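(* Let $m\ge 2$ and let $\mathfrak K_1$ be an arbitrary linear subspace with $\mathfrak K_{\min}\subseteq\mathfrak K_1\subseteq\mathfrak K_{\max}$; all notation is that of the context. 1) Consider $\widetilde\Gamma$ as an operator $A_{\max}\to\mathbb C^{2d}$ (identifying $A_{\max}$ with its graph). Define the operator $$\mathsf\Gamma=(\mathsf\Gamma_0,\mathsf\Gamma_1):=\bigl(\widetilde\Gamma|_{\mathcal H_1\times\mathcal H}\bigr)\,\hat+\,\bigl((\{0\}\times\mathcal H_\bot)\times\{0\}\bigr)$$ from $B_{\max}$ to $\mathbb C^{2d}$. Then $(\mathbb C^d,\mathsf\Gamma_0,\mathsf\Gamma_1)$ is a boundary triple for $B_{\max}$, whose $\gamma$-field $\gamma_{\mathsf\Gamma}$ and Weyl function $M_{\mathsf\Gamma}$ are given on $\mathbb C^d$ by $$\gamma_{\mathsf\Gamma}(z)=[(L-z)^{-1}-(l_1-z)^{-1}]k_{\min}(\cdot),\qquad M_{\mathsf\Gamma}(z)=\widetilde R(z)+\mathcal Q(z),\qquad z\in\rho(\mathcal B_0),$$ where $\mathcal Q$ is the Nevanlinna function $$\mathcal Q(z):=\bigl(\langle f_s,(l_1-z)^{-1}f_{s'}\rangle_{-m}\bigr)_{s,s'=1}^d,\qquad z\in\rho(l_1).$$ 2) Consider instead the operator $\mathsf\Gamma=(\mathsf\Gamma_0,\mathsf\Gamma_1):=\widetilde\Gamma|_{\mathcal H_1}$ from $\operatorname{dom}\mathcal B_{\max}$ to $\mathbb C^{2d}$. Then $(\mathbb C^d,\mathsf\Gamma_0,\mathsf\Gamma_1)$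 is a boundary triple for $\mathcal B_{\max}$, with the same $\gamma$-field $\gamma_{\mathsf\Gamma}$ and the same Weyl function $M_{\mathsf\Gamma}$ as in 1). 3) Let $\mathring l_1:=l_1|_{\mathfrak K_1\ominus\mathfrak K_{\min}}$, a closed symmetric operator in $\mathfrak K_1$ with defect numbers $(d,d)$, whose adjoint in $\mathfrak K_1$ is characterized by $$\mathring l_1^{*}=l_1\,\hat+\,(\{0\}\times\mathfrak K_{\min}),\qquad \mathfrak N_z(\mathring l_1^{*})=(l_1-z)^{-1}(\mathfrak K_{\min}),\quad z\in\rho(l_1).$$ Then the triple $(\mathbb C^d,\mathring\Gamma_0,\mathring\Gamma_1)$, where $\mathring\Gamma=(\mathring\Gamma_0,\mathring\Gamma_1):\mathring l_1^{*}\to\mathbb C^{2d}$, $$\mathring\Gamma_0(k,l_1k+k_{\min}(\chi)):=\chi,\qquad \mathring\Gamma_1(k,l_1k+k_{\min}(\chi)):=-\mathcal G_b^{*}d(k)\qquad(k\in\mathfrak K_1,\ \chi\in\mathbb C^d),$$ is a boundary triple for $\mathring l_1^{*}$ with $\gamma$-field and Weyl function given on $\mathbb C^d$ by $$\gamma_{\mathring\Gamma}(z)=-(l_1-z)^{-1}k_{\min}(\cdot),\qquad M_{\mathring\Gamma}(z)=\mathcal Q(z),\qquad z\in\rho(l_1).$$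
   Context: **Relations and boundary triples.** Scalar products and duality pairings are conjugate-linear in the first argument. Operators are identified with their graphs; a (linear) relation in $\mathfrak H$ is a linear subspace of $\mathfrak H^2$. $\hat+$ denotes the componentwise linear sum of relations (as subspaces), $\hat\oplus$ the orthogonal one, $T|_X:=\{(f,f')\in T: f\in X\}$ the domain restriction, $\mathfrak N_z(T):=\ker(T-z)$, $\widehat{\mathfrak N}_z(T):=\{(f,zf): f\in\mathfrak N_z(T)\}$. For a closed symmetric relation $T$ with defect numbers $(d,d)$, $d<\infty$, a boundary triple for $T^*$ is $(\mathbb C^d,\Gamma_0,\Gamma_1)$ with $\Gamma=(\Gamma_0,\Gamma_1):T^*\to\mathbb C^{2d}$ linear, surjective, and $\langle f,g'\rangle-\langle f',g\rangle=\langle\Gamma_0\hat f,\Gamma_1\hat g\rangle_{\mathbb C^d}-\langle\Gamma_1\hat f,\Gamma_0\hat g\rangle_{\mathbb C^d}$ for all $\hat f=(f,f'),\hat g=(g,g')\in T^*$ (if $T^*$ is an operator, $\Gamma$ is identified with a map on $\operatorname{dom}T^*$). Its $\gamma$-field and Weyl function are $\gamma_\Gamma(z)=\pi_1\hat\gamma_\Gamma(z)$, $M_\Gamma(z)=\Gamma_1\hat\gamma_\Gamma(z)$, where $\hat\gamma_\Gamma(z)=(\Gamma_0|_{\widehat{\mathfrak N}_z(T^* )})^{-1}$ and $\pi_1(f,f')=f$; they are defined for $z\in\rho(T_0)$, $T_0=\ker\Gamma_0$. A matrix Nevanlinna function $M$ is analytic on $\mathbb C\setminus\mathbb R$ with $M(z)^*=M(\bar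 z)$ and $\operatorname{Im}M(z)/\operatorname{Im}z\ge0$. **Scale.** $L$ is a self-adjoint operator (not assumed semibounded) in a separable complex Hilbert space $\mathfrak H_0$. For integers $n\ge0$, $\mathfrak H_n=\operatorname{dom}L^{n/2}$ ($=\operatorname{dom}|L|^{n/2}$) with $\langle f,g\rangle_n=\langle\Omega_nf,\Omega_ng\rangle_0$, where $\Omega_n:\mathfrak H_n\to\mathfrak H_0$ is unitary, $\Omega_0=I$, $\Omega_1(\mathfrak H_2)=\mathfrak H_1$, $\Omega_n(\mathfrak H_{n+2})=\mathfrak H_2$, $L\Omega_n=\Omega_nL$, $\Omega_n$ is self-adjoint in $\mathfrak H_0$, and the $\Omega_n$ mutually commute. $\mathfrak H_{-n}$ is the dual of $\mathfrak H_n$ with pairing $\langle\cdot,\cdot\rangle:\mathfrak H_{-n}\times\mathfrak H_n\to\mathbb C$ and $\langle\psi,\phi\rangle_{-n}=\langle\tilde\Omega_n^{-1}\psi,\tilde\Omega_n^{-1}\phi\rangle_0$, where $\tilde\Omega_n:\mathfrak H_0\to\mathfrak H_{-n}$ is the unitary with $\langle\tilde\Omega_nu,f\rangle=\langle u,\Omega_nf\rangle_0$. $L$ restricted to $\mathfrak H_{n+2}$ is self-adjoint in $\mathfrak H_n$ (denoted $L_n$) and $L$ extends by continuity to a self-adjoint operator in $\mathfrak H_{-n}$ with domain $\mathfrak H_{2-n}$; these, the resolvents and $\Omega_n,\tilde\Omega_n$ are denoted by the same symbols $L$, $(L-z)^{-1}$, $\Omega_n$. **Functionals.** Let $m\geq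 2$, $1\le d<\infty$, $\varphi_1,\dots,\varphi_d\in\mathfrak H_{-m-2}\setminus\mathfrak H_{-m-1}$ linearly independent, and $\langle\varphi,f\rangle:=(\langle\varphi_s,f\rangle)_{s}$. $L_{\min}$ is the restriction of $L$ to $\{f\in\mathfrak H_{m+2}:\langle\varphi,f\rangle=0\}$; it is closed, densely defined, symmetric in $\mathfrak H_m$ with defect numbers $(d,d)$ (standing). $P(L):=\Omega_m^2$. For $z\in\rho(L)$, $c\in\mathbb C^d$: $g_s(z)=(L-z)^{-1}\varphi_s$, $g_z(c)=\sum_sc_sg_s(z)$, $G_s(z)=P(L)^{-1}g_s(z)$, $G_z(c)=\sum_sc_sG_s(z)$. The functionals $\langle\varphi_s,\cdot\rangle$ on $\mathfrak H_{m+2}$ have fixed linear continuations to $\mathfrak H_m$ (same notation) such that $R(z)=(\langle\varphi_s,G_{s'}(z)\rangle)_{s,s'}$, $z\in\rho(L)$, is a matrix Nevanlinna function (extended to $\rho(L)$). $L_{\max}$ is the triplet adjoint of $L_{\min}$: $L_{\max}=\{(\psi,\phi)\in\mathfrak H_{-m}^2:\langle\phi,f\rangle=\langle\psi,Lf\rangle\ \forall f\in\operatorname{dom}L_{\min}\}$. **Exit space.** Let $z_1,\dots,z_m\in\rho(L)$ be distinct; $s,s'$ run over $\{1,\dots,d\}$, $j,j'$ over $\{1,\dots,m\}$, and $i=m(s-1)+j$, $i'=m(s'-1)+j'$. $\mathfrak K=\operatorname{span}\{g_i:=g_s(z_j)\}$ is $md$-dimensional with scalar product $\langle\cdot,\cdot\rangle_{-m}$,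 $\mathcal G=(\langle g_i,g_{i'}\rangle_{-m})$, $k=\sum_id_i(k)g_i$ and $d(k)=(d_i(k))\in\mathbb C^{md}$. $\mathcal H=\mathfrak H_m\dotplus\mathfrak K$ with $\langle f+k,f'+k'\rangle_{\mathcal H}=\langle f,f'\rangle_m+\langle k,k'\rangle_{-m}$. $\widetilde P(L)=\prod_j(L-z_j)$, $f_s=\widetilde P(L)^{-1}\varphi_s$, $\mathfrak K_{\min}=\mathfrak K\cap\mathfrak H_{m-2}=\operatorname{span}\{f_s\}$, $k_{\min}(\chi)=\sum_s\chi_sf_s$, $\mathcal G_b=(\langle g_i,f_{s'}\rangle_{-m})$ ($md\times d$). $e_s=P(L)^{-1}\varphi_s$, $\mathcal C=\mathcal B^{-1}\mathcal A$ with $\mathcal A=(\langle e_s,f_{s'}\rangle_{-m})$, $\mathcal B=(\langle e_s,e_{s'}\rangle_{-m})$; it is standing that $f_s=\sum_{s'}\mathcal C_{s's}e_{s'}$ and $\mathcal C$ is nonsingular. $\widetilde G_z(c):=G_z(\mathcal Cc)=\widetilde P(L)^{-1}g_z(c)$, $\widetilde R(z):=\mathcal C^*R(z)\mathcal C$. **Operators in $\mathcal H$.** $l$ is the operator in $\mathfrak K$ with $lg_s(z_j)=z_jg_s(z_j)$; $A_0=L_m\hat+l$ (domain $\mathfrak H_{m+2}\dotplus\mathfrak K$); $A_{\max}=L_{\max}\cap\mathcal H^2$, an operator with $A_{\max}=A_0\hat+\{(\widetilde G_z(c),z\widetilde G_z(c)+k_{\min}(c)):c\in\mathbb C^d\}$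 for any $z\in\rho(A_0)=\rho(L)\setminus\{z_1,\dots,z_m\}$. $\widetilde\Gamma=(\widetilde\Gamma_0,\widetilde\Gamma_1):\operatorname{dom}A_{\max}\to\mathbb C^{2d}$ is given, for $f\in\mathfrak H_{m+2}$, $k\in\mathfrak K$, $c\in\mathbb C^d$, by $\widetilde\Gamma_0(f+k+\widetilde G_z(c))=c$, $\widetilde\Gamma_1(f+k+\widetilde G_z(c))=\mathcal C^*\langle\varphi,f\rangle+\widetilde R(z)c-\mathcal G_b^*d(k)$ (independent of $z$). $A_{\min}=A_{\max}^*$ (adjoint in $\mathcal H$). **Exit subspace.** $c(k)=(c_s(k))$, $c_s(k)=\sum_jd_{m(s-1)+j}(k)$; $\mathcal M$ is the $d\times md$ matrix $\mathcal M_{si'}=R_{ss'}(z_{j'})$; $\mathfrak K_{\max}=\{k\in\mathfrak K:\operatorname{Im}\langle c(k),\mathcal Md(k)\rangle_{\mathbb C^d}=0\}$. $\mathfrak K_1$ carries $\langle\cdot,\cdot\rangle_{-m}$; $\mathcal H_\bot=\mathfrak K\ominus\mathfrak K_1$; $\mathcal H_1=\mathfrak H_m\dotplus\mathfrak K_1\subseteq\mathcal H$. $l_1=P_{\mathfrak K_1}l|_{\mathfrak K_1}$ ($P_{\mathfrak K_1}$ orthogonal projection in $\mathfrak K$), self-adjoint in $\mathfrak K_1$. $B_{\max}=A_{\max}|_{\mathcal H_1}\hat+(\{0\}\times\mathcal H_\bot)$, the adjoint in $\mathcal H$ of the closed symmetric relation $B_{\min}=B_{\max}^*$. $\mathcal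 B_0=L_m\hat+l_1$, a self-adjoint operator in $\mathcal H_1$. $\mathcal B_{\min}=P_{\mathcal H_1}A_{\min}|_{\mathcal H_1}$ is closed, densely defined, symmetric in $\mathcal H_1$ with defect numbers $(d,d)$, and $\mathcal B_{\max}=\mathcal B_{\min}^*$ (adjoint in $\mathcal H_1$) is the operator part $P_{\mathcal H_1}A_{\max}|_{\mathcal H_1}$ of $B_{\max}$. *)

(* Defs.v *)
From HB Require Import structures.
From mathcomp Require Import all_boot all_order all_algebra.
From mathcomp Require Import complex.
From mathcomp Require Import all_classical all_reals all_analysis.

Set Implicit Arguments.
Unset Strict Implicit.
Unset Printing Implicit Defensive.

Import Order.TTheory GRing.Theory Num.Theory.
Import numFieldNormedType.Exports.

Local Open Scope classical_set_scope.
Local Open Scope ring_scope.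

(* lets a space below be applied to a vector, as sets are *)
Identity Coercion fun_of_set : set >-> Funclass.

(** * Linear relations in inner product spaces

    All spaces live inside one ambient complex vector space [X]: a space is a
    subset of [X] with a form that is only meaningful on that subset.
    A relation is a subset of [X * X]; an operator is identified with its
    graph. *)

Section LinearSets.
Variables (K : fieldType) (V : lmodType K).

Definition is_subspace (A : set V) : Prop :=
  A 0 /\ forall (a : K) u v, A u -> A v -> A (a *: u + v).

Definition ssum (A B : set V) : set V :=
  [set w | exists u v, [/\ A u, B v & w = u + v]].

Definition lin_indep (n : nat) (b : 'I_n -> V) : Prop :=
  forall a : 'I_n -> K, \sum_i a i *: b i = 0 -> forall i, a i = 0.

Definition span (n : nat) (b : 'I_n -> V) : set V :=
  [set v | exists a : 'I_n -> K, v = \sum_i a i *: b i].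

Definition has_dim (A : set V) (n : nat) : Prop :=
  exists b : 'I_n -> V, lin_indep b /\ A = span b.

End LinearSets.

Section Spaces.
Variables (R : realType) (X : lmodType R[i]).
Local Notation C := R[i].

Record hspace := HSpace { hset :> set X; hip : X -> X -> C }.

Definition hnorm (E : hspace) (x : X) : C := sqrtC (hip E x x).

(* conjugate-linear in the first argument *)
Definition is_inner (E : hspace) : Prop :=
  [/\ is_subspace E,
      forall a x y w, E x -> E y -> E w ->
        hip E x (a *: y + w) = a * hip E x y + hip E x w,
      forall x y, E x -> E y -> hip E y x = (hip E x y)^*,
      forall x, E x -> 0 <= hip E x x
    & forall x, E x -> hip E x x = 0 -> x = 0].

Definition is_complete (E : hspace) : Prop :=
  forall u : nat -> X, (forall n, E (u n)) ->
    (forall e : C, 0 < e -> exists N : nat, forall p q : nat,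
      (N <= p)%N -> (N <= q)%N -> hnorm E (u p - u q) < e) ->
    exists2 x, E x & forall e : C, 0 < e -> exists N : nat, forall n : nat,
      (N <= n)%N -> hnorm E (u n - x) < e.

Definition is_hilbert (E : hspace) : Prop := is_inner E /\ is_complete E.

Definition is_separable (E : hspace) : Prop :=
  exists u : nat -> X, (forall n, E (u n)) /\
    forall x (e : C), E x -> 0 < e -> exists n, hnorm E (x - u n) < e.

Definition is_dense (E : hspace) (D : set X) : Prop :=
  D `<=` E /\
  forall x (e : C), E x -> 0 < e -> exists2 y, D y & hnorm E (x - y) < e.

Implicit Types T : set (X * X).

Definition rdom (Y : Type) (T : set (X * Y)) : set X :=
  [set x | exists y, T (x, y)].

Definition is_op (Y : Type) (T : set (X * Y)) : Prop :=
  forall x y y', T (x, y) -> T (x, y') -> y = y'.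

Definition graph_on (A : set X) (F : X -> X) : set (X * X) :=
  [set p | A p.1 /\ p.2 = F p.1].

Definition rcomp T1 T2 : set (X * X) :=
  [set p | exists y, T2 (p.1, y) /\ T1 (y, p.2)].

Definition rpow (E : hspace) T (n : nat) : set (X * X) :=
  iter n (rcomp T) (graph_on E id).

Definition linrel (E : hspace) T : Prop :=
  is_subspace T /\ forall p, T p -> E p.1 /\ E p.2.

Definition rclosure (E : hspace) T : set (X * X) :=
  [set p | [/\ E p.1, E p.2 & forall e : C, 0 < e ->
     exists q, [/\ T q, hnorm E (p.1 - q.1) < e & hnorm E (p.2 - q.2) < e]]].

Definition closed_rel (E : hspace) T : Prop :=
  linrel E T /\ rclosure E T `<=` T.

Definition adj (E : hspace) T : set (X * X) :=
  [set p | [/\ E p.1, E p.2 &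
     forall q, T q -> hip E q.2 p.1 = hip E q.1 p.2]].

Definition symmetric_rel (E : hspace) T : Prop :=
  linrel E T /\ T `<=` adj E T.

Definition selfadjoint (E : hspace) T : Prop := T = adj E T.

Definition selfadjoint_op (E : hspace) T : Prop := is_op T /\ selfadjoint E T.

Definition nonneg_selfadjoint_op (E : hspace) T : Prop :=
  selfadjoint_op E T /\ forall p, T p -> 0 <= hip E p.1 p.2.

(* N_z(T) = ker (T - z) *)
Definition eigspace T (z : C) : set X := [set x | T (x, z *: x)].

(* defect numbers (d, d) *)
Definition defect (E : hspace) T (d : nat) : Prop :=
  forall z : C, 'Im z != 0 -> has_dim (eigspace (adj E T) z) d.

(* resolvent set: (T - z)^{-1} is an everywhere defined bounded operator *)
Definition rho (E : hspace) T : set C :=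
  [set z | (forall y, E y -> exists! x, T (x, y + z *: x)) /\
           exists M : C, forall p, T p ->
             hnorm E p.1 <= M * hnorm E (p.2 - z *: p.1)].

(* (T - z)^{-1} y *)
Definition resolvent T (z : C) (y : X) : X :=
  xget 0 [set x | T (x, y + z *: x)].

(* P_S T |_S, with P_S the orthogonal projection of E onto S *)
Definition compression (E : hspace) (S : set X) T : set (X * X) :=
  [set p | [/\ S p.1, S p.2 & exists2 y, T (p.1, y) &
     forall w, S w -> hip E w (y - p.2) = 0]].

Definition orth_minus (E : hspace) (A B : set X) : set X :=
  [set x | A x /\ forall y, B y -> hip E y x = 0].

End Spaces.

Arguments hnorm {R X} E x.

(** * Matrix-valued functions *)

Section MatrixFunctions.
Variable R : realType.
Local Notation C := R[i].

Definition mxadj (p q : nat) (A : 'M[C]_(p, q)) : 'M[C]_(q, p) :=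
  map_mx (fun x : C => x^*) A^T.

Definition dotc (n : nat) (u v : 'cV[C]_n) : C :=
  \sum_i (u i 0)^* * v i 0.

Definition mxIm (n : nat) (A : 'M[C]_n) : 'M[C]_n :=
  (2%:R * 'i)^-1 *: (A - mxadj A).

(* Over the field R[i], [derivable _ z 1] is complex differentiability. *)
Definition nevanlinna (n : nat) (M : C -> 'M[C]_n) : Prop :=
  forall z : C, 'Im z != 0 ->
    [/\ forall i j, derivable (fun w : C^o => M w i j : C^o) z 1,
        mxadj (M z) = M z^*
      & forall c : 'cV[C]_n, 0 <= dotc c (mxIm (M z) *m c) / 'Im z].

End MatrixFunctions.

(** * Boundary triples

    A boundary map is given by its graph in [(X * X) * (C^d * C^d)], the
    element [((f, f'), (a, b))] meaning Gamma_0 (f, f') = a and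
    Gamma_1 (f, f') = b. *)

Section BoundaryTriples.
Variables (R : realType) (X : lmodType R[i]) (d : nat).
Local Notation C := R[i].
Local Notation bmap := (set ((X * X) * ('cV[C]_d * 'cV[C]_d))).

Definition boundary_triple (E : hspace X) (Tstar : set (X * X)) (G : bmap) :
    Prop :=
  (exists T, [/\ closed_rel E T, symmetric_rel E T, defect E T d
               & Tstar = adj E T]) /\
  [/\ [set p | exists ab, G (p, ab)] = Tstar,
      forall p ab ab', G (p, ab) -> G (p, ab') -> ab = ab',
      is_subspace G,
      forall ab, exists p, G (p, ab)
    & forall p ab q ab', G (p, ab) -> G (q, ab') ->
        hip E p.1 q.2 - hip E p.2 q.1 = dotc ab.1 ab'.2 - dotc ab.2 ab'.1].

(* A map on a domain, seen as a map on the graph of an operator T. *)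
Definition on_graph (T : set (X * X)) (G : set (X * ('cV[C]_d * 'cV[C]_d))) :
    bmap :=
  [set r | T r.1 /\ G (r.1.1, r.2)].

Definition boundary_triple_op (E : hspace X) (Tstar : set (X * X))
    (G : set (X * ('cV[C]_d * 'cV[C]_d))) : Prop :=
  [/\ is_op Tstar, rdom G = rdom Tstar
    & boundary_triple E Tstar (on_graph Tstar G)].

Definition ker0 (G : bmap) : set (X * X) :=
  [set p | exists b, G (p, (0, b))].

(* inverse of the restriction of Gamma_0 to {(f, z f)} *)
Definition gamma_hat (G : bmap) (z : C) : set ('cV[C]_d * (X * X)) :=
  [set r | r.2.2 = z *: r.2.1 /\ exists b, G (r.2, (r.1, b))].

Definition gamma_field (G : bmap) (z : C) : set ('cV[C]_d * X) :=
  [set r | exists f', gamma_hat G z (r.1, (r.2, f'))].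

Definition weyl (G : bmap) (z : C) : set ('cV[C]_d * 'cV[C]_d) :=
  [set r | exists p a, gamma_hat G z (r.1, p) /\ G (p, (a, r.2))].

(* The gamma-field and the Weyl function have domain D, and there they are the
   everywhere defined maps c |-> gam z c and c |-> M z *m c. *)
Definition gamma_weyl_given_by (E : hspace X) (G : bmap) (D : set C)
    (gam : C -> 'cV[C]_d -> X) (M : C -> 'M[C]_d) : Prop :=
  rho E (ker0 G) = D /\
  forall z, D z ->
    gamma_field G z = [set r | r.2 = gam z r.1] /\
    weyl G z = [set r | r.2 = M z *m r.1].

End BoundaryTriples.

(** * The scale of spaces of a self-adjoint operator *)

(* The ambient space sX contains all the spaces of the scale, so that the
   inclusions H_n <= H_0 <= H_{-n} are inclusions of subsets.  [sOm n] is only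
   meaningful on H_n, and [spair psi f] only for psi in H_{-n}, f in H_n.
   [sabsL] and [ssqrtL] are |L| and |L|^{1/2}. *)
Record scale_data (R : realType) := ScaleData {
  sX : lmodType R[i];
  sH0 : hspace sX;
  sL : set (sX * sX);
  sabsL : set (sX * sX);
  ssqrtL : set (sX * sX);
  sOm : forall n : nat, sX -> sX;
  sneg : forall n : nat, set sX;
  spair : forall psi f : sX, R[i]
}.

Arguments sH0 {R} s.
Arguments sL {R} s.
Arguments sabsL {R} s.
Arguments ssqrtL {R} s.
Arguments sOm {R} s n.
Arguments sneg {R} s n.
Arguments spair {R s} psi f.

Section Scale.
Variables (R : realType) (S : scale_data R).
Local Notation C := R[i].
Local Notation X := (sX S).

(* H_n, n >= 0 *)
Definition Hp (n : nat) : hspace X :=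
  HSpace (rdom (rpow (sH0 S) (ssqrtL S) n))
         (fun f g => hip (sH0 S) (sOm S n f) (sOm S n g)).

(* inverse of the unitary H_0 -> H_{-n}, u |-> (f |-> <u, Om_n f>_0) *)
Definition OmtV (n : nat) (psi : X) : X :=
  xget 0 [set u | sH0 S u /\
    forall f, Hp n f -> spair psi f = hip (sH0 S) u (sOm S n f)].

(* H_{-n}, n >= 0 *)
Definition Hn (n : nat) : hspace X :=
  HSpace (sneg S n) (fun psi phi => hip (sH0 S) (OmtV n psi) (OmtV n phi)).

Definition Omg (n : nat) : set (X * X) := graph_on (Hp n) (sOm S n).

Record is_scale : Prop := IsScale {
  sc_hilbert : is_hilbert (sH0 S);
  sc_separable : is_separable (sH0 S);
  sc_L : selfadjoint_op (sH0 S) (sL S);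
  (* |L| and |L|^{1/2} as the unique nonnegative square roots *)
  sc_absL : nonneg_selfadjoint_op (sH0 S) (sabsL S);
  sc_absLE : rcomp (sabsL S) (sabsL S) = rcomp (sL S) (sL S);
  sc_sqrtL : nonneg_selfadjoint_op (sH0 S) (ssqrtL S);
  sc_sqrtLE : rcomp (ssqrtL S) (ssqrtL S) = sabsL S;
  (* dom L^n = dom |L|^n *)
  sc_dom : forall n, rdom (rpow (sH0 S) (sL S) n) = Hp n.*2;
  sc_Om_lin : forall n a f g, Hp n f -> Hp n g ->
    sOm S n (a *: f + g) = a *: sOm S n f + sOm S n g;
  (* unitary, in view of the form chosen on H_n *)
  sc_Om_in : forall n f, Hp n f -> sH0 S (sOm S n f);
  sc_Om_bij : forall n u, sH0 S u -> exists! f, Hp n f /\ sOm S n f = u;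
  sc_Om0 : forall f, sH0 S f -> sOm S 0 f = f;
  sc_Om1 : sOm S 1 @` Hp 2 = Hp 1;
  sc_Om2 : forall n, sOm S n @` Hp n.+2 = Hp 2;
  sc_OmL : forall n, rcomp (sL S) (Omg n) = rcomp (Omg n) (sL S);
  sc_Om_sa : forall n, selfadjoint_op (sH0 S) (Omg n);
  sc_OmC : forall n k, rcomp (Omg n) (Omg k) = rcomp (Omg k) (Omg n);
  (* H_{-n} is the dual of H_n *)
  sc_neg0 : sneg S 0 = sH0 S;
  sc_negS : forall n, sneg S n `<=` sneg S n.+1;
  sc_neg_sub : forall n, is_subspace (sneg S n);
  sc_pair0 : forall u f, sH0 S u -> sH0 S f -> spair u f = hip (sH0 S) u f;
  sc_pairl : forall n a psi phi f, sneg S n psi -> sneg S n phi -> Hp n f ->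
    spair (a *: psi + phi) f = a^* * spair psi f + spair phi f;
  sc_pairr : forall n a psi f g, sneg S n psi -> Hp n f -> Hp n g ->
    spair psi (a *: f + g) = a * spair psi f + spair psi g;
  sc_pair_bdd : forall n psi, sneg S n psi ->
    exists M : C, forall f, Hp n f -> `|spair psi f| <= M * hnorm (Hp n) f;
  sc_pair_inj : forall n psi, sneg S n psi ->
    (forall f, Hp n f -> spair psi f = 0) -> psi = 0;
  sc_pair_surj : forall n (F : X -> C),
    (forall a f g, Hp n f -> Hp n g -> F (a *: f + g) = a * F f + F g) ->
    (exists M : C, forall f, Hp n f -> `|F f| <= M * hnorm (Hp n) f) ->
    exists2 psi, sneg S n psi & forall f, Hp n f -> F f = spair psi f
}.

(* L_n: L restricted to H_{n+2} *)
Definition Lres (n : nat) : set (X * X) := [set p | sL S p /\ Hp n.+2 p.1].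

(* The extensions by continuity of L and of Om_n to H_{-k}. *)
Definition Lext (k : nat) : set (X * X) := rclosure (Hn k) (sL S).
Definition Omext (k n : nat) : set (X * X) := rclosure (Hn k) (Omg n).

(* P(L)^{-1} psi, for P(L) = Om_m^2 extended to H_{-k} *)
Definition Pinv (k m : nat) (psi : X) : X :=
  xget 0 [set e | rcomp (Omext k m) (Omext k m) (e, psi)].

Definition rhoL : set C := rho (sH0 S) (sL S).

End Scale.

Arguments Hp {R} S n.
Arguments Hn {R} S n.
Arguments Lres {R} S n.
Arguments Lext {R} S k.
Arguments Pinv {R} S k m psi.
Arguments rhoL {R} S.

(** * Functionals, exit space and operators

    [phi] is the family of functionals, [phic s] the continuation of
    <phi_s, .> to H_m, [zs] the family of points z_1, ..., z_m, and [K1] the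
    subspace of the exit space. *)

Section Model.
Variables (R : realType) (S : scale_data R) (m d : nat).
Local Notation C := R[i].
Local Notation X := (sX S).
Variables (phi : 'I_d -> X) (phic : 'I_d -> X -> C) (zs : 'I_m -> C).
Variable K1 : set X.

(* L, (L - z)^{-1} and P(L)^{-1} on H_{-m-2}, the largest space needed; their
   parts in the smaller spaces of the scale carry the same symbols. *)
Definition Lx : set (X * X) := Lext S m.+2.
Definition RL (z : C) (psi : X) : X := resolvent Lx z psi.
Definition PLinv (psi : X) : X := Pinv S m.+2 m psi.

Definition phiv (f : X) : 'cV[C]_d := \col_s spair (phi s) f.

Definition Lmin : set (X * X) :=
  [set p | [/\ sL S p, Hp S m.+2 p.1 & phiv p.1 = 0]].

Definition Lmax : set (X * X) :=
  [set p | [/\ Hn S m p.1, Hn S m p.2 &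
     forall q, Lmin q -> spair p.2 q.1 = spair p.1 q.2]].

Definition gs (s : 'I_d) (z : C) : X := RL z (phi s).
Definition Gs (s : 'I_d) (z : C) : X := PLinv (gs s z).
Definition Gz (z : C) (c : 'cV[C]_d) : X := \sum_s c s 0 *: Gs s z.

Definition Rmx (z : C) : 'M[C]_d := \matrix_(s, s') phic s (Gs s' z).

(* the pair (s, j) with i = mxvec_index s j, that is i = m * s + j *)
Definition ix (i : 'I_(d * m)) : 'I_d * 'I_m :=
  enum_val (cast_ord (esym (mxvec_cast d m)) i).

Definition gi (i : 'I_(d * m)) : X := gs (ix i).1 (zs (ix i).2).

Definition Kx : hspace X := HSpace (span gi) (hip (Hn S m)).

Definition dvec (k : X) : 'cV[C]_(d * m) :=
  xget 0 [set a : 'cV[C]_(d * m) | k = \sum_i a i 0 *: gi i].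

(* The component in H_m of an element of the direct sum of H_m and K. *)
Definition prm (x : X) : X := xget 0 [set f | Hp S m f /\ Kx (x - f)].

Definition Hip (x y : X) : C :=
  hip (Hp S m) (prm x) (prm y) + hip (Hn S m) (x - prm x) (y - prm y).

Definition Hcal : hspace X := HSpace (ssum (Hp S m) Kx) Hip.

Definition fs (s : 'I_d) : X :=
  foldr (fun j => RL (zs j)) (phi s) (enum 'I_m).
Definition es (s : 'I_d) : X := PLinv (phi s).

Definition Kmin : set X := Kx `&` Hp S (m - 2).
Definition kmin (c : 'cV[C]_d) : X := \sum_s c s 0 *: fs s.

Definition Gb : 'M[C]_(d * m, d) := \matrix_(i, s) hip (Hn S m) (gi i) (fs s).
Definition Amx : 'M[C]_d := \matrix_(s, s') hip (Hn S m) (es s) (fs s').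
Definition Bmx : 'M[C]_d := \matrix_(s, s') hip (Hn S m) (es s) (es s').
Definition Cmx : 'M[C]_d := invmx Bmx *m Amx.

Definition Gtz (z : C) (c : 'cV[C]_d) : X := Gz z (Cmx *m c).
Definition Rt (z : C) : 'M[C]_d := mxadj Cmx *m Rmx z *m Cmx.

Definition lop : set (X * X) :=
  [set p | exists a : 'I_(d * m) -> C,
     p.1 = \sum_i a i *: gi i /\
     p.2 = \sum_i (a i * zs (ix i).2) *: gi i].

Definition A0 : set (X * X) := ssum (Lres S m) lop.
Definition Amax : set (X * X) :=
  [set p | [/\ Lmax p, Hcal p.1 & Hcal p.2]].
Definition Amin : set (X * X) := adj Hcal Amax.

Definition Gammat : set (X * ('cV[C]_d * 'cV[C]_d)) :=
  [set r | exists z f k c, [/\ rho Hcal A0 z, Hp S m.+2 f, Kx k,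
     r.1 = f + k + Gtz z c &
     r.2 = (c, mxadj Cmx *m phiv f + Rt z *m c - mxadj Gb *m dvec k)]].

Definition cvec (k : X) : 'cV[C]_d := \col_s \sum_j dvec k (mxvec_index s j) 0.
Definition Mmx : 'M[C]_(d, d * m) :=
  \matrix_(s, i) Rmx (zs (ix i).2) s (ix i).1.

Definition Kmax : set X :=
  [set k | Kx k /\ 'Im (dotc (cvec k) (Mmx *m dvec k)) = 0].

Definition K1x : hspace X := HSpace K1 (hip (Hn S m)).
Definition Hbot : set X := orth_minus Kx Kx K1.
Definition H1 : hspace X := HSpace (ssum (Hp S m) K1) Hip.
Definition l1 : set (X * X) := compression Kx K1 lop.

Definition mulHbot : set (X * X) := [set p | p.1 = 0 /\ Hbot p.2].
Definition Bmax : set (X * X) :=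
  ssum [set p | Amax p /\ H1 p.1] mulHbot.

Definition calB0 : set (X * X) := ssum (Lres S m) l1.
Definition calBmin : set (X * X) := compression Hcal H1 Amin.
Definition calBmax : set (X * X) := adj H1 calBmin.

Definition Qmx (z : C) : 'M[C]_d :=
  \matrix_(s, s') hip (Hn S m) (fs s) (resolvent l1 z (fs s')).

Definition gammaB (z : C) (c : 'cV[C]_d) : X :=
  RL z (kmin c) - resolvent l1 z (kmin c).
Definition weylB (z : C) : 'M[C]_d := Rt z + Qmx z.

Definition GammaB : set ((X * X) * ('cV[C]_d * 'cV[C]_d)) :=
  ssum [set r | [/\ on_graph Amax Gammat r, H1 r.1.1 & Hcal r.1.2]]
       [set r | mulHbot r.1 /\ r.2 = 0].

Definition GammacalB : set (X * ('cV[C]_d * 'cV[C]_d)) :=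
  [set r | Gammat r /\ H1 r.1].

Definition l1ring : set (X * X) :=
  [set p | l1 p /\ orth_minus K1x K1 Kmin p.1].
Definition l1ringadj : set (X * X) := adj K1x l1ring.

Definition Gammaring : set ((X * X) * ('cV[C]_d * 'cV[C]_d)) :=
  [set r | exists k k' c, [/\ l1 (k, k'), r.1 = (k, k' + kmin c)
     & r.2 = (c, - (mxadj Gb *m dvec k))]].

Definition gammaring (z : C) (c : 'cV[C]_d) : X := - resolvent l1 z (kmin c).

End Model.

(* Main.v *)
(** Both operator triples are instances of one explicit map.  For a fixed
    nonreal [z0], an element of the maximal domain is uniquely
    [f + k + (L - z0)^-1 k_min(c)] with [f] in [H_{m+2}] and [k] in [K1], and its
    boundary values are [c] and [C^* <phi, f> + R~(z0) c - G_b^* d(k)].  A linear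
    map onto [C^d x C^d] that satisfies Green's identity, and for which
    [ker Gamma_0 - z] is onto for all nonreal [z], is a boundary triple: adjoints,
    closedness and defect numbers follow from these properties.

    On [H_m] Green's identity comes from the resolvent identity for [R~]; on the
    exit space it is the symmetry of [l1], which is what [K_max] encodes, since
    [<k, l k> - <l k, k>] is the difference of [<c(k), M d(k)>] and its
    conjugate.  The spaces [H_{-n}] are handled inside [H_0], through the inverse
    of the extended [Omega_n], which turns the extended resolvents into those of
    [L]. *)
From mathcomp Require Import all_boot all_order all_algebra.
From mathcomp Require Import complex.
From mathcomp Require Import all_classical all_reals all_analysis.
From mathcomp Require Import ring lra.
Require Import Defs.

Set Implicit Arguments.
Unset Strict Implicit.
Unset Printing Implicit Defensive.

Import Order.TTheory GRing.Theory Num.Theory.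
Import numFieldNormedType.Exports.
Local Open Scope classical_set_scope.
Local Open Scope ring_scope.

(** * Linear identities in modules *)

(** The hypotheses keep each [phi s] out of $\mathfrak H_{-m-1}$ but do not speak of combinations.
    Density of the domain of [Lmin] does: a combination in $\mathfrak H_{-m}$ would be continuous on
    $\mathfrak H_m$ and vanish on a dense set. Hence, with [U] the map [OmtV m.+2], no nonzero
    combination of the [U (phi s)] lies in $\mathfrak H_2=\operatorname{dom}L$. This fact carries
    the structure of the exit space. Under [U] a vector of $\mathfrak K$ is a sum over the points
    $z_j$ of resolvents of such combinations, and membership in $\mathfrak H_{-m}$, $\mathfrak
    H_{m-2}$, $\mathfrak H_m$ becomes membership of the image in $\mathfrak H_2$, $\mathfrak
    H_{2m}$, $\mathfrak H_{2m+2}$. Applying $L-z_j$ removes one point and two orders of smoothness;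
    counting orders gives independence of the $g_i$, $\mathfrak K\cap\mathfrak
    H_{m-2}=\operatorname{span}\{f_s\}$ and $\mathfrak K\cap\mathfrak H_m=0$. The obstacle is that
    $\Omega_m$ and $\Omega_{m+2}$ are tied only by commutation, with each other and with $L$, and by
    their ranges. Every passage between the pairings at levels [m] and [m+2] has to be made from
    these alone. *)

Section LinearExpressions.
Variables (R : realType) (V : lmodType R[i]).
Local Notation K := R[i].

(** Syntax for linear combinations over an environment of atoms: an identity between two of them
    reduces to one scalar identity per atom, which [ring] decides. *)
Inductive lexpr :=
| LVar of nat | LZero | LAdd of lexpr & lexpr | LOpp of lexpr | LScale of K & lexpr.

Fixpoint leval (env : seq V) (e : lexpr) : V :=
  match e with
  | LVar n => nth 0 env n
  | LZero => 0
  | LAdd e1 e2 => leval env e1 + leval env e2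
  | LOpp e1 => - leval env e1
  | LScale a e1 => a *: leval env e1
  end.

Fixpoint lcoef (e : lexpr) (i : nat) : K :=
  match e with
  | LVar n => if eqn n i then 1 else 0
  | LZero => 0
  | LAdd e1 e2 => lcoef e1 i + lcoef e2 i
  | LOpp e1 => - lcoef e1 i
  | LScale a e1 => a * lcoef e1 i
  end.

(** A conjunction by recursion rather than a quantifier, so that reduction for a concrete
    environment leaves one equation per atom. *)
Fixpoint lsame (k n : nat) (e1 e2 : lexpr) : Prop :=
  match n with
  | 0%N => True
  | n'.+1 => lcoef e1 k = lcoef e2 k /\ lsame k.+1 n' e1 e2
  end.

Lemma leval_coef env e : leval env e = \sum_(i < size env) lcoef e i *: nth 0 env i.
Proof.
elim: e => /= [n||e1 -> e2 ->|e1 ->|a e1 ->].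
- have [hn|hn] := ltnP n (size env).
    rewrite (bigD1 (Ordinal hn)) //= big1 ?addr0 => [|i]; first by rewrite eqnE eqxx scale1r.
    by rewrite -val_eqE /= eqnE eq_sym => /negPf ->; rewrite scale0r.
  rewrite nth_default // big1 // => i _.
  by rewrite eqnE gtn_eqF ?scale0r // (leq_trans (ltn_ord i)).
- by rewrite big1 // => i _; rewrite scale0r.
- by rewrite -big_split; apply: eq_bigr => i _; rewrite scalerDl.
- by rewrite -sumrN; apply: eq_bigr => i _; rewrite scaleNr.
- by rewrite scaler_sumr; apply: eq_bigr => i _; rewrite scalerA.
Qed.

Lemma lsame_eq env e1 e2 : lsame 0 (size env) e1 e2 -> leval env e1 = leval env e2.
Proof.
move=> h; rewrite !leval_coef; apply: eq_bigr => -[i hi] _ /=; congr (_ *: _).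
have gen k n : lsame k n e1 e2 -> forall j, (k <= j < k + n)%N -> lcoef e1 j = lcoef e2 j.
  elim: n k => [|n IH] k /=; first by move=> _ j; rewrite addn0; case: ltngtP.
  move=> [h0 h1] j /andP[kj jn]; move: kj; rewrite leq_eqVlt => /orP[/eqP <- //|kj].
  by apply: (IH k.+1) => //; rewrite kj addSnnS.
exact: (gen _ _ h).
Qed.

End LinearExpressions.

(* Big sums may differ in the inferred structure only, hence the unification. *)
Ltac lm_same x y :=
  match constr:((x, y)) with
  | (?a, ?a) => constr:(true)
  | (bigop.body _ _ _, bigop.body _ _ _) =>
      let _ := match goal with _ => unify x y end in constr:(true)
  | _ => constr:(false)
  end.
Ltac lm_has x l :=
  lazymatch l with
  | nil => constr:(false)
  | cons ?y ?l' => lazymatch lm_same x y with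
      | true => constr:(true)
      | _ => lm_has x l' end
  end.
Ltac lm_atoms e l :=
  lazymatch e with
  | GRing.add ?a ?b => let l := lm_atoms a l in lm_atoms b l
  | GRing.opp ?a => lm_atoms a l
  | GRing.scale _ ?a => lm_atoms a l
  | GRing.zero => l
  | _ => lazymatch lm_has e l with true => l | _ => constr:(cons e l) end
  end.
Ltac lm_index x l :=
  lazymatch l with
  | cons ?y ?l' => lazymatch lm_same x y with
      | true => constr:(0%N)
      | _ => let n := lm_index x l' in constr:(S n) end
  end.
Ltac lm_reify K e l :=
  lazymatch e with
  | GRing.add ?a ?b => let a := lm_reify K a l in let b := lm_reify K b l in
      constr:(@LAdd K a b)
  | GRing.opp ?a => let a := lm_reify K a l in constr:(@LOpp K a)
  | GRing.scale ?c ?a => let a := lm_reify K a l in constr:(@LScale K c a)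
  | GRing.zero => constr:(@LZero K)
  | _ => let n := lm_index e l in constr:(@LVar K n)
  end.
(** Stops before the scalar goals, so that [field] can take the place of [ring] when coefficients
    contain quotients. *)
Ltac lmod_core :=
  lazymatch goal with
  | |- @eq ?T ?a ?b =>
    let l := lm_atoms a (@nil T) in
    let l := lm_atoms b l in
    match T with
    | context [?X] =>
      let tX := type of X in
      lazymatch tX with
      | GRing.Lmodule.type _ =>
      match tX with
      | context [?r] =>
        let K := constr:(r : realType) in
        let ea := lm_reify r a l in
        let eb := lm_reify r b l in
        refine (@lsame_eq r X l ea eb _)
      end end
    end
  end; rewrite /lsame /=; repeat split.

(* equality in a module, by comparing the coefficients of the atoms *)
Ltac lmod := lmod_core; ring.

Section Subspaces.
Variables (K : fieldType) (V : lmodType K) (A : set V) (hA : is_subspace A).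

Lemma subspace0 : A 0. Proof. by case: hA. Qed.

Lemma subspaceZ a x : A x -> A (a *: x).
Proof. by case: hA => h0 h hx; rewrite -[_ *: _]addr0; apply: h. Qed.

Lemma subspaceD x y : A x -> A y -> A (x + y).
Proof. by case: hA => h0 h hx hy; rewrite -[x]scale1r; apply: h. Qed.

Lemma subspaceN x : A x -> A (- x).
Proof. by move=> hx; rewrite -scaleN1r; apply: subspaceZ. Qed.

Lemma subspaceB x y : A x -> A y -> A (x - y).
Proof. by move=> hx hy; apply: subspaceD => //; apply: subspaceN. Qed.

Lemma subspace_sum (I : Type) (r : seq I) (P : pred I) (F : I -> V) :
  (forall i, A (F i)) -> A (\sum_(i <- r | P i) F i).
Proof.
move=> h; elim/big_ind: _ => //; [exact: subspace0|exact: subspaceD].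
Qed.

End Subspaces.

Create HintDb mem.

Ltac subspace_step :=
  lazymatch goal with
  | |- _ (GRing.add _ (GRing.opp _)) => apply: subspaceB
  | |- _ (GRing.add _ _) => apply: subspaceD
  | |- _ (GRing.opp _) => apply: subspaceN
  | |- _ (GRing.scale _ _) => apply: subspaceZ
  | |- _ (GRing.zero) => apply: subspace0
  | |- _ (\sum_(_ <- _ | _) _) => apply: subspace_sum
  end.
#[export] Hint Extern 1 (hset _ _) => subspace_step : mem.

(** Fails on equations and boolean goals, so [try mem] after a rewrite discharges the membership
    side conditions and leaves the rest. *)
Ltac mem := intros;
  lazymatch goal with
  | |- is_true _ => fail
  | |- _ = _ => fail
  | |- _ => first [ assumption | solve [eauto 8 with mem] | subspace_step; mem ]
  end.

(** * Inner product spaces *)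

Section Inner.
Variables (R : realType) (X : lmodType R[i]) (E : hspace X).
Hypothesis hE : is_inner E.
Local Notation C := R[i].

Lemma inner_subspace : is_subspace E. Proof. by case: hE. Qed.
#[local] Hint Resolve inner_subspace : mem.

Lemma ipC x y : E x -> E y -> hip E y x = (hip E x y)^*.
Proof. by case: hE => _ _ h _ _; apply: h. Qed.

Lemma ip_ge0 x : E x -> 0 <= hip E x x.
Proof. by case: hE => _ _ _ h _; apply: h. Qed.

Lemma ip_eq0 x : E x -> hip E x x = 0 -> x = 0.
Proof. by case: hE => _ _ _ _ h; apply: h. Qed.

Lemma ipDr x y w : E x -> E y -> E w -> hip E x (y + w) = hip E x y + hip E x w.
Proof.
by case: hE => _ h _ _ _ hx hy hw; have := h 1 x y w hx hy hw; rewrite scale1r mul1r.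
Qed.

Lemma ip0r x : E x -> hip E x 0 = 0.
Proof.
move=> hx; have := ipDr hx (subspace0 inner_subspace) (subspace0 inner_subspace).
by rewrite addr0 => /eqP; rewrite -subr_eq0 opprD addrA subrr sub0r oppr_eq0 => /eqP.
Qed.

Lemma ipZr a x y : E x -> E y -> hip E x (a *: y) = a * hip E x y.
Proof.
case: hE => _ h _ _ _ hx hy; rewrite -[_ *: _]addr0 h ?ip0r ?addr0 //.
exact: (subspace0 inner_subspace).
Qed.

Lemma ipNr x y : E x -> E y -> hip E x (- y) = - hip E x y.
Proof. by move=> hx hy; rewrite -scaleN1r ipZr // mulN1r. Qed.

Lemma ipBr x y w : E x -> E y -> E w -> hip E x (y - w) = hip E x y - hip E x w.
Proof. by move=> hx hy hw; rewrite ipDr ?ipNr //; mem. Qed.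

Lemma ipDl x y w : E x -> E y -> E w -> hip E (x + y) w = hip E x w + hip E y w.
Proof.
by move=> hx hy hw; rewrite (ipC hw) ?ipDr ?rmorphD /= -?ipC //; mem.
Qed.

Lemma ip0l x : E x -> hip E 0 x = 0.
Proof. by move=> hx; rewrite (ipC hx) ?ip0r ?rmorph0 //; mem. Qed.

Lemma ipZl a x y : E x -> E y -> hip E (a *: x) y = a^* * hip E x y.
Proof. by move=> hx hy; rewrite (ipC hy) ?ipZr ?rmorphM /= -?ipC //; mem. Qed.

Lemma ipNl x y : E x -> E y -> hip E (- x) y = - hip E x y.
Proof. by move=> hx hy; rewrite -scaleN1r ipZl // rmorphN rmorph1 mulN1r. Qed.

Lemma ipBl x y w : E x -> E y -> E w -> hip E (x - y) w = hip E x w - hip E y w.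
Proof. by move=> hx hy hw; rewrite ipDl ?ipNl //; mem. Qed.

Lemma ip_sumr (I : Type) (r : seq I) (P : pred I) (F : I -> X) x : E x -> (forall i, E (F i)) ->
  hip E x (\sum_(i <- r | P i) F i) = \sum_(i <- r | P i) hip E x (F i).
Proof.
move=> hx hF; elim: r => [|i r IH]; first by rewrite !big_nil ip0r.
by rewrite !big_cons; case: ifP => // _; rewrite ipDr ?IH //; mem.
Qed.

Lemma ip_suml (I : Type) (r : seq I) (P : pred I) (F : I -> X) x : E x -> (forall i, E (F i)) ->
  hip E (\sum_(i <- r | P i) F i) x = \sum_(i <- r | P i) hip E (F i) x.
Proof.
move=> hx hF; elim: r => [|i r IH]; first by rewrite !big_nil ip0l.
by rewrite !big_cons; case: ifP => // _; rewrite ipDl ?IH //; mem.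
Qed.

Lemma ip_eq0_all x : E x -> (forall y, E y -> hip E y x = 0) -> x = 0.
Proof. by move=> hx h; apply: ip_eq0 => //; apply: h. Qed.

Lemma hnorm_ge0 x : E x -> 0 <= hnorm E x.
Proof. by move=> hx; rewrite sqrtC_ge0 ip_ge0. Qed.

Lemma hnormK x : hnorm E x ^+ 2 = hip E x x.
Proof. exact: sqrtCK. Qed.

(* [e = 0] gives Cauchy-Schwarz, [e] the squared distance of [y] to a subspace
   gives almost orthogonality of [y - p] for almost minimal [p]. *)
Lemma ip_le_of_min x y (e : C) : E x -> E y ->
  (forall t : C, e <= hip E (y - t *: x) (y - t *: x)) ->
  `|hip E x y| ^+ 2 <= hip E x x * (hip E y y - e).
Proof.
move=> hx hy he; have [x0|x0] := eqVneq (hip E x x) 0.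
  by rewrite (ip_eq0 hx x0) !ip0l // ?mul0r ?normr0 ?expr0n //; mem.
have xp : 0 < hip E x x by rewrite lt_def x0 ip_ge0.
(* This [t] makes [y - t *: x] orthogonal to [x], hence of minimal norm. *)
have := he (hip E x y / hip E x x); set t := _ / _.
rewrite ipBl ?ipBr ?ipZl ?ipZr; try mem.
have xR : (hip E x x)^* = hip E x x by rewrite -ipC.
have -> : hip E y x = (hip E x y)^* by rewrite ipC.
rewrite {2 3}/t rmorphM fmorphV /= xR.
rewrite -(ler_pM2l xp) => h.
rewrite normCK mulrBr lerBrDr addrC -lerBrDr.
apply: le_trans h _; rewrite le_eqVlt; apply/orP; left; apply/eqP.
rewrite /t; field. exact: x0.
Qed.

Lemma cauchy_schwarz x y : E x -> E y -> `|hip E x y| <= hnorm E x * hnorm E y.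
Proof.
move=> hx hy; rewrite -(ler_pXn2r (n:=2)) // ?nnegrE ?mulr_ge0 ?hnorm_ge0 ?normr_ge0 //.
rewrite exprMn !hnormK -[X in _ * X]subr0; apply: ip_le_of_min => // t.
by rewrite ip_ge0 //; mem.
Qed.

Lemma hnorm_eq0 x : E x -> hnorm E x = 0 -> x = 0.
Proof. by move=> hx /eqP; rewrite sqrtC_eq0 => /eqP; apply: ip_eq0. Qed.

Lemma hnorm0 : hnorm E 0 = 0.
Proof. by rewrite /hnorm ip0l ?sqrtC0 //; mem. Qed.

Lemma hnormZ a x : E x -> hnorm E (a *: x) = `|a| * hnorm E x.
Proof.
move=> hx; rewrite /hnorm ipZl ?ipZr; try mem.
by rewrite mulrA [_^* * _]mulrC -normCK rootCMl ?exprn_ge0 // sqrCK.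
Qed.

Lemma hnormN x : E x -> hnorm E (- x) = hnorm E x.
Proof. by move=> hx; rewrite -scaleN1r hnormZ // normrN1 mul1r. Qed.

Lemma hnormD x y : E x -> E y -> hnorm E (x + y) <= hnorm E x + hnorm E y.
Proof.
move=> hx hy; rewrite -(ler_pXn2r (n:=2)) // ?nnegrE ?addr_ge0 ?hnorm_ge0 //; try mem.
rewrite sqrrD !hnormK ipDl ?ipDr; try mem.
rewrite !addrA lerD2r -!addrA lerD2l (ipC hx hy).
have : `|hip E x y + (hip E x y)^* | <= hnorm E x * hnorm E y *+ 2.
  apply: le_trans (ler_normD _ _) _; rewrite norm_conjC mulr2n.
  by apply: lerD; apply: cauchy_schwarz.
apply: le_trans; apply: real_ler_norm.
by rewrite CrealE rmorphD /= conjCK addrC.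
Qed.

Lemma hnormBC x y : E x -> E y -> hnorm E (x - y) = hnorm E (y - x).
Proof. by move=> hx hy; rewrite -opprB hnormN //; mem. Qed.

Lemma inner_restrict (A : set X) : is_subspace A -> A `<=` E -> is_inner (HSpace A (hip E)).
Proof.
case: hE => _ h1 h2 h3 h4 sA AE; split=> //=.
- by move=> a x y w hx hy hw; apply: h1; apply: AE.
- by move=> x y hx hy; apply: h2; apply: AE.
- by move=> x hx; apply: h3; apply: AE.
- by move=> x hx; apply: h4; apply: AE.
Qed.

End Inner.
#[export] Hint Resolve inner_subspace : mem.

Section Relations.
Variables (R : realType) (X Y : lmodType R[i]) (T : set (X * Y)).
Hypothesis hT : is_subspace T.

Lemma rel0 : T (0, 0). Proof. exact: (subspace0 hT). Qed.

Lemma relD x y x' y' : T (x, y) -> T (x', y') -> T (x + x', y + y').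
Proof. exact: (subspaceD hT). Qed.

Lemma relB x y x' y' : T (x, y) -> T (x', y') -> T (x - x', y - y').
Proof. exact: (subspaceB hT). Qed.

Lemma relN x y : T (x, y) -> T (- x, - y).
Proof. exact: (subspaceN hT). Qed.

Lemma relZ a x y : T (x, y) -> T (a *: x, a *: y).
Proof. exact: (subspaceZ hT). Qed.

Lemma rdom_subspace : is_subspace (rdom T).
Proof.
split; first by exists 0; exact: rel0.
move=> a u v [x hx] [y hy]; exists (a *: x + y).
by apply: relD => //; apply: relZ.
Qed.

End Relations.

Section ComplexReals.
Variables (R : realType).
Local Notation C := R[i].

Lemma small_natV (e : C) : 0 < e -> exists N : nat, forall n : nat, (N <= n)%N -> n.+1%:R^-1 < e.
Proof.
move=> e0; have eR : (complex.Re e)%:C%C = e by apply: RRe_real; apply: gtr0_real.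
have := e0; rewrite -eR ltcR => e0'.
have [k] := ltr_add_invr e0'; rewrite add0r => hk.
exists k => n hn; have : n.+1%:R^-1 < complex.Re e.
  by apply: le_lt_trans hk; rewrite lef_pV2 ?posrE ?ltr0n // ler_nat.
by rewrite -ltcR fmorphV rmorph_nat.
Qed.

Lemma eq0_small (a b : C) : 0 <= b -> (forall e : C, 0 < e -> `|a| <= b * e) -> a = 0.
Proof.
move=> b0 h; apply/eqP; apply: contraT => a0.
have ap : 0 < `|a| by rewrite normr_gt0.
have b1 : 0 < b + 1 by apply: ltr_wpDl.
(* Division by [b + 1], since [b] may be zero. *)
have := h (`|a| / (b + 1)) (divr_gt0 ap b1).
by rewrite mulrCA -[leLHS]mulr1 ler_pM2l // ler_pdivlMr // mul1r gerDl ler10.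
Qed.

Lemma le_norm_mul (x y M : C) : 0 <= x -> 0 <= y -> x <= M * y -> x <= `|M| * y.
Proof.
move=> x0 y0 h; have := le_trans x0 h => My0.
by rewrite -(ger0_norm My0) normrM (ger0_norm y0) in h.
Qed.

Lemma neq0_Im (z : C) : 'Im z != 0 -> 'Im z^* != 0.
Proof. by rewrite Im_conj oppr_eq0. Qed.

Lemma norm_Im_le (z : C) : `|'Im z| <= `|z|.
Proof.
rewrite -(ler_pXn2r (n:=2)) // ?nnegrE // (normC2_Re_Im z).
by rewrite real_normK ?Creal_Im // lerDr -realEsqr Creal_Re.
Qed.

Lemma Im_it (t : C) : 0 < t -> 'Im ('i * t) = t.
Proof. by move=> t0; rewrite ImMil; apply/Creal_ReP; apply: gtr0_real. Qed.

Lemma Im_i_neq0 : 'Im ('i : C) != 0.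
Proof. by rewrite Im_i oner_eq0. Qed.

End ComplexReals.

(** * Adjoints and self-adjoint relations *)

Section Adjoint.
Variables (R : realType) (X : lmodType R[i]) (E : hspace X).
Hypothesis hE : is_inner E.
Local Notation C := R[i].
Implicit Types T : set (X * X).

Lemma adj_subspace T : (forall p, T p -> E p.1 /\ E p.2) -> is_subspace (adj E T).
Proof.
move=> hT; split.
  by split=> /= [||q /hT[q1 q2]]; rewrite ?(ip0r hE) //; mem.
move=> a [x y] [x' y'] [/= hx hy h] [/= hx' hy' h']; split=> /=; try mem.
move=> q hq; have [q1 q2] := hT q hq.
rewrite !(ipDr hE) ?(ipZr hE); try mem.
by rewrite h // h'.
Qed.

Lemma adj_closed T : (forall p, T p -> E p.1 /\ E p.2) -> rclosure E (adj E T) `<=` adj E T.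
Proof.
move=> hT [x y] [/= hx hy h]; split => //= q hq; have [q1 q2] := hT q hq.
apply/eqP; rewrite -subr_eq0; apply/eqP.
apply: (@eq0_small _ _ (hnorm E q.2 + hnorm E q.1)).
  by rewrite addr_ge0 ?hnorm_ge0.
move=> e e0; have [[x' y'] [[/= hx' hy' h'] hxx hyy]] := h e e0.
have -> : hip E q.2 x - hip E q.1 y = hip E q.2 (x - x') - hip E q.1 (y - y').
  by rewrite !(ipBr hE) // h' //; ring.
apply: le_trans (ler_normB _ _) _; rewrite mulrDl; apply: lerD.
  apply: le_trans (cauchy_schwarz hE _ _) _ => //; try mem.
  by apply: ler_wpM2l; rewrite ?hnorm_ge0 // ltW.
apply: le_trans (cauchy_schwarz hE _ _) _ => //; try mem.
by apply: ler_wpM2l; rewrite ?hnorm_ge0 // ltW.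
Qed.

Lemma adjP T p : adj E T p -> E p.1 /\ E p.2. Proof. by case. Qed.

Lemma adj_adj T : (forall p, T p -> E p.1 /\ E p.2) -> T `<=` adj E (adj E T).
Proof.
move=> hT p hp; have [p1 p2] := hT p hp; split => // q [q1 q2 h].
rewrite (ipC hE p1 q2) (ipC hE p2 q1); congr (_ ^*).
by rewrite h.
Qed.

(* the real number [<x, y>] does not contribute to the imaginary part *)
Lemma im_bound T x y z : T `<=` adj E T -> T (x, y) ->
  `|'Im z| * hnorm E x <= hnorm E (y - z *: x).
Proof.
move=> hT hxy; have [/= hx hy h] := hT _ hxy.
have xyR : (hip E x y)^* = hip E x y by rewrite -ipC // (h _ hxy).
have [->|x0] := eqVneq x 0.
  by rewrite (hnorm0 hE) mulr0 scaler0 subr0 (hnorm_ge0 hE).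
have xp : 0 < hnorm E x.
  rewrite lt_def (hnorm_ge0 hE) // andbT; apply: contra_neq x0.
  exact: (hnorm_eq0 hE).
rewrite -(ler_pM2r xp) -mulrA -expr2 hnormK mulrC [leRHS]mulrC.
apply: le_trans (cauchy_schwarz hE hx _); last by mem.
rewrite -(ger0_norm (ip_ge0 hE hx)) -normrM.
rewrite (ipBr hE) ?(ipZr hE); try mem.
have -> : hip E x x * 'Im z = - 'Im (hip E x y - z * hip E x x).
  have xxR : hip E x x \is Num.real by apply: ger0_real; apply: ip_ge0.
  rewrite raddfB /=; have -> : 'Im (hip E x y) = 0.
    by apply/Creal_ImP; rewrite CrealE xyR.
  by rewrite sub0r opprK ImMr // mulrC.
by rewrite normrN; exact: norm_Im_le.
Qed.

Lemma im_inj T x z : T `<=` adj E T -> T (x, z *: x) -> 'Im z != 0 -> x = 0.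
Proof.
move=> hT h z0; have [/= hx _ _] := hT _ h.
have := im_bound z hT h; rewrite subrr (hnorm0 hE) pmulr_rle0 ?normr_gt0 // => hn.
by apply: (hnorm_eq0 hE hx); apply/eqP; rewrite eq_le hn (hnorm_ge0 hE).
Qed.

(** For [(x, y)] in the adjoint, solve [(T - z) x' = y - z x]. Then [x - x'] is orthogonal to the
    range of [T - z^*], which is everything, so [x = x']. *)
Lemma onto_selfadjoint T z : is_subspace T -> T `<=` adj E T ->
  (forall y, E y -> exists x, T (x, y + z *: x)) ->
  (forall y, E y -> exists x, T (x, y + z^* *: x)) -> T = adj E T.
Proof.
move=> sT hT hz hz'; apply/seteqP; split => // -[x y] [/= hx hy h].
have [x' hx'] := hz (y - z *: x) ltac:(by mem).
have [/= Ex' _ hx'a] := hT _ hx'.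
have d0 : x - x' = 0.
  have [w hw] := hz' (x - x') ltac:(by mem).
  have [/= Ew _ _] := hT _ hw.
  apply: (ip_eq0 hE); first by mem.
  have e1 := h _ hw; have e2 := hx'a _ hw; move: e1 e2 => /=.
  rewrite !(ipDl hE) ?(ipZl hE) ?(ipDr hE) ?(ipNr hE) ?(ipZr hE) ?conjCK ?(ipDl hE) ?(ipNl hE); try mem.
  move=> e1 e2.
  have -> : hip E x x - hip E x x' + (- hip E x' x - - hip E x' x') =
     (hip E x x - hip E x' x + z * hip E w x) - (hip E x x' - hip E x' x' + z * hip E w x')
     - z * hip E w x + z * hip E w x' by ring.
  by rewrite e1 e2; ring.
have -> : x = x' by apply/eqP; rewrite -subr_eq0 d0.
move: hx'; congr (T (_, _)).
by rewrite (_ : x = x') ?subrK //; apply/eqP; rewrite -subr_eq0 d0.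
Qed.

End Adjoint.

(** * Projections and the Riesz representation *)

Section Hilbert.
Variables (R : realType) (X : lmodType R[i]) (E : hspace X).
Hypothesis hH : is_hilbert E.
Local Notation C := R[i].
Let hE : is_inner E. Proof. by case: hH. Qed.

(** Along a sequence [y n] in [D] with squared distance within $(n+1)^{-2}$ of the infimum,
    [ip_le_of_min] bounds [<d, x - y n>] by [|d| / (n+1)] for every [d] in [D]. With [d = y p - y q]
    this also gives the Cauchy property, in place of the parallelogram law. *)
Lemma projection_closure (D : set X) x : is_subspace D -> D `<=` E -> E x ->
  exists p, [/\ E p, forall y, D y -> hip E y (x - p) = 0
    & forall e : C, 0 < e -> exists2 y, D y & hnorm E (p - y) < e].
Proof.
move=> sD DE hx.
(* Squared distances are complex numbers with real values; the infimum is taken over their real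
   preimages. *)
pose S := [set r : R | exists2 y, D y & (r%:C)%C = hip E (x - y) (x - y)].
have SRe y : D y -> S (complex.Re (hip E (x - y) (x - y))).
  move=> hy; exists y => //; apply: RRe_real; apply: ger0_real; apply: ip_ge0 => //.
  by have := DE _ hy => Ey; mem.
have Slb : has_lbound S.
  exists 0 => r [y hy hr]; rewrite -ler0c hr; apply: ip_ge0 => //.
  by have := DE _ hy => Ey; mem.
have Sinf : has_inf S.
  by split=> //; exists (complex.Re (hip E (x - 0) (x - 0))); apply: SRe; mem.
have hmin y : D y -> ((inf S)%:C)%C <= hip E (x - y) (x - y).
  move=> hy; have [y' hy' hr] := SRe _ hy.
  rewrite -(RRe_real (x := hip E (x - y) (x - y))) ?lecR ?ge_inf //; first exact: SRe.
  by apply: ger0_real; apply: ip_ge0 => //; have := DE _ hy => Ey; mem.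
have hy n : exists y, D y /\ hip E (x - y) (x - y) <= ((inf S)%:C)%C + (n.+1%:R^-1) ^+ 2.
  have e0 : 0 < (n.+1%:R^-1) ^+ 2 :> R by rewrite exprn_gt0 // invr_gt0.
  have [r [y hy hr] hlt] := inf_adherent e0 Sinf.
  exists y; split => //; rewrite -hr; apply: ltW; move: hlt; rewrite -ltcR rmorphD rmorphXn /= fmorphV.
  by rewrite rmorph_nat.
have [y hy'] := choice hy.
have Dy n : D (y n) by case: (hy' n).
have Ey n : E (y n) by apply: DE.
have ortho d n : D d -> `|hip E d (x - y n)| <= hnorm E d * n.+1%:R^-1.
  move=> hd; have Ed := DE _ hd.
  rewrite -(ler_pXn2r (n:=2)) // ?nnegrE ?mulr_ge0 ?hnorm_ge0 ?invr_ge0 ?ler0n //.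
  rewrite exprMn hnormK.
  apply: le_trans (ip_le_of_min (e := ((inf S)%:C)%C) hE Ed _ _) _; first by mem.
    move=> t; rewrite -addrA -opprD; apply: hmin; have := Dy n; mem.
  apply: ler_wpM2l; first exact: ip_ge0.
  by rewrite lerBlDl; case: (hy' n).
have cau p q : hnorm E (y p - y q) <= p.+1%:R^-1 + q.+1%:R^-1.
  have Dd : D (y p - y q) by have := Dy p; have := Dy q; mem.
  have Ed := DE _ Dd.
  have [->|d0] := eqVneq (hnorm E (y p - y q)) 0; first by rewrite addr_ge0 ?invr_ge0 ?ler0n.
  have dp : 0 < hnorm E (y p - y q) by rewrite lt_def d0 hnorm_ge0.
  rewrite -(ler_pM2l dp) -expr2 hnormK.
  have -> : hip E (y p - y q) (y p - y q) = hip E (y p - y q) (x - y q) - hip E (y p - y q) (x - y p).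
    have Exp : E (x - y p) by have := Ey p; mem.
    have Exq : E (x - y q) by have := Ey q; mem.
    by rewrite -(ipBr hE) //; congr (hip E _ _); rewrite opprB [RHS]addrC subrKA.
  rewrite -[leLHS]ger0_norm; last first.
    have Exp : E (x - y p) by have := Ey p; mem.
    have Exq : E (x - y q) by have := Ey q; mem.
    rewrite -(ipBr hE) //; have -> : x - y q - (x - y p) = y p - y q by rewrite opprB [LHS]addrC subrKA.
    exact: ip_ge0.
  apply: le_trans (ler_normB _ _) _; rewrite addrC mulrDr; apply: lerD; exact: ortho.
case: hH => _ /(_ y Ey) [].
  move=> e e0; have e2 : 0 < e / 2 by rewrite divr_gt0 // ltr0n.
  have [N hN] := small_natV e2; exists N => p q hp hq.
  by apply: le_lt_trans (cau p q) _; rewrite [e]splitr ltrD ?hN.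
move=> p Ep hp; exists p; split => //.
  move=> d hd; have Ed := DE _ hd.
  apply: (@eq0_small _ _ (hnorm E d *+ 2)); first by rewrite mulrn_wge0 // hnorm_ge0.
  move=> e e0; have [N hN] := small_natV e0; have [M hM] := hp e e0.
  pose n := maxn N M.
  have Exn : E (x - y n) by have := Ey n; mem.
  have Enp : E (y n - p) by have := Ey n; mem.
  have -> : x - p = (x - y n) + (y n - p) by rewrite addrA subrK.
  rewrite (ipDr hE) // mulrnAl mulr2n; apply: le_trans (ler_normD _ _) _; apply: lerD.
    apply: le_trans (ortho d n hd) _; rewrite ler_wpM2l ?hnorm_ge0 // ltW // hN //.
    exact: leq_maxl.
  apply: le_trans (cauchy_schwarz hE Ed Enp) _; rewrite ler_wpM2l ?hnorm_ge0 // ltW // hM //.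
  exact: leq_maxr.
move=> e e0; have [N hN] := hp e e0; exists (y N); first exact: Dy.
by rewrite (hnormBC hE) // hN.
Qed.

Lemma orth_dense (D : set X) : is_subspace D -> D `<=` E ->
  (forall x, E x -> (forall y, D y -> hip E y x = 0) -> x = 0) -> is_dense E D.
Proof.
move=> sD DE h; split => // x e hx e0.
have [p [Ep op hp]] := projection_closure sD DE hx.
have -> : x = p by apply/eqP; rewrite -subr_eq0; apply/eqP; apply: h => //; mem.
exact: hp.
Qed.

(** The kernel [D] enters through its closure: boundedness makes [F] vanish at the projection [p] of
    [f1], so [w = f1 - p] is orthogonal to [D] with [F w] nonzero, and [F] is a multiple of
    [<w, .>]. *)
Lemma riesz (F : X -> C) (M : C) :
  (forall a f g, E f -> E g -> F (a *: f + g) = a * F f + F g) ->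
  (forall f, E f -> `|F f| <= M * hnorm E f) ->
  exists2 u, E u & forall f, E f -> F f = hip E u f.
Proof.
move=> Flin Fbd.
have E0 : E 0 by mem.
have F0 : F 0 = 0.
  have := Flin 1 0 0 E0 E0; rewrite scaler0 addr0 mul1r => /eqP.
  by rewrite -subr_eq0 opprD addrA subrr sub0r oppr_eq0 => /eqP.
have FZ a f : E f -> F (a *: f) = a * F f.
  by move=> hf; rewrite -[a *: f]addr0 Flin // F0 addr0.
have FB f g : E f -> E g -> F (f - g) = F f - F g.
  by move=> hf hg; rewrite addrC -scaleN1r Flin // mulN1r addrC.
have [Fz|] := pselect (forall f, E f -> F f = 0).
  by exists 0 => // f hf; rewrite (ip0l hE) // Fz.
move=> /existsNP [f1 /not_implyP [Ef1 Ff1]].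
pose D := [set f | E f /\ F f = 0].
have sD : is_subspace D.
  by split=> [|a u v [Eu Fu] [Ev Fv]]; split => //; rewrite ?Flin ?Fu ?Fv ?mulr0 ?addr0 //; mem.
have [p [Ep op hp]] := projection_closure sD (fun f hf => proj1 hf) Ef1.
have Fp : F p = 0.
  apply: (@eq0_small _ _ `|M|) => // e e0; have [y [Ey Fy] hy] := hp e e0.
  have Epy : E (p - y) by mem.
  rewrite -[F p]subr0 -Fy -FB //.
  apply: le_trans (le_norm_mul _ _ (Fbd _ Epy)) _ => //; first exact: hnorm_ge0.
  by rewrite ler_wpM2l // ltW.
set w := f1 - p in op.
have Ew : E w by rewrite /w; mem.
have Fw : F w = F f1 by rewrite /w FB // Fp subr0.
have w0 : hip E w w != 0.
  apply/eqP => /(ip_eq0 hE Ew) w0; apply: Ff1; rewrite -Fw w0.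
  exact: F0.
have Fw0 : F w != 0 by rewrite Fw; apply/eqP.
exists ((F w / hip E w w)^* *: w); first by mem.
move=> f Ef; rewrite (ipZl hE) // conjCK.
set c := F f / F w.
have Df : D (f - c *: w).
  split; first by mem.
  by rewrite FB ?FZ //; [rewrite divfK // subrr|mem].
have /eqP := op _ Df; rewrite (ipBl hE) ?(ipZl hE); try mem.
rewrite subr_eq0 => /eqP h.
have -> : hip E w f = (hip E f w)^* by rewrite -ipC.
rewrite h rmorphM /= conjCK -ipC // /c.
by field; apply/andP.
Qed.

End Hilbert.

(** * Resolvents of self-adjoint operators *)

Section SelfAdjoint.
Variables (R : realType) (X : lmodType R[i]) (E : hspace X).
Hypothesis hH : is_hilbert E.
Local Notation C := R[i].
Let hE : is_inner E. Proof. by case: hH. Qed.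
Variable T : set (X * X).
Hypotheses (opT : is_op T) (saT : T = adj E T).

Lemma sa_sub : T `<=` adj E T. Proof. by rewrite -saT. Qed.

Lemma sa_inE p : T p -> E p.1 /\ E p.2.
Proof. by rewrite saT; apply: adjP. Qed.

Lemma sa_subspace : is_subspace T.
Proof. by rewrite saT; apply: adj_subspace => // p /sa_inE. Qed.

Lemma sa_closed : rclosure E T `<=` T.
Proof. by move=> p; rewrite {2}saT => hp; apply: (adj_closed hE sa_inE); rewrite -saT. Qed.

(** A vector [x] orthogonal to the domain makes [(0, x)] an element of the adjoint, hence of the
    operator [T], so [x = 0]. *)
Lemma sa_dense : is_dense E (rdom T).
Proof.
apply: (orth_dense hH); first exact: (rdom_subspace sa_subspace).
  by move=> x [y /sa_inE[]].
move=> x Ex h; apply: (opT (x := 0)); last exact: (rel0 sa_subspace).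
rewrite saT; split => //=; first by mem.
move=> [u v] huv; have [/= Eu Ev] := sa_inE huv.
by rewrite (ip0r hE) // h //; exists v.
Qed.

(** Riesz in [rdom T] with the form [<r f, r g>], [r = T - z^*], which is complete because [T] is
    closed and [|Im z| |f| <= |r f|]. If [g] represents [f |-> <y, f>], then [<r g, r f> = <y, f>]
    on the domain, which says that [x = r g] lies in the domain of the adjoint and
    [(T - z) x = y]. *)
Lemma sa_onto z y : 'Im z != 0 -> E y -> exists x, T (x, y + z *: x).
Proof.
move=> z0 Ey; have sT := sa_subspace; have hsub := sa_sub.
pose t f := xget 0 [set g | T (f, g)].
have tP f : rdom T f -> T (f, t f) by move=> [g hg]; apply: (xgetPex 0 (P := [set g | T (f, g)])); exists g.
pose r f := t f - z^* *: f.
have Er f : rdom T f -> E (r f) by move=> /tP/sa_inE[/= ? ?]; rewrite /r; mem.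
have Ed f : rdom T f -> E f by move=> /tP/sa_inE[].
have rlin a f g : rdom T f -> rdom T g -> r (a *: f + g) = a *: r f + r g.
  move=> hf hg; rewrite /r; have -> : t (a *: f + g) = a *: t f + t g.
    apply: (opT (x := a *: f + g)); last by apply: relD (relZ _ _ _) _ => //; exact: tP.
    by apply/tP; exists (a *: t f + t g); apply: relD (relZ _ _ _) _ => //; exact: tP.
  by lmod.
have rbd f : rdom T f -> `|'Im z| * hnorm E f <= hnorm E (r f).
  move=> /tP hf; have := im_bound hE (z^*) hsub hf.
  by rewrite Im_conj normrN.
have zp : 0 < `|'Im z| by rewrite normr_gt0.
have sD : is_subspace (rdom T) := rdom_subspace sT.
pose E' := HSpace (rdom T) (fun f g => hip E (r f) (r g)).
have hE' : is_inner E'.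
  split=> [||||] /=.
  - exact: sD.
  - by move=> a f g h hf hg hh; rewrite rlin // (ipDr hE) ?(ipZr hE) //; try mem; apply: Er.
  - by move=> f g hf hg; rewrite -(ipC hE) //; apply: Er.
  - by move=> f hf; apply: (ip_ge0 hE); apply: Er.
  - move=> f hf /(ip_eq0 hE (Er _ hf)) h0; apply: (hnorm_eq0 hE (Ed _ hf)).
    have := rbd _ hf; rewrite h0 (hnorm0 hE) pmulr_rle0 // => h.
    by apply/eqP; rewrite eq_le h (hnorm_ge0 hE) //; apply: Ed.
have rB f g : rdom T f -> rdom T g -> r (f - g) = r f - r g.
  by move=> hf hg; rewrite addrC -scaleN1r rlin // scaleN1r addrC.
have cE' : is_complete E'.
  move=> u Du cu.
  have [v Ev hv] : exists2 x, E x & forall e : C, 0 < e -> exists N : nat, forall n : nat,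
      (N <= n)%N -> hnorm E (r (u n) - x) < e.
    case: hH => _; apply; first by move=> n; apply: Er; apply: Du.
    move=> e e0; have [N hN] := cu e e0; exists N => p q hp hq.
    by rewrite -rB; [exact: hN|exact: Du|exact: Du].
  have [x Ex hx] : exists2 x, E x & forall e : C, 0 < e -> exists N : nat, forall n : nat,
      (N <= n)%N -> hnorm E (u n - x) < e.
    case: hH => _; apply; first by move=> n; apply: Ed; apply: Du.
    move=> e e0; have [N hN] := cu (`|'Im z| * e) (mulr_gt0 zp e0); exists N => p q hp hq.
    rewrite -(ltr_pM2l zp); apply: le_lt_trans (hN p q hp hq).
    by apply: rbd; have := Du p; have := Du q; mem.
  have hxT : T (x, v + z^* *: x).
    apply: sa_closed; split => /=; try mem.
    move=> e e0; pose e1 := e / (1 + `|z|).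
    have z1 : 0 < 1 + `|z| by rewrite ltr_wpDr.
    have e10 : 0 < e1 by rewrite divr_gt0.
    have [N hN] := hx _ e10; have [M hM] := hv _ e10.
    pose n := maxn N M; have hn := Du n; have En := Ed _ hn; have Ern := Er _ hn.
    have xn : hnorm E (x - u n) < e1 by rewrite (hnormBC hE) //; apply: hN; apply: leq_maxl.
    have vn : hnorm E (v - r (u n)) < e1 by rewrite (hnormBC hE) //; apply: hM; apply: leq_maxr.
    exists (u n, t (u n)); split => /=; first exact: tP.
      apply: lt_le_trans xn _; rewrite ler_pdivrMr // mulrDr mulr1 lerDl mulr_ge0 //.
      exact: ltW.
    have -> : v + z^* *: x - t (u n) = (v - r (u n)) + z^* *: (x - u n) by rewrite /r; lmod.
    apply: le_lt_trans (hnormD hE _ _) _; try mem.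
    rewrite (hnormZ hE) ?norm_conjC; last by mem.
    have -> : e = e1 + `|z| * e1 by rewrite -[X in X + _]mul1r -mulrDl mulrC divfK // gt_eqF.
    apply: ltr_leD => //; apply: ler_wpM2l => //; exact: ltW.
  exists x; first by exists (v + z^* *: x).
  move=> e e0; have [N hN] := hv e e0; exists N => n hn.
  have Dx : rdom T x by exists (v + z^* *: x).
  rewrite /hnorm /= rB //; last exact: Du.
  have -> : r x = v; last exact: hN.
  rewrite /r; have -> : t x = v + z^* *: x by apply: (opT (x := x)) => //; exact: tP.
  by lmod.
have Flin a f h : E' f -> E' h -> hip E y (a *: f + h) = a * hip E y f + hip E y h.
  move=> hf hh; have Ef := Ed _ hf; have Eh := Ed _ hh.
  by rewrite (ipDr hE) ?(ipZr hE) //; mem.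
have Fbd f : E' f -> `|hip E y f| <= hnorm E y / `|'Im z| * hnorm E' f.
  move=> hf; apply: le_trans (cauchy_schwarz hE Ey (Ed _ hf)) _.
  rewrite -mulrA ler_wpM2l ?(hnorm_ge0 hE) // mulrC ler_pdivlMr // mulrC.
  exact: rbd.
have [g Dg hg] := riesz (conj hE' cE') Flin Fbd.
have Erg := Er _ Dg.
exists (r g); rewrite saT; split => /=; try mem.
move=> [u v] huv; have [/= Eu Ev] := sa_inE huv.
have Du : rdom T u by exists v.
have ruE : r u = v - z^* *: u.
  by rewrite /r; congr (_ - _); apply: (opT (x := u)) => //; exact: tP.
move: Erg (hg u Du); rewrite /= ruE; move: (r g) => w Ew /(congr1 Num.conj).
rewrite -!(ipC hE); try mem.
rewrite (ipBl hE) ?(ipZl hE) ?conjCK; try mem.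
by move=> e1; rewrite (ipDr hE) ?(ipZr hE) ?e1 ?subrK //; mem.
Qed.

Lemma sa_rho z : 'Im z != 0 -> rho E T z.
Proof.
move=> z0; split.
  move=> y Ey; have [x hx] := sa_onto z0 Ey; exists x; split => // x' hx'.
  have := relB sa_subspace hx hx'.
  have -> : y + z *: x - (y + z *: x') = z *: (x - x') by lmod.
  move=> /(im_inj hE sa_sub) /(_ z0) /eqP; rewrite subr_eq0 => /eqP //.
exists (`|'Im z|^-1) => -[x y] /(im_bound hE z sa_sub) /= h.
by rewrite mulrC ler_pdivlMr ?normr_gt0 // mulrC.
Qed.

(* Resolvents at [it] regularize: [-it (T - it)^-1 x] tends to [x]. *)
Lemma yosida x (e : C) : E x -> 0 < e -> exists2 t0 : C, 0 < t0 &
  forall t u, t0 <= t -> T (u, x + ('i * t) *: u) -> hnorm E (x + ('i * t) *: u) < e.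
Proof.
move=> Ex e0; have sT := sa_subspace; have e2 : 0 < e / 2 by rewrite divr_gt0.
have [_ /(_ x _ Ex e2) [x' [y' hx'] hxx]] := sa_dense.
have [/= Ex' Ey'] := sa_inE hx'.
(* With [a = (T - it) u] and [T] symmetric the cross terms cancel: $|a|^2=|Tu|^2+t^2|u|^2$. *)
have bd t a u : 0 < t -> E a -> T (u, a + ('i * t) *: u) ->
    hnorm E (a + ('i * t) *: u) <= hnorm E a /\ t * hnorm E u <= hnorm E a.
  move=> t0 Ea hu; have [/= Eu Ew] := sa_inE hu.
  set w := a + _ in hu Ew *.
  have tR : t^* = t by apply/eqP; rewrite -CrealE gtr0_real.
  have aE : a = w - ('i * t) *: u by rewrite /w; lmod.
  have uw : hip E w u = hip E u w by case: (sa_sub hu) => _ _ /(_ _ hu).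
  have h : hip E a a = hip E w w + t ^+ 2 * hip E u u.
    rewrite aE !(ipBl hE) ?(ipBr hE) ?(ipZl hE) ?(ipZr hE); try mem.
    rewrite uw rmorphM /= conjCi tR.
    have -> : hip E w w - 'i * t * hip E u w - (- 'i * t * hip E u w - - 'i * t * ('i * t * hip E u u))
      = hip E w w - ('i ^+ 2) * t ^+ 2 * hip E u u by ring.
    by rewrite sqrCi mulN1r mulNr opprK.
  have wp := ip_ge0 hE Ew; have up := ip_ge0 hE Eu.
  split; rewrite -(ler_pXn2r (n:=2)) ?nnegrE ?(hnorm_ge0 hE) ?mulr_ge0 ?(hnorm_ge0 hE) ?(ltW t0) //.
    by rewrite !hnormK h lerDl mulr_ge0 // exprn_ge0 // ltW.
  by rewrite exprMn !hnormK h lerDr.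
(* For [x'] in the domain with image [y'], [t |T (T - it)^-1 x'| <= |y'|], so such [t] bring this
   term below [e / 2]; the summand 1 keeps the constant positive when [y' = 0]. *)
exists (2 * hnorm E y' / e + 1).
  by rewrite ltr_wpDl // mulr_ge0 ?invr_ge0 ?mulr_ge0 ?(hnorm_ge0 hE) // ltW.
move=> t u ht hu.
have tp : 0 < t.
  by apply: lt_le_trans ht; rewrite ltr_wpDl // mulr_ge0 ?invr_ge0 ?mulr_ge0 ?(hnorm_ge0 hE) // ltW.
have itn : 'Im ('i * t) != 0 by rewrite Im_it ?gt_eqF.
have [u' hu'] := sa_onto itn Ex'.
have [/= Eu Ew] := sa_inE hu; have [/= Eu' Ew'] := sa_inE hu'.
have hw' : T (x' + ('i * t) *: u', y' + ('i * t) *: (x' + ('i * t) *: u')).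
  by apply: relD => //; apply: relZ.
have [_ b1] := bd t _ _ tp Ey' hw'.
have hd : T (u - u', (x - x') + ('i * t) *: (u - u')).
  have := relB sT hu hu'; congr (T (_, _)); lmod.
have Exx : E (x - x') by mem.
have [b2 _] := bd t _ _ tp Exx hd.
have -> : x + ('i * t) *: u = (x - x' + ('i * t) *: (u - u')) + (x' + ('i * t) *: u') by lmod.
apply: le_lt_trans (hnormD hE _ _) _; try mem.
rewrite [e]splitr; apply: ltr_leD; first exact: le_lt_trans b2 hxx.
rewrite -(ler_pM2l tp); apply: le_trans b1 _.
have -> : hnorm E y' = (2 * hnorm E y' / e) * (e / 2) by field; rewrite gt_eqF.
apply: ler_wpM2r; first exact: ltW.
by apply: le_trans ht; rewrite lerDl.
Qed.

Lemma yosida2 x y (e : C) : E x -> E y -> 0 < e -> exists2 z : C, 'Im z != 0 &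
  forall u v, T (u, x + z *: u) -> T (v, y + z *: v) ->
    hnorm E (x + z *: u) < e /\ hnorm E (y + z *: v) < e.
Proof.
move=> Ex Ey e0; have [t1 t1p h1] := yosida Ex e0; have [t2 t2p h2] := yosida Ey e0.
have tp : 0 < t1 + t2 by rewrite addr_gt0.
exists ('i * (t1 + t2)); first by rewrite Im_it ?gt_eqF.
move=> u v hu hv; split; [apply: h1|apply: h2] => //.
  by rewrite lerDl ltW.
by rewrite lerDr ltW.
Qed.

(** The vectors [V x'] form a core: approximate [(T - i) x] by [V h] and take [x' = (T - i)^-1 h].
    As [V] preserves the graph, [im_bound] at [i] lets the error in [(T - i) x] control both
    components. *)
Lemma core_dense (V : X -> X) :
  (forall a u v, E u -> E v -> V (a *: u + v) = a *: V u + V v) ->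
  is_dense E (V @` E) -> (forall x y, T (x, y) -> T (V x, V y)) ->
  forall p (e : C), T p -> 0 < e ->
  exists q, [/\ T q, hnorm E (p.1 - V q.1) < e & hnorm E (p.2 - V q.2) < e].
Proof.
move=> Vlin [VE Vd] VT [x y] e hp e0 /=; have [/= Ex Ey] := sa_inE hp.
have e2 : 0 < e / 2 by rewrite divr_gt0.
have [_ [h Eh <-] hV] := Vd (y - 'i *: x) _ ltac:(by mem) e2.
have EV u : E u -> E (V u) by move=> Eu; apply: VE; exists u.
have [x' hx'] := sa_onto (Im_i_neq0 R) Eh.
have [/= Ex' _] := sa_inE hx'.
have VhE := EV _ Eh; have Vx'E := EV _ Ex'.
have VE2 : V (h + 'i *: x') = V h + 'i *: V x' by rewrite addrC Vlin // addrC.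
have hd : T (x - V x', y - V (h + 'i *: x')) := relB sa_subspace hp (VT _ _ hx').
have b := im_bound hE 'i sa_sub hd.
have xe : hnorm E (x - V x') < e / 2.
  rewrite Im_i normr1 mul1r in b; apply: le_lt_trans b _; apply: le_lt_trans hV.
  by rewrite VE2 le_eqVlt; apply/orP; left; apply/eqP; congr hnorm; lmod.
exists (x', h + 'i *: x'); split => //=.
  by apply: lt_le_trans xe _; rewrite ler_pdivrMr // ler_peMr ?ltW // ltr1n.
rewrite VE2.
have -> : y - (V h + 'i *: V x') = (y - 'i *: x - V h) + 'i *: (x - V x') by lmod.
apply: le_lt_trans (hnormD hE _ _) _; try mem.
by rewrite [e]splitr (hnormZ hE) ?normCi ?mul1r; [apply: ltrD|mem].
Qed.

End SelfAdjoint.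

(** * Finite-dimensional spaces *)

Lemma unitmx_of_ker (K : fieldType) n (A : 'M[K]_n) : (forall v : 'cV[K]_n, A *m v = 0 -> v = 0) -> A \in unitmx.
Proof.
move=> h; rewrite -unitmx_tr -row_free_unit -kermx_eq0; apply/eqP/row_matrixP => i.
rewrite row0; apply: trmx_inj; rewrite trmx0; apply: h.
by rewrite -{1}[A]trmxK -trmx_mul -row_mul mulmx_ker row0 trmx0.
Qed.

Section FiniteDimension.
Variables (R : realType) (X : lmodType R[i]).
Local Notation C := R[i].

Lemma span_subspace n (b : 'I_n -> X) : is_subspace (span b).
Proof.
split; first by exists (fun=> 0); rewrite big1 // => i _; rewrite scale0r.
move=> a u v [c ->] [c' ->]; exists (fun i => a * c i + c' i).
rewrite scaler_sumr -big_split; apply: eq_bigr => i _.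
by rewrite scalerDl scalerA.
Qed.

Lemma span_gen n (b : 'I_n -> X) i : span b (b i).
Proof.
exists (fun j => (j == i)%:R); rewrite (bigD1 i) //= eqxx scale1r big1 ?addr0 // => j.
by move=> /negPf ->; rewrite scale0r.
Qed.

Lemma lin_indep_inj n (b : 'I_n -> X) (a c : 'I_n -> C) : lin_indep b ->
  \sum_i a i *: b i = \sum_i c i *: b i -> forall i, a i = c i.
Proof.
move=> hb h i; apply/eqP; rewrite -subr_eq0; apply/eqP.
apply: (hb (fun i => a i - c i)).
rewrite (eq_bigr (fun i => a i *: b i - c i *: b i)) => [|j _]; last by rewrite scalerBl.
by rewrite sumrB h subrr.
Qed.

(** Induction on the number of functionals: on the kernel of [ph ord0] the others suffice, and what
    remains of [F] vanishes there, hence is a multiple of [ph ord0]. All is relative to [D], since a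
    pairing of the scale is meaningful only on its own space. *)
Lemma kernel_combination d (ph : 'I_d -> X -> C) (F : X -> C) (D : set X) : is_subspace D ->
  (forall s a f g, D f -> D g -> ph s (a *: f + g) = a * ph s f + ph s g) ->
  (forall a f g, D f -> D g -> F (a *: f + g) = a * F f + F g) ->
  (forall f, D f -> (forall s, ph s f = 0) -> F f = 0) ->
  exists a : 'I_d -> C, forall f, D f -> F f = \sum_s a s * ph s f.
Proof.
elim: d ph F D => [|d IH] ph F D sD lph lF hF.
  by exists (fun=> 0) => f Df; rewrite big_ord0 hF // => -[].
have lin0 (G : X -> C) : (forall a f g, D f -> D g -> G (a *: f + g) = a * G f + G g) -> G 0 = 0.
  move=> lG; have D0 : D 0 by mem.
  have := lG 1 0 0 D0 D0; rewrite scaler0 addr0 mul1r => /eqP.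
  by rewrite -subr_eq0 opprD addrA subrr sub0r oppr_eq0 => /eqP.
pose D' := [set f | D f /\ ph ord0 f = 0].
have sD' : is_subspace D'.
  split=> [|a u v [Du hu] [Dv hv]].
    split; [by mem|exact: (lin0 _ (lph ord0))].
  by split; [mem|rewrite lph // hu hv mulr0 addr0].
have [a ha] : exists a : 'I_d -> C, forall f, D' f -> F f = \sum_s a s * ph (lift ord0 s) f.
  apply: (IH (fun s => ph (lift ord0 s)) F D') => //.
  - by move=> s b f g [Df _] [Dg _]; apply: lph.
  - by move=> b f g [Df _] [Dg _]; apply: lF.
  - move=> f [Df h0] h; apply: hF => // s.
    by case: (unliftP ord0 s) => [j ->|->] //; apply: h.
pose F' f := F f - \sum_s a s * ph (lift ord0 s) f.
have lF' b f g : D f -> D g -> F' (b *: f + g) = b * F' f + F' g.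
  move=> Df Dg; rewrite /F' lF //.
  under eq_bigr do rewrite lph // mulrDr mulrCA.
  by rewrite big_split /= -mulr_sumr; ring.
have F'0 f : D' f -> F' f = 0 by move=> h; rewrite /F' -ha // subrr.
have [h0|] := pselect (forall f, D f -> ph ord0 f = 0).
  exists (fun s => if unlift ord0 s is Some j then a j else 0) => f Df.
  rewrite big_ord_recl unlift_none mul0r add0r.
  under eq_bigr do rewrite liftK.
  by apply: ha; split => //; apply: h0.
move=> /existsNP[f1 /not_implyP[Df1 /eqP n1]].
exists (fun s => if unlift ord0 s is Some j then a j else F' f1 / ph ord0 f1) => f Df.
rewrite big_ord_recl unlift_none.
under eq_bigr do rewrite liftK.
have : F' (f - (ph ord0 f / ph ord0 f1) *: f1) = 0.
  apply: F'0; split; first by mem.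
  by rewrite addrC -scaleNr lph // mulNr divfK // addrC subrr.
rewrite addrC -scaleNr lF' // mulNr => /eqP; rewrite addrC subr_eq0 => /eqP.
rewrite {1}/F' => /eqP; rewrite subr_eq => /eqP ->.
by congr (_ + _); ring.
Qed.

End FiniteDimension.
#[export] Hint Resolve span_subspace : mem.

Section FiniteDimensionInner.
Variables (R : realType) (X : lmodType R[i]) (E : hspace X).
Hypothesis hE : is_inner E.
Local Notation C := R[i].

(** Induction on the generators, since [A] comes without a basis. The part [A'] of [A] in the span
    of the remaining generators has codimension at most one in [A], and the projection onto [A] adds
    to the one onto [A'] a component along a vector [v'] of [A] orthogonal to [A']. *)
Lemma findim_projection n (g : 'I_n -> X) (A : set X) y : (forall i, E (g i)) ->
  is_subspace A -> A `<=` span g -> E y ->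
  exists2 p, A p & forall w, A w -> hip E w (y - p) = 0.
Proof.
elim: n g A y => [|n IH] g A y Eg sA Ag Ey.
  exists 0; first by mem.
  by move=> w /Ag [a ->]; rewrite big_ord0 subr0 (ip0l hE).
have sg : span g `<=` E by move=> w [a ->]; mem.
have AE : A `<=` E by move=> w /Ag/sg.
pose g' (i : 'I_n) := g (lift ord0 i).
pose A' := A `&` span g'.
have sA' : is_subspace A'.
  split=> [|a u v [Au su] [Av sv]]; first by split; mem.
  by split; mem.
have IHA' y' := IH g' A' y' (fun i => Eg _) sA' (fun w h => proj2 h).
have [hAA'|] := pselect (A `<=` A').
  have [p [Ap _] hp] := IHA' y Ey; exists p => // w Aw; apply: hp.
  exact: hAA'.
move=> /existsNP[v /not_implyP[Av nv]].
have Ev := AE _ Av.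
have [q A'q hq] := IHA' v Ev; have [Aq sq] := A'q; have Eq := AE _ Aq.
set v' := v - q in hq; have Av' : A v' by rewrite /v'; mem.
have Ev' := AE _ Av'.
have nv' : hip E v' v' != 0.
  apply/eqP => /(ip_eq0 hE Ev') v'0; apply: nv.
  by rewrite -[v](subrK q) -/v' v'0 add0r.
(* [c] is the quotient of the coefficients of the first generator; that of [v'] is nonzero, as
   otherwise [v] would lie in [A']. *)
have dec w : A w -> exists (c : C), A' (w - c *: v').
  move=> Aw; have [a aw] := Ag _ Aw; have [b bv] := Ag _ Av'.
  have b0 : b ord0 != 0.
    apply/eqP => b0; apply: nv.
    have sv' : span g' v'.
      by exists (fun i => b (lift ord0 i)); rewrite bv big_ord_recl b0 scale0r add0r.
    have -> : v = v' + q by rewrite /v' subrK.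
    by split; [mem|exact: (subspaceD (span_subspace g'))].
  exists (a ord0 / b ord0); split; first by mem.
  exists (fun i => a (lift ord0 i) - a ord0 / b ord0 * b (lift ord0 i)).
  pose S1 := \sum_(i < n) a (lift ord0 i) *: g (lift ord0 i).
  pose S2 := \sum_(i < n) b (lift ord0 i) *: g (lift ord0 i).
  have -> : w = a ord0 *: g ord0 + S1 by rewrite aw big_ord_recl.
  have -> : v' = b ord0 *: g ord0 + S2 by rewrite bv big_ord_recl.
  transitivity (S1 - (a ord0 / b ord0) *: S2); first by lmod_core; field.
  rewrite /S1 /S2 scaler_sumr -sumrB; apply: eq_bigr => i _.
  by rewrite /g'; lmod.
have [p A'p hp] := IHA' y Ey; have [Ap sp] := A'p; have Ep := AE _ Ap.
pose t := hip E v' y / hip E v' v'.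
exists (p + t *: v'); first by mem.
move=> w Aw; have [c A'w] := dec w Aw; have Ew := AE _ Aw.
have Ew' : E (w - c *: v') by mem.
have -> : w = (w - c *: v') + c *: v' by rewrite subrK.
have h1 : hip E (w - c *: v') (y - (p + t *: v')) = 0.
  have -> : y - (p + t *: v') = (y - p) - t *: v' by lmod.
  by rewrite (ipBr hE) ?(ipZr hE) ?hp ?hq ?mulr0 ?subr0 //; mem.
have h2 : hip E v' (y - (p + t *: v')) = 0.
  have pv : hip E v' p = 0 by rewrite (ipC hE Ep) // hq // conjC0.
  rewrite (ipBr hE) ?(ipDr hE) ?(ipZr hE) ?pv; try mem.
  by rewrite add0r /t divfK // subrr.
rewrite (ipDl hE) ?h1 ?(ipZl hE) ?h2 ?mulr0 ?addr0 //; mem.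
Qed.

(** A kernel vector of the Gram matrix yields a combination of norm zero, so independence makes the
    matrix invertible. *)
Lemma gram_solve n (g : 'I_n -> X) (b : 'I_n -> C) : (forall i, E (g i)) -> lin_indep g ->
  exists a : 'I_n -> C, forall i, hip E (g i) (\sum_j a j *: g j) = b i.
Proof.
move=> Eg ig; pose G : 'M[C]_n := \matrix_(i, j) hip E (g i) (g j).
have GE (v : 'cV[C]_n) i : hip E (g i) (\sum_j v j 0 *: g j) = (G *m v) i 0.
  rewrite (ip_sumr hE) //; last by mem.
  by rewrite mxE; apply: eq_bigr => j _; rewrite (ipZr hE) // mxE mulrC.
have uG : G \in unitmx.
  apply: unitmx_of_ker => v Gv; set x := \sum_j v j 0 *: g j.
  have Ex : E x by rewrite /x; mem.
  have x0 : x = 0.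
    apply: (ip_eq0 hE Ex); rewrite {1}/x (ip_suml hE) //; last by mem.
    rewrite big1 // => i _; rewrite (ipZl hE) //.
    by rewrite GE Gv mxE mulr0.
  by apply/colP => i; rewrite [RHS]mxE; apply: (ig (fun i => v i 0)).
exists (fun j => (invmx G *m (\col_i b i)) j 0) => i.
by rewrite GE mulmxA mulmxV // mul1mx mxE.
Qed.

(** Coordinates are inner products with the dual basis [v], which Cauchy-Schwarz bounds. *)
Lemma coord_bounded n (g : 'I_n -> X) : (forall i, E (g i)) -> lin_indep g ->
  exists2 M : C, 0 <= M & forall (a : 'I_n -> C) i, `|a i| <= M * hnorm E (\sum_j a j *: g j).
Proof.
move=> Eg ig.
have /choice[b hb] : forall i, exists b : 'I_n -> C,
    forall j, hip E (g j) (\sum_k b k *: g k) = (i == j)%:R.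
  by move=> i; apply: gram_solve.
pose v i := \sum_k b i k *: g k.
have Ev i : E (v i) by rewrite /v; mem.
exists (\sum_i hnorm E (v i)); first by apply: sumr_ge0 => i _; apply: hnorm_ge0.
move=> a i; set x := (X in _ * hnorm E X); have Ex : E x by rewrite /x; mem.
have -> : a i = hip E (v i) x.
  rewrite /x (ip_sumr hE) //; last by mem.
  rewrite (bigD1 i) //= (ipZr hE) // (ipC hE (Eg i)) // hb eqxx rmorph1 mulr1.
  rewrite big1 ?addr0 // => j ji.
  by rewrite (ipZr hE) // (ipC hE (Eg j)) // hb eq_sym (negPf ji) rmorph0 mulr0.
apply: le_trans (cauchy_schwarz hE _ _) _ => //.
apply: ler_wpM2r; first exact: hnorm_ge0.
by rewrite (bigD1 i) //= lerDl; apply: sumr_ge0 => j _; apply: hnorm_ge0.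
Qed.

(** Serves to bound resolvents of an operator diagonal in a basis that need not be orthogonal. *)
Lemma diag_bounded n (g : 'I_n -> X) (c : 'I_n -> C) : (forall i, E (g i)) -> lin_indep g ->
  exists2 M : C, 0 <= M & forall a : 'I_n -> C,
    hnorm E (\sum_j (c j * a j) *: g j) <= M * hnorm E (\sum_j a j *: g j).
Proof.
move=> Eg ig; have [M M0 hM] := coord_bounded Eg ig.
exists (\sum_j `|c j| * hnorm E (g j) * M).
  by apply: sumr_ge0 => j _; rewrite !mulr_ge0 // (hnorm_ge0 hE).
move=> a; rewrite mulr_suml.
have gen (r : seq 'I_n) : hnorm E (\sum_(j <- r) (c j * a j) *: g j) <= \sum_(j <- r) hnorm E ((c j * a j) *: g j).
  elim: r => [|j r IH]; first by rewrite !big_nil (hnorm0 hE).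
  rewrite !big_cons; apply: le_trans (hnormD hE _ _) _; try mem.
  by rewrite lerD2l.
apply: le_trans (gen _) _; apply: ler_sum => j _.
rewrite (hnormZ hE) // normrM -!mulrA; apply: ler_wpM2l => //.
by rewrite mulrC; apply: ler_wpM2l => //; apply: (hnorm_ge0 hE).
Qed.

End FiniteDimensionInner.

(** * The scalar product of $\mathbb C^n$ and adjoint matrices *)

Section Dot.
Variables (R : realType).
Local Notation C := R[i].

Lemma dotcDr n (u v w : 'cV[C]_n) : dotc u (v + w) = dotc u v + dotc u w.
Proof. by rewrite /dotc -big_split; apply: eq_bigr => i _; rewrite mxE mulrDr. Qed.
Lemma dotcZr n (a : C) (u v : 'cV[C]_n) : dotc u (a *: v) = a * dotc u v.
Proof. by rewrite /dotc mulr_sumr; apply: eq_bigr => i _; rewrite mxE mulrCA. Qed.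
Lemma dotcC n (u v : 'cV[C]_n) : dotc v u = (dotc u v)^*.
Proof. by rewrite /dotc rmorph_sum; apply: eq_bigr => i _; rewrite rmorphM /= conjCK mulrC. Qed.
Lemma dotcNr n (u v : 'cV[C]_n) : dotc u (- v) = - dotc u v.
Proof. by rewrite -scaleN1r dotcZr mulN1r. Qed.
Lemma dotcBr n (u v w : 'cV[C]_n) : dotc u (v - w) = dotc u v - dotc u w.
Proof. by rewrite dotcDr dotcNr. Qed.
Lemma dotcDl n (u v w : 'cV[C]_n) : dotc (u + v) w = dotc u w + dotc v w.
Proof. by rewrite dotcC dotcDr rmorphD /= -!dotcC. Qed.
Lemma dotcNl n (u v : 'cV[C]_n) : dotc (- u) v = - dotc u v.
Proof. by rewrite dotcC dotcNr rmorphN /= -dotcC. Qed.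
Lemma dotcBl n (u v w : 'cV[C]_n) : dotc (u - v) w = dotc u w - dotc v w.
Proof. by rewrite dotcDl dotcNl. Qed.
Lemma dotc0r n (u : 'cV[C]_n) : dotc u 0 = 0.
Proof. by rewrite /dotc big1 // => i _; rewrite mxE mulr0. Qed.
Lemma dotc0l n (u : 'cV[C]_n) : dotc 0 u = 0.
Proof. by rewrite dotcC dotc0r rmorph0. Qed.

Lemma dotc_delta n (u : 'cV[C]_n) i : dotc (delta_mx i 0) u = u i 0.
Proof.
rewrite /dotc (bigD1 i) //= big1 => [|j ji]; rewrite !mxE.
  by rewrite !eqxx rmorph1 mul1r addr0.
by rewrite (negPf ji) rmorph0 mul0r.
Qed.

Lemma dotc_inj n (u v : 'cV[C]_n) : (forall w, dotc w u = dotc w v) -> u = v.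
Proof. by move=> h; apply/colP => i; rewrite -!dotc_delta h. Qed.

Lemma dotc_adj p q (A : 'M[C]_(p, q)) u v : dotc (mxadj A *m u) v = dotc u (A *m v).
Proof.
rewrite /dotc.
under eq_bigr do rewrite mxE rmorph_sum mulr_suml.
under [RHS]eq_bigr do rewrite mxE mulr_sumr.
rewrite exchange_big; apply: eq_bigr => i _; apply: eq_bigr => j _.
by rewrite !mxE rmorphM /= conjCK; ring.
Qed.

Lemma mxadjE p q (A : 'M[C]_(p, q)) i j : mxadj A i j = (A j i)^*.
Proof. by rewrite !mxE. Qed.

Lemma mxadjK p q (A : 'M[C]_(p, q)) : mxadj (mxadj A) = A.
Proof. by apply/matrixP => i j; rewrite !mxE conjCK. Qed.

Lemma dotc_adjr p q (A : 'M[C]_(p, q)) u v : dotc u (mxadj A *m v) = dotc (A *m u) v.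
Proof. by rewrite -{2}[A]mxadjK dotc_adj. Qed.

Lemma mxadj_mul p q r (A : 'M[C]_(p, q)) (B : 'M[C]_(q, r)) :
  mxadj (A *m B) = mxadj B *m mxadj A.
Proof.
apply/matrixP => i j; rewrite !mxE rmorph_sum; apply: eq_bigr => k _.
by rewrite !mxE rmorphM mulrC.
Qed.

Lemma mxadj_congruence p q (A : 'M[C]_(p, q)) (B : 'M[C]_p) :
  mxadj (mxadj A *m B *m A) = mxadj A *m mxadj B *m A.
Proof. by rewrite !mxadj_mul mxadjK mulmxA. Qed.

End Dot.

Section Quadruples.
Variables (R : realType) (X Y : lmodType R[i]) (G : set ((X * X) * (Y * Y))).
Hypothesis sG : is_subspace G.

Lemma quad0 : G ((0, 0), (0, 0)). Proof. exact: (subspace0 sG). Qed.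

Lemma quadD x y a b x' y' a' b' : G ((x, y), (a, b)) -> G ((x', y'), (a', b')) ->
  G ((x + x', y + y'), (a + a', b + b')).
Proof. exact: (subspaceD sG). Qed.

Lemma quadB x y a b x' y' a' b' : G ((x, y), (a, b)) -> G ((x', y'), (a', b')) ->
  G ((x - x', y - y'), (a - a', b - b')).
Proof. exact: (subspaceB sG). Qed.

Lemma quadZ t x y a b : G ((x, y), (a, b)) -> G ((t *: x, t *: y), (t *: a, t *: b)).
Proof. exact: (subspaceZ sG). Qed.

Lemma quad_sum (I : Type) (r : seq I) (x y : I -> X) (a b : I -> Y) :
  (forall i, G ((x i, y i), (a i, b i))) ->
  G ((\sum_(i <- r) x i, \sum_(i <- r) y i), (\sum_(i <- r) a i, \sum_(i <- r) b i)).
Proof.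
move=> h; elim: r => [|i r IH]; first by rewrite !big_nil; exact: quad0.
by rewrite !big_cons; apply: quadD.
Qed.

End Quadruples.

(** * Boundary triples from Green's identity *)

Section Triples.
Variables (R : realType) (X : lmodType R[i]) (d : nat) (E : hspace X).
Hypothesis hE : is_inner E.
Local Notation C := R[i].
Variables (A : set (X * X)) (G : set ((X * X) * ('cV[C]_d * 'cV[C]_d))).
Hypotheses (AE : forall p, A p -> E p.1 /\ E p.2)
  (domG : [set p | exists ab, G (p, ab)] = A)
  (sG : is_subspace G)
  (ontoG : forall ab, exists p, G (p, ab))
  (green : forall p ab q ab', G (p, ab) -> G (q, ab') ->
     hip E p.1 q.2 - hip E p.2 q.1 = dotc ab.1 ab'.2 - dotc ab.2 ab'.1).

Lemma bmap_dom p ab : G (p, ab) -> A p.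
Proof. by rewrite -domG => h; exists ab. Qed.

(* Green's identity against a surjective map determines the boundary values *)
Lemma bmap_fun p ab ab' : G (p, ab) -> G (p, ab') -> ab = ab'.
Proof.
case: ab ab' => a b [a' b'] h h'.
case: p h h' => x y h h'.
have h0 : G ((0, 0), (a - a', b - b')) by have := quadB sG h h'; rewrite !subrr.
have E0 : E 0 by mem.
have gr c c' : dotc (a - a') c' - dotc (b - b') c = 0.
  have [q hq] := ontoG (c, c'); have [/= q1 q2] := AE (bmap_dom hq).
  by have /= <- := green h0 hq; rewrite !(ip0l hE) // subrr.
congr (_, _); apply/eqP; rewrite -subr_eq0; apply/eqP; apply: dotc_inj => w; rewrite dotc0r.
  by have := gr 0 w; rewrite dotc0r subr0 => h1; rewrite dotcC h1 rmorph0.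
by have := gr w 0; rewrite dotc0r sub0r => /eqP; rewrite oppr_eq0 => /eqP h1; rewrite dotcC h1 rmorph0.
Qed.

Lemma bmap_dom_subspace : is_subspace A.
Proof.
rewrite -domG; split; first by exists 0; exact: (subspace0 sG).
move=> t [u u'] [v v'] [[a b] h] [[a' b'] h']; exists (t *: a + a', t *: b + b').
exact: (quadD sG (quadZ sG t h)).
Qed.

Let A0 := ker0 G.
Let T : set (X * X) := [set p | G (p, (0, 0))].

Lemma ker0_subspace : is_subspace A0.
Proof.
split; first by exists 0; exact: (subspace0 sG).
move=> a [u u'] [v v'] [b hb] [c hc]; exists (a *: b + c).
by have := quadD sG (quadZ sG a hb) hc; rewrite scaler0 addr0.
Qed.

Lemma ker0_sym : A0 `<=` adj E A0.
Proof.
move=> p [b hb]; have [p1 p2] := AE (bmap_dom hb); split => // q [c hc].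
apply/eqP; rewrite -subr_eq0 -opprB (green hc hb) /= dotc0l dotc0r subrr oppr0 //.
Qed.

Hypothesis onto0 : forall (z : C) y, 'Im z != 0 -> E y -> exists x, A0 (x, y + z *: x).

Lemma ker0_sa : A0 = adj E A0.
Proof.
apply: (onto_selfadjoint (z := 'i) hE ker0_subspace ker0_sym) => y Ey; apply: onto0 => //.
  exact: Im_i_neq0.
exact/neq0_Im/Im_i_neq0.
Qed.

Lemma ker0_sub : A0 `<=` A. Proof. by move=> p [b /bmap_dom]. Qed.

(** An element of the adjoint is adjoint to the smaller [A0], hence lies in [A0]; Green's identity
    against elements with values [(w, 0)] then annihilates its second boundary value. *)
Lemma adj_bmap : adj E A = T.
Proof.
apply/seteqP; split=> [p [p1 p2 h]|p hp]; last first.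
  have [p1 p2] := AE (bmap_dom hp); split => // q; rewrite -domG => -[[a b] hq].
  apply/eqP; rewrite -subr_eq0 -opprB (green hq hp) /= !dotc0r subrr oppr0 //.
have [b hb] : A0 p by rewrite ker0_sa; split => // q /ker0_sub; apply: h.
suff b0 : b = 0 by rewrite /T /= -{2}b0.
apply: dotc_inj => w; rewrite dotc0r.
have [q hq] := ontoG (w, 0).
have := green hq hb; rewrite h ?subrr //=; last exact: bmap_dom hq.
by rewrite dotc0r subr0 => <-.
Qed.

(** An element [(x, y)] adjoint to [T] fails to be adjoint to [A0] only through the elements [q s]
    with boundary values [(0, e_s)], which span [A0] modulo [T]. Subtracting a suitable [r] of [A]
    repairs this, and [A0] is self-adjoint. *)
Lemma adj_ker_bmap : adj E T = A.
Proof.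
apply/seteqP; split=> [[x y] [/= Ex Ey h]|p]; last first.
  rewrite -adj_bmap; exact: (adj_adj hE AE).
have /choice[q hq] : forall s : 'I_d, exists q, G (q, (0, delta_mx s 0)).
  by move=> s; apply: ontoG.
pose F p := hip E p.2 x - hip E p.1 y.
(* [F (q s)] measures the failure at [q s]; by Green's identity an [r] with these first values and
   second value zero fails in the same way. *)
have [r hr] := ontoG (\col_s F (q s), 0); have Ar := bmap_dom hr; have [r1 r2] := AE Ar.
have Eq1 s : E (q s).1 by have [] := AE (bmap_dom (hq s)).
have Eq2 s : E (q s).2 by have [] := AE (bmap_dom (hq s)).
suff A0r : A0 (x - r.1, y - r.2).
  have -> : (x, y) = (x - r.1, y - r.2) + r by case: (r) => u v; congr (_, _); rewrite /= subrK.
  apply: subspaceD => //; first exact: bmap_dom_subspace.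
  exact: ker0_sub.
rewrite ker0_sa; split => /=; try mem.
move=> [u v] [b hb]; have [/= Eu Ev] := AE (bmap_dom hb).
pose su := \sum_s b s 0 *: (q s).1; pose sv := \sum_s b s 0 *: (q s).2.
have Esu : E su by rewrite /su; mem.
have Esv : E sv by rewrite /sv; mem.
have hT : T (u - su, v - sv).
  have : G ((su, sv), (0, b)).
    have h1 s : G ((b s 0 *: (q s).1, b s 0 *: (q s).2), (0, b s 0 *: delta_mx s 0)).
      by rewrite -[X in (X, _ *: delta_mx _ _)](scaler0 _ (b s 0)); apply: quadZ => //; rewrite -surjective_pairing.
    have := quad_sum sG (index_enum _) h1; rewrite -/su -/sv big1 //.
    have -> // : \sum_s b s 0 *: delta_mx s 0 = b.
    by rewrite [RHS]matrix_sum_delta; apply: eq_bigr => s _; rewrite big_ord1.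
  by move=> h1; have := quadB sG hb h1; rewrite !subrr.
have hF : F (u, v) = \sum_s (b s 0)^* * F (q s).
  have := h _ hT; rewrite /= !(ipBl hE) // => /eqP; rewrite subr_eq => /eqP h1.
  rewrite /F /= h1; transitivity (hip E sv x - hip E su y); first by ring.
  rewrite /su /sv !(ip_suml hE) //; try mem.
  rewrite -sumrB; apply: eq_bigr => s _.
  by rewrite !(ipZl hE) // mulrBr.
have /= := green hb hr; rewrite dotc0l sub0r => h1.
have h2 : F (u, v) = dotc b (\col_s F (q s)).
  by rewrite hF; apply: eq_bigr => s _; rewrite mxE.
rewrite !(ipBr hE) //; move: h2; rewrite -[dotc _ _]opprK -h1 /F /= opprB => /eqP.
by rewrite subr_eq => /eqP ->; ring.
Qed.

Lemma bmap_kernel : [/\ closed_rel E T, symmetric_rel E T, defect E T d & A = adj E T].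
Proof.
have TA : T `<=` A by move=> p /bmap_dom.
have sT : is_subspace T by rewrite -adj_bmap; apply: adj_subspace.
have TE p : T p -> E p.1 /\ E p.2 by move=> /TA/AE.
split.
- by split; [split|rewrite -adj_bmap; apply: adj_closed].
- by split; [split|rewrite adj_ker_bmap].
- move=> z z0; rewrite adj_ker_bmap.
  (* An element with first boundary value [e_s] becomes an eigenvector after subtracting a solution
     in [A0], which leaves that value unchanged. So the first boundary map takes the eigenspace onto
     $\mathbb C^d$, and [im_inj] makes it injective there. *)
  have /choice[x hx] : forall s : 'I_d, exists x, exists b, G ((x, z *: x), (delta_mx s 0, b)).
    move=> s; have [[u v] hu] := ontoG (delta_mx s 0, 0); have [/= Eu Ev] := AE (bmap_dom hu).
    have [w [b hw]] := onto0 z0 (subspaceB (inner_subspace hE) Ev (subspaceZ (inner_subspace hE) z Eu)).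
    exists (u - w), (0 - b).
    have := quadB sG hu hw; rewrite subr0; congr (G ((_, _), _)).
    by lmod.
  have hsum a : exists b, G ((\sum_s a s *: x s, z *: (\sum_s a s *: x s)), (\col_s a s, b)).
    have /choice[b hb] := hx.
    exists (\sum_s a s *: b s).
    have h1 s := quadZ sG (a s) (hb s).
    have := quad_sum sG (index_enum _) h1; congr (G ((_, _), (_, _))).
      by rewrite scaler_sumr; apply: eq_bigr => s _; rewrite !scalerA mulrC.
    rewrite [RHS]matrix_sum_delta; apply: eq_bigr => s _.
    by rewrite big_ord1 mxE.
  exists x; split.
    move=> a ha; have [b] := hsum a; rewrite ha scaler0 => hb i.
    have [h _] := bmap_fun hb (subspace0 sG).
    by have := congr1 (fun M : 'cV[C]_d => M i 0) h; rewrite !mxE.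
  apply/seteqP; split=> [v hv|v [a ->]]; last first.
    by have [b /bmap_dom] := hsum a.
  move: (hv); rewrite /eigspace /= -domG => -[[a b] hab].
  have [c hc] := hsum (fun s => a s 0).
  exists (fun s => a s 0); apply/eqP; rewrite -subr_eq0; apply/eqP.
  apply: (im_inj hE ker0_sym (z := z)) => //; exists (b - c).
  have := quadB sG hab hc; congr (G ((_, _), (_, _))); first by rewrite scalerBr.
  by apply/colP => i; rewrite !mxE subrr.
- by rewrite adj_ker_bmap.
Qed.

Lemma boundary_triple_green : boundary_triple E A G.
Proof. by split; [exists T; exact: bmap_kernel|split => //; exact: bmap_fun]. Qed.

(** One solution per [c] suffices: two eigenvectors with the same first boundary value differ by an
    element of the kernel of [A0 - z], trivial on the resolvent set. *)
Lemma gamma_weyl_of_solutions (D : set C) (gam : C -> 'cV[C]_d -> X) (M : C -> 'M[C]_d) :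
  rho E A0 = D ->
  (forall z c, D z -> G ((gam z c, z *: gam z c), (c, M z *m c))) ->
  gamma_weyl_given_by E G D gam M.
Proof.
move=> rD h; split => // z Dz.
have inj c f f' b : f' = z *: f -> G ((f, f'), (c, b)) -> f = gam z c.
  move=> -> hf; have hd := quadB sG hf (h z c Dz).
  have : A0 (f - gam z c, 0 + z *: (f - gam z c)).
    by exists (b - M z *m c); move: hd; rewrite subrr add0r scalerBr.
  move: Dz; rewrite -rD => -[/(_ 0 ltac:(by mem)) [y [_ hu]] _].
  move=> /hu e1; have e2 : y = 0.
    by apply: hu; rewrite scaler0 addr0; apply: (subspace0 ker0_subspace).
  by apply/eqP; rewrite -subr_eq0 -e1 e2.
split; apply/seteqP; split => -[c y].
- by move=> [f' [/= e1 [b hb]]]; apply: inj hb.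
- by move=> /= ->; exists (z *: gam z c); split => //=; exists (M z *m c); apply: h.
- move=> [[f f'] [a [[/= e1 [b hb]] hy]]] /=.
  have e2 := inj _ _ _ _ e1 hb; have [_ ->] := bmap_fun hy hb.
  by move: hb; rewrite e1 e2 => hb; have [] := bmap_fun hb (h z c Dz).
- move=> /= ->; exists (gam z c, z *: gam z c), c; split; last exact: h.
  by split => //=; exists (M z *m c); apply: h.
Qed.

End Triples.

(** * The scale *)

Section ScaleTheory.
Variables (R : realType) (S : scale_data R).
Hypothesis hS : is_scale S.
Local Notation C := R[i].
Local Notation X := (sX S).
Local Notation H0 := (sH0 S).
Local Notation L := (sL S).
Local Notation Omg := (@Omg R S).
Implicit Types (u v w f g x y psi : X) (z : C) (n k : nat).

Lemma H0_inner : is_inner H0. Proof. by case: (sc_hilbert hS). Qed.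
Let h0 := H0_inner.
Let hH := sc_hilbert hS.

Lemma H0_sub : is_subspace H0. Proof. exact: inner_subspace. Qed.
#[local] Hint Resolve H0_sub : mem.

Lemma Lop : is_op L. Proof. by case: (sc_L hS). Qed.
Lemma Lsa : L = adj H0 L. Proof. by case: (sc_L hS). Qed.
Lemma Lsub : is_subspace L. Proof. exact: (sa_subspace hH Lsa). Qed.
Lemma LH0 x y : L (x, y) -> H0 x /\ H0 y. Proof. by move/(sa_inE Lsa). Qed.
Lemma Lsym x y x' y' : L (x, y) -> L (x', y') -> hip H0 y x' = hip H0 x y'.
Proof. by move=> h; rewrite Lsa => -[_ _ h']; apply: (h' (x, y)). Qed.

Lemma rdom_Omg n : rdom (Omg n) = Hp S n.
Proof. by apply/seteqP; split=> [x [y []] //|x hx]; exists (sOm S n x). Qed.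

Lemma Omg_sub n : is_subspace (Omg n).
Proof. by case: (sc_Om_sa hS n) => _ h; apply: (sa_subspace hH h). Qed.

Lemma Hp_sub n : is_subspace (Hp S n).
Proof. by rewrite -rdom_Omg; apply: rdom_subspace (Omg_sub n). Qed.
#[local] Hint Resolve Hp_sub : mem.

Lemma HpS n x : Hp S n.+1 x -> Hp S n x.
Proof. by move=> [y [y' [h _]]]; exists y'. Qed.

Lemma Hp_le n k x : (n <= k)%N -> Hp S k x -> Hp S n x.
Proof.
move=> /subnK <-; elim: (k - n)%N => [//|j IH]; rewrite addSn => /HpS; exact: IH.
Qed.

Lemma Hp0 : Hp S 0 = H0 :> set X.
Proof. by apply/seteqP; split=> [x [y []] //|x hx]; exists x. Qed.

Lemma HpH0 n x : Hp S n x -> H0 x.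
Proof. by move=> /(@Hp_le 0 n _ (leq0n n)); rewrite Hp0. Qed.

Lemma OmH0 n x : Hp S n x -> H0 (sOm S n x). Proof. exact: sc_Om_in. Qed.

Lemma Om_inj n x y : Hp S n x -> Hp S n y -> sOm S n x = sOm S n y -> x = y.
Proof.
move=> hx hy e; have [w [_ h]] := sc_Om_bij hS n (OmH0 hx).
by rewrite -(h x) // -(h y).
Qed.

(** The inverse of $\Omega_n$ as an everywhere defined operator of $\mathfrak H_0$ with range
    $\mathfrak H_n$: symmetry and commutation hold for it without domain conditions. *)
Definition Vn n u : X := xget 0 [set f | Hp S n f /\ sOm S n f = u].

Lemma VnP n u : H0 u -> Hp S n (Vn n u) /\ sOm S n (Vn n u) = u.
Proof.
move=> hu; have [w [hw _]] := sc_Om_bij hS n hu.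
by apply: (xgetPex 0 (P := [set f | Hp S n f /\ sOm S n f = u])); exists w.
Qed.

Lemma Vn_in n u : H0 u -> Hp S n (Vn n u). Proof. by move=> /(@VnP n)[]. Qed.
Lemma OmVn n u : H0 u -> sOm S n (Vn n u) = u. Proof. by move=> /(@VnP n)[]. Qed.
Lemma VnH0 n u : H0 u -> H0 (Vn n u). Proof. by move=> /(@Vn_in n)/HpH0. Qed.
#[local] Hint Resolve Vn_in VnH0 OmH0 HpH0 : mem.

Lemma VnOm n f : Hp S n f -> Vn n (sOm S n f) = f.
Proof. by move=> hf; apply: (@Om_inj n); [mem|mem|rewrite OmVn //; mem]. Qed.

Lemma Vn_eq n f u : Hp S n f -> sOm S n f = u -> f = Vn n u.
Proof. by move=> hf <-; rewrite VnOm. Qed.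

Lemma Vn_inj n u v : H0 u -> H0 v -> Vn n u = Vn n v -> u = v.
Proof. by move=> hu hv e; rewrite -(OmVn n hu) e OmVn. Qed.

Lemma Vn_lin n (a : C) u v : H0 u -> H0 v -> Vn n (a *: u + v) = a *: Vn n u + Vn n v.
Proof.
move=> hu hv; apply/esym/Vn_eq; first by mem.
by rewrite (sc_Om_lin hS) ?OmVn //; mem.
Qed.

Lemma Vn0 n : Vn n 0 = 0.
Proof.
have z0 : H0 0 by mem.
have := Vn_lin n 1 z0 z0; rewrite scaler0 addr0 scale1r => /eqP.
by rewrite -subr_eq0 opprD addrA subrr sub0r oppr_eq0 => /eqP.
Qed.

Lemma Vn0E u : H0 u -> Vn 0 u = u.
Proof. by move=> hu; apply/esym/Vn_eq; [rewrite Hp0|exact: (sc_Om0 hS)]. Qed.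

Lemma OmgV n u : H0 u -> Omg n (Vn n u, u).
Proof. by move=> hu; split; [exact: Vn_in|rewrite /= OmVn]. Qed.

Lemma Vn_sym n u v : H0 u -> H0 v -> hip H0 (Vn n u) v = hip H0 u (Vn n v).
Proof.
move=> hu hv; have [_ sa] := sc_Om_sa hS n.
have := OmgV n hv; rewrite {1}sa => -[_ _ /(_ _ (OmgV n hu))] /= ->.
by [].
Qed.

Lemma VnC n k u : H0 u -> Vn n (Vn k u) = Vn k (Vn n u).
Proof.
move=> hu; have : rcomp (Omg n) (Omg k) (Vn k (Vn n u), u).
  by exists (Vn n u); split; apply: OmgV; mem.
rewrite (sc_OmC hS) => -[y [[/= h1 ->] [/= h2 h3]]].
by rewrite -(VnOm h1) -(VnOm h2) -h3.
Qed.

Lemma Vn_L n x y : L (x, y) -> L (Vn n x, Vn n y).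
Proof.
move=> hL; have [hx hy] := LH0 hL.
have : rcomp L (Omg n) (Vn n x, y) by exists x; split => //; apply: OmgV.
rewrite (sc_OmL hS) => -[w [h [/= hw ->]]].
by rewrite VnOm.
Qed.

Lemma L_Vn n x y : H0 x -> H0 y -> L (Vn n x, Vn n y) -> L (x, y).
Proof.
move=> hx hy hL.
have : rcomp (Omg n) L (Vn n x, y) by exists (Vn n y); split => //; apply: OmgV.
rewrite -(sc_OmL hS) => -[w [[/= _ ->] h]].
by move: h; rewrite OmVn.
Qed.

Definition rs z u : X := resolvent L z u.

Lemma rsP z u : rhoL S z -> H0 u -> L (rs z u, u + z *: rs z u).
Proof.
move=> [h _] hu; have [x [hx _]] := h u hu.
by apply: (xgetPex 0 (P := [set x | L (x, u + z *: x)])); exists x.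
Qed.

Lemma rs_eq z u x : rhoL S z -> H0 u -> L (x, u + z *: x) -> x = rs z u.
Proof.
move=> hz hu hx; have [h _] := hz; have [x' [_ h']] := h u hu.
by rewrite -(h' x) // -(h' (rs z u)) //; apply: rsP.
Qed.

Lemma rhoL_nonreal z : 'Im z != 0 -> rhoL S z.
Proof. exact: (sa_rho hH Lop Lsa). Qed.

Lemma rhoL_conj z : rhoL S z -> rhoL S z^*.
Proof.
move=> hz; have [z0|z0] := eqVneq ('Im z) 0; last exact/rhoL_nonreal/neq0_Im.
by have /eqP -> : z^* == z by rewrite -CrealE; apply/Creal_ImP.
Qed.

Lemma rhoL_i : rhoL S 'i. Proof. exact/rhoL_nonreal/Im_i_neq0. Qed.

Lemma rsH0 z u : rhoL S z -> H0 u -> H0 (rs z u).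
Proof. by move=> hz hu; case: (LH0 (rsP hz hu)). Qed.
#[local] Hint Resolve rsH0 rhoL_i : mem.

Lemma rs_lin z (a : C) u v : rhoL S z -> H0 u -> H0 v -> rs z (a *: u + v) = a *: rs z u + rs z v.
Proof.
move=> hz hu hv; apply/esym/rs_eq => //; first by mem.
have := relD Lsub (relZ Lsub a (rsP hz hu)) (rsP hz hv); congr (L (_, _)); lmod.
Qed.

Lemma rs_Vn z n u : rhoL S z -> H0 u -> Vn n (rs z u) = rs z (Vn n u).
Proof.
move=> hz hu; apply: rs_eq => //; first by mem.
have := Vn_L n (rsP hz hu); congr (L (_, _)).
rewrite addrC Vn_lin; try mem; exact: addrC.
Qed.

Lemma rs_inj z u v : rhoL S z -> H0 u -> H0 v -> rs z u = rs z v -> u = v.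
Proof.
move=> hz hu hv e; have := rsP hz hu; rewrite e => /Lop /(_ (rsP hz hv)).
exact: addIr.
Qed.

Lemma rdomL : rdom L = Hp S 2.
Proof.
rewrite -(sc_dom hS 1); apply/seteqP; split=> x [y h]; exists y.
  by exists x; split => //; have [] := LH0 h.
by case: h => x' [[/= _ ->]].
Qed.

(** $\Omega_n$ carries $\mathfrak H_{n+2}$ onto $\mathfrak H_2=\operatorname{dom}L$ and commutes
    with the resolvent, which reduces the gain of two orders to [n = 0]. *)
Lemma Hp_rs z n v : rhoL S z -> Hp S n v -> Hp S n.+2 (rs z v).
Proof.
move=> hz hv; have hv0 := HpH0 hv; have hO := OmH0 hv.
have : Hp S 2 (rs z (sOm S n v)).
  rewrite -rdomL; exists (sOm S n v + z *: rs z (sOm S n v)); exact: rsP.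
rewrite -(sc_Om2 hS n) => -[f hf e].
have hfn : Hp S n f by do 2! apply: HpS.
have fE : f = rs z v by rewrite (Vn_eq hfn e) rs_Vn // VnOm.
by rewrite -fE.
Qed.

Lemma Hp_rs_inv z n x : rhoL S z -> Hp S n.+2 x -> exists2 v, Hp S n v & x = rs z v.
Proof.
move=> hz hx; have hxn : Hp S n x by do 2! apply: HpS.
have : Hp S 2 (sOm S n x) by rewrite -(sc_Om2 hS n); exists x.
rewrite -rdomL => -[y hy]; have [Ox Oy] := LH0 hy.
have hyz : H0 (y - z *: sOm S n x) by mem.
exists (Vn n (y - z *: sOm S n x)); first by mem.
rewrite -rs_Vn //; apply: Vn_eq => //; apply: rs_eq => //.
by rewrite subrK.
Qed.

Lemma Hp_L n x y : Hp S n.+2 x -> L (x, y) -> Hp S n y.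
Proof.
move=> hx hL; have [v hv xE] := Hp_rs_inv rhoL_i hx.
have hv0 := HpH0 hv.
have -> : y = v + 'i *: x by apply: (Lop hL); rewrite xE; apply: rsP => //; mem.
have hxn : Hp S n x by do 2! apply: HpS.
mem.
Qed.

Lemma L_Hp n x y : Hp S n x -> Hp S n y -> L (x, y) -> Hp S n.+2 x.
Proof.
move=> hx hy hL; have hyx : Hp S n (y - 'i *: x) by mem.
rewrite (@rs_eq 'i (y - 'i *: x) x) //; [exact: Hp_rs rhoL_i _|mem|mem|].
by rewrite subrK.
Qed.

(** The operators [Vn n.+2] and [rs z] after [Vn n] share only their range $\mathfrak H_{n+2}$, so
    the argument changes from [u] to some [u']. *)
Lemma Vn_shift z n u : rhoL S z -> H0 u -> exists2 u', H0 u' & rs z (Vn n u) = Vn n.+2 u'.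
Proof.
move=> hz hu; have h := Hp_rs hz (Vn_in n hu).
by exists (sOm S n.+2 (rs z (Vn n u))); [mem|rewrite VnOm].
Qed.

Lemma Vn_shift_inv z n u : rhoL S z -> H0 u -> exists2 u', H0 u' & Vn n.+2 u = rs z (Vn n u').
Proof.
move=> hz hu; have [v hv e] := Hp_rs_inv hz (Vn_in n.+2 hu).
by exists (sOm S n v); [mem|rewrite VnOm].
Qed.

(** [Vn_shift] advances [n] by two, whence the pair of consecutive indices in the induction; the
    base cases are $\Omega_0=I$ and $\Omega_1(\mathfrak H_2)=\mathfrak H_1$. *)
Lemma Vn_double n : (forall x, Hp S n x -> Hp S n.*2 (Vn n x)) /\
  (forall y, Hp S n.*2 y -> exists2 x, Hp S n x & y = Vn n x).
Proof.
have hi := rhoL_i.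
suff h : ((forall x, Hp S n x -> Hp S n.*2 (Vn n x)) /\
  (forall y, Hp S n.*2 y -> exists2 x, Hp S n x & y = Vn n x)) /\
  ((forall x, Hp S n.+1 x -> Hp S n.+1.*2 (Vn n.+1 x)) /\
  (forall y, Hp S n.+1.*2 y -> exists2 x, Hp S n.+1 x & y = Vn n.+1 x)) by case: h.
elim: n => [|n [IH1 IH2]]; split => //.
- split=> [x|y]; rewrite double0 Hp0 => hx; first by rewrite Vn0E.
  by exists y; rewrite ?Hp0 ?Vn0E.
- split=> [x hx|y hy].
    have : Hp S 1 x by []. rewrite -{1}(sc_Om1 hS) => -[f hf <-].
    by rewrite VnOm //; apply: HpS.
  exists (sOm S 1 y); first by rewrite -(sc_Om1 hS); exists y.
  by rewrite VnOm //; apply: HpS.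
- case: IH1 => IHa IHb; split=> [x hx|y].
    have [u hu] := Vn_shift_inv n hi (OmH0 hx); rewrite VnOm // => xE.
    have [u' hu' e] := Vn_shift_inv n hi hu.
    rewrite xE (rs_Vn _ hi) ?(VnC n.+2) ?e ?(rs_Vn _ hi); try mem.
    by rewrite !doubleS; do 2! apply: Hp_rs => //; apply: IHa; mem.
  rewrite !doubleS => /(Hp_rs_inv hi)[y1 /(Hp_rs_inv hi)[y2 /IHb[x' hx' ->] ->] ->].
  have hO := OmH0 hx'; have [b hb e] := Vn_shift n hi hO.
  exists (rs 'i (Vn n b)); first by apply: Hp_rs => //; mem.
  rewrite (rs_Vn _ hi) ?(VnC n.+2) -?e ?(rs_Vn _ hi) ?VnOm //; mem.
Qed.

(** Serves for [OmtV m.+2], which is [Vn m.+2] on $\mathfrak H_0$: it turns smoothness of a vector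
    of $\mathfrak H_m$ into smoothness of its image. *)
Lemma Vn_double2 n : (forall x, Hp S n x -> Hp S n.*2.+2 (Vn n.+2 x)) /\
  (forall y, Hp S n.*2.+2 y -> exists2 x, Hp S n x & y = Vn n.+2 x).
Proof.
have hi := rhoL_i; have [ha hb] := Vn_double n; split=> [x hx|y].
  have hO := OmH0 hx; have [u hu e] := Vn_shift_inv n hi hO.
  rewrite -(VnOm hx) VnC // e rs_Vn //; last by mem.
  by apply: Hp_rs => //; apply: ha; mem.
move=> /(Hp_rs_inv hi)[y1 /hb[x hx ->] ->]; have hO := OmH0 hx.
have [b hb' e] := Vn_shift n hi hO.
exists (Vn n b); first by mem.
by rewrite -VnC // -e rs_Vn ?VnOm //; mem.
Qed.

(** Meant for [n = m - 2], where [n.+4] is again [m.+2]. *)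
Lemma Vn_double4 n : (forall x, Hp S n x -> Hp S n.*2.+4 (Vn n.+4 x)) /\
  (forall y, Hp S n.*2.+4 y -> exists2 x, Hp S n x & y = Vn n.+4 x).
Proof.
have hi := rhoL_i; have [ha hb] := Vn_double2 n; split=> [x hx|y].
  have hO := OmH0 hx; have [u hu e] := Vn_shift_inv n.+2 hi hO.
  rewrite -(VnOm hx) VnC // e rs_Vn //; last by mem.
  rewrite VnC //; apply: Hp_rs => //; apply: ha; mem.
move=> /(Hp_rs_inv hi)[y1 /hb[x hx ->] ->]; have hO := OmH0 hx.
have [b hb' e] := Vn_shift n.+2 hi hO.
exists (Vn n b); first by mem.
by rewrite -VnC // -e rs_Vn ?(VnC n n.+2) ?VnOm //; mem.
Qed.

Lemma Hp_inner n : is_inner (Hp S n).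
Proof.
split=> /=.
- exact: Hp_sub.
- by move=> a x y w hx hy hw; rewrite (sc_Om_lin hS) // (ipDr h0) ?(ipZr h0) //; mem.
- by move=> x y hx hy; rewrite (ipC h0) //; mem.
- by move=> x hx; apply: (ip_ge0 h0); mem.
- move=> x hx /(ip_eq0 h0 (OmH0 hx)) e.
  by rewrite -(VnOm hx) e Vn0.
Qed.

Lemma hnorm_Hp_Vn n u : H0 u -> hnorm (Hp S n) (Vn n u) = hnorm H0 u.
Proof. by move=> hu; rewrite /hnorm /= OmVn. Qed.

(** * Negative spaces of the scale represented in $\mathfrak H_0$ *)

Local Notation U := (@OmtV R S).

Lemma neg_sub n : is_subspace (sneg S n). Proof. exact: (sc_neg_sub hS). Qed.
#[local] Hint Resolve neg_sub : mem.
#[local] Hint Extern 1 (sneg _ _ _) => subspace_step : mem.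

Lemma neg_le n k psi : (n <= k)%N -> sneg S n psi -> sneg S k psi.
Proof.
move=> /subnK <-; elim: (k - n)%N => [//|j IH]; rewrite addSn => /IH; exact: (sc_negS hS).
Qed.

Lemma H0_neg n u : H0 u -> sneg S n u.
Proof. by move=> hu; apply: (neg_le (leq0n n)); rewrite (sc_neg0 hS). Qed.

(** Riesz in $\mathfrak H_0$ for [u |-> spair psi (Vn n u)], the functional transported by the
    unitary $\Omega_n$. *)
Lemma UP n psi : sneg S n psi -> H0 (U n psi) /\
  forall f, Hp S n f -> spair psi f = hip H0 (U n psi) (sOm S n f).
Proof.
move=> hpsi; have [M hM] := sc_pair_bdd hS hpsi.
have Flin (a : C) f g : H0 f -> H0 g -> spair psi (Vn n (a *: f + g)) = a * spair psi (Vn n f) + spair psi (Vn n g).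
  by move=> hf hg; rewrite Vn_lin // (sc_pairr hS _ hpsi) //; mem.
have Fbd f : H0 f -> `|spair psi (Vn n f)| <= M * hnorm H0 f.
  by move=> hf; rewrite -(hnorm_Hp_Vn n hf); apply: hM; mem.
have [u hu hF] := riesz hH Flin Fbd.
pose P u := H0 u /\ forall f, Hp S n f -> spair psi f = hip H0 u (sOm S n f).
apply: (xgetPex 0 (P := P)); exists u; split => // f hf.
by rewrite -hF ?VnOm //; mem.
Qed.

Lemma UH0 n psi : sneg S n psi -> H0 (U n psi). Proof. by move=> /UP[]. Qed.
#[local] Hint Resolve UH0 : mem.

Lemma spairE n psi f : sneg S n psi -> Hp S n f -> spair psi f = hip H0 (U n psi) (sOm S n f).
Proof. by move=> /UP[_ h] /h. Qed.

Lemma U_eq n psi u : sneg S n psi -> H0 u ->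
  (forall f, Hp S n f -> spair psi f = hip H0 u (sOm S n f)) -> U n psi = u.
Proof.
move=> hpsi hu h; apply/eqP; rewrite -subr_eq0; apply/eqP; apply: (ip_eq0 h0); first by mem.
have hV : Hp S n (Vn n (U n psi - u)) by mem.
have := h _ hV; rewrite (spairE hpsi hV) OmVn; last by mem.
move=> e; rewrite (ipBl h0) ?e ?subrr //; mem.
Qed.

Lemma U_lin n (a : C) psi phi : sneg S n psi -> sneg S n phi ->
  U n (a *: psi + phi) = a *: U n psi + U n phi.
Proof.
move=> h1 h2; apply: U_eq; [mem|mem|move=> f hf].
rewrite (sc_pairl hS _ h1 h2 hf) (spairE h1 hf) (spairE h2 hf).
by rewrite (ipDl h0) ?(ipZl h0) //; mem.
Qed.

Lemma U_inj n psi phi : sneg S n psi -> sneg S n phi -> U n psi = U n phi -> psi = phi.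
Proof.
move=> h1 h2 e; apply/eqP; rewrite -subr_eq0; apply/eqP.
apply: (sc_pair_inj hS (n := n)); first by mem.
move=> f hf; rewrite addrC -scaleN1r (sc_pairl hS _ h2 h1 hf) rmorphN rmorph1 mulN1r.
by rewrite (spairE h1 hf) (spairE h2 hf) e addrC subrr.
Qed.

Lemma U_onto n u : H0 u -> exists2 psi, sneg S n psi & U n psi = u.
Proof.
move=> hu; have [||psi hpsi h] := sc_pair_surj hS (n := n) (F := fun f => hip H0 u (sOm S n f)).
- by move=> a f g hf hg; rewrite (sc_Om_lin hS) // (ipDr h0) ?(ipZr h0) //; mem.
- by exists (hnorm H0 u) => f hf; apply: (cauchy_schwarz h0); mem.
by exists psi => //; apply: U_eq => // f hf; rewrite h.
Qed.

Lemma U_H0 n u : H0 u -> U n u = Vn n u.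
Proof.
move=> hu; apply: U_eq; [exact: H0_neg|mem|move=> f hf].
rewrite (sc_pair0 hS) //; last by mem.
by rewrite Vn_sym ?VnOm //; mem.
Qed.

(** Tested on [h], both sides give, up to conjugation, the value of [psi] at [Vn n (Vn k h)],
    computed at level [k] and at level [n]. *)
Lemma U_comm n k psi : sneg S n psi -> sneg S k psi -> Vn n (U k psi) = Vn k (U n psi).
Proof.
move=> hn hk; apply/eqP; rewrite -subr_eq0; apply/eqP.
have h1 : H0 (Vn n (U k psi)) by mem.
have h2 : H0 (Vn k (U n psi)) by mem.
apply: (ip_eq0_all h0) => [|h hh]; first by mem.
have hnV : Hp S n (Vn k (Vn n h)) by rewrite -VnC //; mem.
have hkV : Hp S k (Vn k (Vn n h)) by mem.
have := spairE hn hnV; rewrite (spairE hk hkV) OmVn; last by mem.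
rewrite -VnC // OmVn; last by mem.
rewrite -!Vn_sym; try mem.
move=> e; rewrite (ipBr h0) // (ipC h0 h1 hh) (ipC h0 h2 hh) e subrr //.
Qed.

Lemma Hn_inner n : is_inner (Hn S n).
Proof.
split=> /=.
- exact: neg_sub.
- by move=> a x y w hx hy hw; rewrite U_lin // (ipDr h0) ?(ipZr h0) //; mem.
- by move=> x y hx hy; rewrite (ipC h0) //; mem.
- by move=> x hx; apply: (ip_ge0 h0); mem.
- move=> x hx /(ip_eq0 h0 (UH0 hx)) e; apply: (@U_inj n) => //; first by mem.
  by rewrite e U_H0 ?Vn0 //; mem.
Qed.

Lemma Vn_dense n : is_dense H0 (Vn n @` H0).
Proof.
have [opO saO] := sc_Om_sa hS n; rewrite /selfadjoint in saO.
suff -> : Vn n @` H0 = rdom (Omg n) by exact: (sa_dense hH opO saO).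
rewrite rdom_Omg; apply/seteqP; split=> [x [u hu <-]|x hx]; first by mem.
by exists (sOm S n x); [mem|rewrite VnOm].
Qed.

Lemma hnorm_Hn_sub k x q : sneg S k x -> H0 q ->
  hnorm (Hn S k) (x - q) = hnorm H0 (U k x - Vn k q).
Proof.
move=> hx hq; rewrite /hnorm /=; have hq' := H0_neg k hq.
have -> : U k (x - q) = U k x - Vn k q by rewrite addrC -scaleN1r U_lin // scaleN1r addrC (U_H0 _ hq).
by [].
Qed.

(* The extension of [T] to H_{-k} is unitarily equivalent to [T]. *)
Lemma extension_iff k (T : set (X * X)) : is_op T -> T = adj H0 T ->
  (forall x y, T (x, y) -> T (Vn k x, Vn k y)) ->
  forall x y, rclosure (Hn S k) T (x, y) <-> [/\ sneg S k x, sneg S k y & T (U k x, U k y)].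
Proof.
move=> opT saT TV x y; split.
  move=> [/= hx hy h]; split => //; apply: (sa_closed hH saT); split=> /=; try mem.
  move=> e e0; have [[q1 q2] [hq /= b1 b2]] := h e e0.
  have [/= Hq1 Hq2] := sa_inE saT hq.
  exists (Vn k q1, Vn k q2); split => /=; first exact: TV.
    by rewrite -hnorm_Hn_sub.
  by rewrite -hnorm_Hn_sub.
move=> [hx hy hT]; split => //= e e0.
have Vl a u v : H0 u -> H0 v -> Vn k (a *: u + v) = a *: Vn k u + Vn k v := @Vn_lin k a u v.
have [[q1 q2] [hq b1 b2]] := core_dense hH opT saT Vl (Vn_dense k) TV hT e0.
have [/= Hq1 Hq2] := sa_inE saT hq.
by exists (q1, q2); split => //=; rewrite hnorm_Hn_sub.
Qed.

Lemma Lext_iff k x y : Lext S k (x, y) <-> [/\ sneg S k x, sneg S k y & L (U k x, U k y)].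
Proof. by apply: extension_iff; [exact: Lop|exact: Lsa|exact: Vn_L]. Qed.

Lemma Omext_iff k n x y : @Omext R S k n (x, y) <-> [/\ sneg S k x, sneg S k y & Omg n (U k x, U k y)].
Proof.
have [opO saO] := sc_Om_sa hS n.
apply: extension_iff => // u v [/= hu ->]; have hO := OmH0 hu.
split; first by rewrite -(VnOm hu) VnC //; apply: Vn_in; mem.
by rewrite /= -{2}(VnOm hu) VnC // OmVn //; mem.
Qed.

Lemma PinvP k n psi : sneg S k psi -> sneg S k (Pinv S k n psi) /\
  U k (Pinv S k n psi) = Vn n (Vn n (U k psi)).
Proof.
move=> hpsi; have hU := UH0 hpsi.
have [e1 he1 e1E] := U_onto k (VnH0 n hU); have [e2 he2 e2E] := U_onto k (VnH0 n (VnH0 n hU)).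
have hVV : H0 (Vn n (U k psi)) by mem.
have : rcomp (@Omext R S k n) (@Omext R S k n) (Pinv S k n psi, psi).
  apply: (xgetPex 0 (P := [set e | rcomp (@Omext R S k n) (@Omext R S k n) (e, psi)])).
  by exists e2, e1; split; apply/Omext_iff; split => //; rewrite ?e1E ?e2E ?e1E; apply: OmgV.
move=> [y [/= /Omext_iff[h1 h2 [/= h3 h4]] /Omext_iff[_ _ [/= h5 h6]]]]; split => //.
by rewrite h6 VnOm // h4 VnOm.
Qed.

Lemma RextP k z psi : rhoL S z -> sneg S k psi ->
  sneg S k (resolvent (Lext S k) z psi) /\ U k (resolvent (Lext S k) z psi) = rs z (U k psi).
Proof.
move=> hz hpsi; have hU := UH0 hpsi.
have [x hx xE] := U_onto k (rsH0 hz hU).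
have : Lext S k (resolvent (Lext S k) z psi, psi + z *: resolvent (Lext S k) z psi).
  apply: (xgetPex 0 (P := [set x | Lext S k (x, psi + z *: x)])); exists x.
  apply/Lext_iff; split => //; first by mem.
  by rewrite addrC U_lin // xE addrC; apply: rsP.
move=> /Lext_iff[h1 _ h2]; split => //; apply: rs_eq => //.
by move: h2; rewrite addrC U_lin // addrC.
Qed.

(** An instance of the rule that [psi] lies in $\mathfrak H_n$ exactly when [U m.+2 psi] lies in
    $\mathfrak H_{n+m+2}$, here for [n = -m]. The next two lemmas are the cases [n = m] and, with
    [m] shifted by two, [n = m - 2]. *)
Lemma neg_U2 m psi : sneg S m.+2 psi -> sneg S m psi <-> Hp S 2 (U m.+2 psi).
Proof.
move=> hpsi; have hU := UH0 hpsi; have hi := rhoL_i; split.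
  move=> hm; have hUm := UH0 hm; have [u hu e] := Vn_shift_inv m hi hUm.
  have := U_comm hm hpsi; rewrite e -rs_Vn // => /Vn_inj -> //; last by mem.
  by apply: Hp_rs => //; rewrite Hp0.
move=> /(Hp_rs_inv hi)[u]; rewrite Hp0 => hu uE.
have [u' hu' e] := Vn_shift m hi hu.
have [psi' hpsi' e'] := U_onto m hu'.
have hm2 : sneg S m.+2 psi' by apply: neg_le hpsi'; rewrite ltnW.
suff -> : psi = psi' by [].
apply: (@U_inj m.+2) => //; apply: (@Vn_inj m) => //; first by mem.
by rewrite (U_comm hpsi' hm2) e' -e uE rs_Vn.
Qed.

Lemma Hp_U2 m psi : sneg S m.+2 psi -> Hp S m psi <-> Hp S m.*2.+2 (U m.+2 psi).
Proof.
move=> hpsi; have [ha hb] := Vn_double2 m; split.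
  by move=> h; rewrite U_H0; [apply: ha|mem].
move=> /hb[x hx e]; suff -> : psi = x by [].
apply: (@U_inj m.+2) => //; first by apply: H0_neg; mem.
by rewrite e U_H0 //; mem.
Qed.

Lemma Hp_U4 m psi : sneg S m.+4 psi -> Hp S m psi <-> Hp S m.*2.+4 (U m.+4 psi).
Proof.
move=> hpsi; have [ha hb] := Vn_double4 m; split.
  by move=> h; rewrite U_H0; [apply: ha|mem].
move=> /hb[x hx e]; suff -> : psi = x by [].
apply: (@U_inj m.+4) => //; first by apply: H0_neg; mem.
by rewrite e U_H0 //; mem.
Qed.

(** Symmetry of $W=\Omega_m\Omega_{m+2}^{-1}$, where [g = W a] and [e = W h]. Both sides are the
    pairing of one [psi] in $\mathfrak H_{-m}$ with [Vn m e], computed at levels [m+2] and [m]. *)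
Lemma weak_comm m a e g h : H0 a -> H0 e -> H0 g -> H0 h ->
  Vn m g = Vn m.+2 a -> Vn m e = Vn m.+2 h -> hip H0 g h = hip H0 a e.
Proof.
move=> ha he hg hh e1 e2; have [psi hpsi Ua] := U_onto m ha.
have hm2 : sneg S m.+2 psi by apply: neg_le hpsi; rewrite ltnW.
have Ug : U m.+2 psi = g.
  by apply: (@Vn_inj m) => //; [mem|rewrite (U_comm hpsi hm2) Ua].
have hf : Hp S m.+2 (Vn m e) by rewrite e2; mem.
have hfm : Hp S m (Vn m e) by mem.
have := spairE hpsi hfm; rewrite (spairE hm2 hf) Ug Ua OmVn // => <-.
by rewrite e2 OmVn.
Qed.

(* [L W] is symmetric for the everywhere defined [W = Om_m Om_{m+2}^{-1}]:
   first on the range of the resolvents, then by regularization. *)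
Lemma weak_comm_L m a e e' g g' h : H0 a -> H0 h -> L (g, g') -> L (e, e') ->
  Vn m g = Vn m.+2 a -> Vn m e = Vn m.+2 h -> hip H0 g' h = hip H0 a e'.
Proof.
move=> ha hh hg he e1 e2; have [Hg Hg'] := LH0 hg; have [He He'] := LH0 he.
have reg (w : C) : 'Im w != 0 -> hip H0 g' (rs w h) = hip H0 a (rs w e').
  move=> /rhoL_nonreal hw; have hr := rsP hw hh; have [Hr Hr'] := LH0 hr.
  have hre : L (rs w e, rs w e').
    have hre := rsP hw He; have [Hre Hre'] := LH0 hre.
    rewrite -(@rs_eq w e' (e + w *: rs w e)) //.
    by apply: relD Lsub _ _ _ _ he (relZ Lsub w hre).
  rewrite (Lsym hg hr); have [Hre Hre'] := LH0 hre.
  apply: (@weak_comm m) => //.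
  apply: (@Lop (Vn m (rs w e))); first exact: Vn_L.
  by rewrite rs_Vn // e2 -rs_Vn //; apply: Vn_L.
apply/eqP; rewrite -subr_eq0; apply/eqP.
apply: (@eq0_small _ _ (hnorm H0 g' + hnorm H0 a)); first by rewrite addr_ge0 ?hnorm_ge0.
move=> eps eps0; have [w hw hwe] := yosida2 hH Lop Lsa hh He' eps0.
have hw' := rhoL_nonreal hw.
have [b1 b2] := hwe _ _ (rsP hw' hh) (rsP hw' He').
have -> : hip H0 g' h - hip H0 a e' =
    hip H0 g' (h + w *: rs w h) - hip H0 a (e' + w *: rs w e').
  rewrite !(ipDr h0) ?(ipZr h0) ?reg //; try mem.
  by ring.
apply: le_trans (ler_normB _ _) _; rewrite mulrDl; apply: lerD.
  apply: le_trans (cauchy_schwarz h0 _ _) _; try mem.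
  by apply: ler_wpM2l; [exact: hnorm_ge0|exact: ltW].
apply: le_trans (cauchy_schwarz h0 _ _) _; try mem.
by apply: ler_wpM2l; [exact: hnorm_ge0|exact: ltW].
Qed.

(** The left pairing lives at level [m], the right one at level [m+2]; [weak_comm_L] and [weak_comm]
    bridge the levels. The conjugate of [z] comes from antilinearity in the first argument. *)
Lemma spair_resolvent m z phi g f f' : rhoL S z -> sneg S m.+2 phi -> sneg S m g ->
  U m.+2 g = rs z (U m.+2 phi) -> Hp S m.+2 f -> L (f, f') ->
  spair g (f' - z^* *: f) = spair phi f.
Proof.
move=> hz hphi hg gE hf hL.
have hg2 : sneg S m.+2 g by apply: neg_le hg; rewrite ltnW.
have hfm : Hp S m f by do 2! apply: HpS.
have hfm' : Hp S m f' := Hp_L hf hL.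
have hff : Hp S m (f' - z^* *: f) by mem.
have hUg := UH0 hg; have hUg2 := UH0 hg2; have hUphi := UH0 hphi.
have hOf := OmH0 hf; have hOfm := OmH0 hfm; have hOfm' := OmH0 hfm'.
have hUL : L (U m.+2 g, U m.+2 phi + z *: U m.+2 g) by rewrite gE; apply: rsP.
have hOL : L (sOm S m f, sOm S m f') by apply: (@L_Vn m) => //; rewrite !VnOm.
have c1 : Vn m (U m.+2 g) = Vn m.+2 (U m g) := U_comm hg hg2.
have c2 : Vn m (sOm S m f) = Vn m.+2 (sOm S m.+2 f) by rewrite !VnOm.
have e1 := weak_comm_L hUg hOf hUL hOL c1 c2.
have e2 := weak_comm hUg hOfm hUg2 hOf c1 c2.
rewrite (spairE hg hff) (spairE hphi hf) addrC -scaleNr (sc_Om_lin hS) //.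
rewrite (ipDr h0) ?(ipZr h0) //; try mem.
rewrite -e1 -e2 (ipDl h0) ?(ipZl h0) //; try mem.
by ring.
Qed.

(** On $\mathfrak H_{-m}$ the operator $P(L)^{-1}$ is the Riesz isomorphism onto $\mathfrak H_m$. *)
Lemma Pinv_neg m psi : sneg S m psi -> Pinv S m.+2 m psi = Vn m (U m psi).
Proof.
move=> hpsi; have h2 : sneg S m.+2 psi by apply: neg_le hpsi; rewrite ltnW.
have hU := UH0 hpsi; have [hP PE] := PinvP m h2.
apply: (@U_inj m.+2) => //; first by apply: H0_neg; mem.
rewrite PE (U_comm hpsi h2) (@U_H0 m.+2); last by mem.
by rewrite VnC.
Qed.

Lemma LresP m f g : Lres S m (f, g) <-> [/\ Hp S m f, Hp S m g & L (f, g)].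
Proof.
split=> [[/= hL hf]|[hf hg hL]].
  by split => //; [do 2! apply: HpS|apply: Hp_L hL].
by split => //=; apply: L_Hp hL.
Qed.

Lemma Lres_Om m f g : Lres S m (f, g) -> L (sOm S m f, sOm S m g).
Proof. by move=> /LresP[hf hg hL]; apply: (@L_Vn m); rewrite ?VnOm //; mem. Qed.

Lemma Lres_sub m : is_subspace (Lres S m).
Proof.
split; first by apply/LresP; split; [mem|mem|exact: (rel0 Lsub)].
move=> a [f f'] [g g'] /LresP[h1 h2 h3] /LresP[h4 h5 h6]; apply/LresP.
split; last exact: (relD Lsub (relZ Lsub a h3) h6).
  exact: (subspaceD (Hp_sub m) (subspaceZ (Hp_sub m) a h1) h4).
exact: (subspaceD (Hp_sub m) (subspaceZ (Hp_sub m) a h2) h5).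
Qed.

Lemma Lres_sym m f f' g g' : Lres S m (f, f') -> Lres S m (g, g') ->
  hip (Hp S m) f' g = hip (Hp S m) f g'.
Proof. by move=> /Lres_Om h /Lres_Om h'; apply: Lsym h h'. Qed.

Lemma Lres_rs m z y : rhoL S z -> Hp S m y -> Lres S m (rs z y, y + z *: rs z y).
Proof.
move=> hz hy; have h := Hp_rs hz hy; have hm : Hp S m (rs z y) by do 2! apply: HpS.
apply/LresP; split => //; first by mem.
by apply: rsP => //; mem.
Qed.

Lemma Lres_inE m f g : Lres S m (f, g) -> Hp S m f /\ Hp S m g.
Proof. by move=> /LresP[]. Qed.

(** [sOm S m] is a unitary equivalence of $L_m$ with $L$. *)
Lemma rho_Lres m : rho (Hp S m) (Lres S m) = rhoL S.
Proof.
apply/seteqP; split=> z hz.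
  have [h1 [M hM]] := hz; split.
    move=> y hy; have [x [hx ux]] := h1 _ (Vn_in m hy).
    have [hxm hx'm] := Lres_inE hx.
    have e (x' : X) : Hp S m x' -> sOm S m (Vn m y + z *: x') = y + z *: sOm S m x'.
      move=> hx'; rewrite addrC (sc_Om_lin hS) ?OmVn; try mem; exact: addrC.
    exists (sOm S m x); split; first by rewrite -e //; apply: Lres_Om.
    move=> x' hx'; have [Hx' _] := LH0 hx'.
    rewrite (ux (Vn m x')) ?OmVn //.
    apply/LresP; split; [mem|have := Vn_in m hy; have := Vn_in m Hx'; mem|].
    by have := Vn_L m hx'; rewrite addrC Vn_lin // addrC.
  exists M => -[x y] hxy; have [Hx Hy] := LH0 hxy.
  have hV : Lres S m (Vn m x, Vn m y) by apply/LresP; split; [mem|mem|exact: Vn_L].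
  have := hM _ hV; rewrite /= addrC -scaleNr -Vn_lin // ?hnorm_Hp_Vn // ; try mem.
  by rewrite scaleNr addrC.
have [h1 [M hM]] := hz; split.
  move=> y hy; exists (rs z y); split; first exact: Lres_rs.
  by move=> x' /LresP[_ _ h]; apply/esym/rs_eq => //; mem.
exists M => -[x y] hxy; have [Hx Hy] := Lres_inE hxy.
have := hM _ (Lres_Om hxy); rewrite /= addrC -scaleNr -(sc_Om_lin hS) //.
by rewrite scaleNr addrC.
Qed.

End ScaleTheory.

Lemma linear_on0 (R : realType) (X Y : lmodType R[i]) (D : set X) (F : X -> Y) : D 0 ->
  (forall (a : R[i]) u v, D u -> D v -> F (a *: u + v) = a *: F u + F v) -> F 0 = 0.
Proof.
move=> D0 h; have := h 1 0 0 D0 D0; rewrite scaler0 addr0 scale1r => /eqP.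
by rewrite -subr_eq0 opprD addrA subrr sub0r oppr_eq0 => /eqP.
Qed.

Lemma linear_sum (R : realType) (X Y : lmodType R[i]) (D : set X) (F : X -> Y) :
  is_subspace D ->
  (forall (a : R[i]) u v, D u -> D v -> F (a *: u + v) = a *: F u + F v) ->
  forall (I : Type) (r : seq I) (a : I -> R[i]) (x : I -> X), (forall i, D (x i)) ->
  F (\sum_(i <- r) a i *: x i) = \sum_(i <- r) a i *: F (x i).
Proof.
move=> sD Flin I r a x hx; have F0 : F 0 = 0 by apply: (linear_on0 (subspace0 sD) Flin).
elim: r => [|i r IH]; first by rewrite !big_nil.
by rewrite !big_cons Flin ?IH //; apply: subspace_sum => // j; apply: subspaceZ.
Qed.

(** The scalar core of extending $R(z)^*=R(\bar z)$ from a nonreal point to all of $\rho(L)$: both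
    sides differ from their values at that point by conjugate terms. *)
Lemma conj_of_differences (R : realType) (A A' B B' p p' z w : R[i]) :
  A - B = (z - w) * p -> B' - A' = (w^* - z^*) * p' -> B^* = B' -> p^* = p' -> A^* = A'.
Proof.
move=> h h' hB hp; have -> : A = (z - w) * p + B by rewrite -h subrK.
rewrite rmorphD rmorphM rmorphB /= hB hp.
have -> : A' = B' - (B' - A') by ring.
by rewrite h'; ring.
Qed.

(** The form in which a twice iterated resolvent identity gives differentiability. *)
Lemma derivable_quadratic (R : realType) (F : R[i] -> R[i]) (z a K e : R[i]) : 0 < e -> 0 <= K ->
  (forall w, `|w - z| < e -> `|F w - F z - (w - z) * a| <= K * `|w - z| ^+ 2) ->
  derivable (F : (R[i])^o -> (R[i])^o) z 1.
Proof.
move=> e0 K0 h; apply/cvg_ex; exists a.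
have K1 : 0 < K + 1 by apply: ltr_wpDl.
apply/cvgrPdist_le => t t0; near=> x.
have x0 : x != 0 by near: x; exact: nbhs_dnbhs_neq.
have xe : `|x| < e by near: x; apply: dnbhs0_lt.
have xt : `|x| < t / (K + 1) by near: x; apply: dnbhs0_lt; rewrite divr_gt0.
have := h (x + z); rewrite addrK => /(_ xe) hx.
have -> : a - x^-1 *: ((F \o shift z) (x *: (1 : (R[i])^o)) - F z) = - x^-1 * (F (x + z) - F z - x * a).
  rewrite /= [x *: 1]mulr1 mulNr -mulrN opprB mulrBr mulrA mulVf // mul1r.
  by [].
rewrite normrM normrN normfV ler_pdivrMl ?normr_gt0 //; apply: le_trans hx _.
rewrite expr2 mulrCA ler_wpM2l //.
rewrite ltr_pdivlMr // in xt; apply: le_trans (ltW xt); rewrite mulrC ler_wpM2l // lerDl //.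
Unshelve. all: by end_near.
Qed.

Section Indices.
Variables (d m : nat).

Lemma ixK (i : 'I_(d * m)) : mxvec_index (ix i).1 (ix i).2 = i.
Proof.
by rewrite /mxvec_index /ix -surjective_pairing enum_valK cast_ordKV.
Qed.

Lemma ix_index (s : 'I_d) (j : 'I_m) : ix (mxvec_index s j) = (s, j).
Proof. by rewrite /mxvec_index /ix cast_ordK enum_rankK. Qed.

Lemma sum_ix (V : nmodType) (F : 'I_(d * m) -> V) :
  \sum_i F i = \sum_s \sum_j F (mxvec_index s j).
Proof.
rewrite pair_bigA (reindex (fun p : 'I_d * 'I_m => mxvec_index p.1 p.2)) //=.
exists (@ix m d) => [[s j] _|i _]; first by rewrite ix_index.
by rewrite ixK.
Qed.

End Indices.

(** * Functionals and exit space *)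

Section ModelTheory.
Variables (R : realType) (S : scale_data R).
Hypothesis hS : is_scale S.
Variables (m d : nat).
Hypothesis (hm : (2 <= m)%N).
Variable phi : 'I_d -> sX S.
Hypotheses (hphi : forall s, Hn S m.+2 (phi s) /\ ~ Hn S m.+1 (phi s))
  (hphi_indep : lin_indep phi)
  (hLmin_dense : is_dense (Hp S m) (rdom (Lmin m phi))).
Variable zs : 'I_m -> R[i].
Hypotheses (hzs_inj : injective zs) (hzs : forall j, rhoL S (zs j))
  (hC : forall s, fs phi zs s = \sum_s' Cmx phi zs s' s *: es m phi s').

Local Notation C := R[i].
Local Notation X := (sX S).
Local Notation H0 := (sH0 S).
Local Notation L := (sL S).
Local Notation U := (@OmtV R S m.+2).
Local Notation Um := (@OmtV R S m).
Local Notation Vm := (@Vn R S m).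
Local Notation V2 := (@Vn R S m.+2).
Local Notation rs := (@rs R S).
Local Notation hh s := (U (phi s)).
Local Notation es := (es m phi).
Local Notation Gs := (Gs m phi).
Local Notation gs := (gs m phi).
Local Notation fs := (fs phi zs).
Local Notation kmin := (kmin phi zs).
Local Notation gi := (gi phi zs).
Local Notation Kx := (Kx phi zs).

Let h0 := H0_inner hS.
#[local] Hint Resolve H0_sub Hp_sub neg_sub Vn_in VnH0 OmH0 HpH0 rsH0 UH0 H0_inner Hp_inner Hn_inner : mem.
#[local] Hint Extern 1 (sneg _ _ _) => subspace_step : mem.
#[local] Hint Extern 1 (is_scale _) => exact hS : mem.

Lemma Hn_of_neg n x : sneg S n x -> Hn S n x. Proof. by []. Qed.
#[local] Hint Resolve Hn_of_neg : mem.

Lemma negphi s : sneg S m.+2 (phi s). Proof. by case: (hphi s). Qed.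
#[local] Hint Resolve negphi hzs : mem.

Lemma hhH0 s : H0 (hh s). Proof. by mem. Qed.
#[local] Hint Resolve hhH0 : mem.

Lemma neg_m2 psi : sneg S m psi -> sneg S m.+2 psi.
Proof. by apply: neg_le => //; rewrite ltnW. Qed.
Lemma Hp_m2 f : Hp S m.+2 f -> Hp S m f.
Proof. by move=> h; do 2! apply: HpS. Qed.
Lemma Hp_neg n f : Hp S n f -> sneg S m f.
Proof. by move=> h; apply: H0_neg => //; mem. Qed.
Lemma Hp_subm f : Hp S m f -> Hp S (m - 2) f.
Proof. by apply: Hp_le; rewrite leq_subr. Qed.
Lemma Hp_rs_sub z f : rhoL S z -> Hp S (m - 2) f -> Hp S m (rs z f).
Proof. by move=> hz h; rewrite -(subnK hm) addn2; apply: Hp_rs. Qed.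
Lemma Hp_rs_m z f : rhoL S z -> Hp S m f -> Hp S m.+2 (rs z f).
Proof. by move=> hz h; apply: Hp_rs. Qed.
#[local] Hint Resolve neg_m2 Hp_m2 Hp_rs_sub Hp_rs_m : mem.

Lemma Hp_Usub psi : sneg S m.+2 psi -> Hp S (m - 2) psi <-> Hp S m.*2 (U psi).
Proof.
case: m hm => [|[|n]] // _ h; rewrite !subSS subn0 !doubleS; exact: Hp_U4.
Qed.

Lemma U_sum k (I : Type) (r : seq I) (a : I -> C) (x : I -> X) : (forall i, sneg S k (x i)) ->
  @OmtV R S k (\sum_(i <- r) a i *: x i) = \sum_(i <- r) a i *: @OmtV R S k (x i).
Proof. by apply: linear_sum => [|b u v hu hv]; [mem|exact: U_lin]. Qed.

Lemma rs_sum z (I : Type) (r : seq I) (a : I -> C) (x : I -> X) : rhoL S z ->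
  (forall i, H0 (x i)) ->
  rs z (\sum_(i <- r) a i *: x i) = \sum_(i <- r) a i *: rs z (x i).
Proof. by move=> hz; apply: linear_sum => [|b u v hu hv]; [mem|exact: rs_lin]. Qed.

Lemma rsZ z (a : C) u : rhoL S z -> H0 u -> rs z (a *: u) = a *: rs z u.
Proof.
move=> hz hu; have := @rs_sum z unit [:: tt] (fun=> a) (fun=> u) hz (fun=> hu).
by rewrite !big_cons !big_nil !addr0.
Qed.

Lemma rs0 z : rhoL S z -> rs z 0 = 0.
Proof. by move=> hz; rewrite -[0](scale0r (0 : X)) rsZ ?scale0r //; mem. Qed.

Lemma resolvent_identity z w u : rhoL S z -> rhoL S w -> H0 u ->
  rs z u - rs w u = (z - w) *: rs z (rs w u).
Proof.
move=> hz hw hu; have h1 := rsH0 hS hz hu; have h2 := rsH0 hS hw hu.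
rewrite -rsZ //; apply: rs_eq => //; first by mem.
have := relB (Lsub hS) (rsP hz hu) (rsP hw hu); congr (L (_, _)).
by lmod.
Qed.

Lemma RLP z psi : rhoL S z -> sneg S m.+2 psi -> sneg S m.+2 (RL m z psi) /\ U (RL m z psi) = rs z (U psi).
Proof. exact: RextP. Qed.

Lemma RL_neg z psi : rhoL S z -> sneg S m.+2 psi -> sneg S m (RL m z psi).
Proof.
move=> hz hpsi; have [h1 h2] := RLP hz hpsi; have hU := UH0 hS hpsi.
by apply/(neg_U2 hS) => //; rewrite h2; apply: Hp_rs => //; rewrite Hp0.
Qed.

Lemma spair_comb (c : 'I_d -> C) f : Hp S m.+2 f ->
  spair (\sum_s c s *: phi s) f = \sum_s (c s)^* * spair (phi s) f.
Proof.
move=> hf; rewrite (spairE hS (n := m.+2)) //; last by mem.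
rewrite U_sum; last by mem.
rewrite (ip_suml h0); try mem.
by apply: eq_bigr => s _; rewrite (ipZl h0) -?(spairE hS) //; mem.
Qed.

Lemma phi_comb_neg (c : 'I_d -> C) : sneg S m (\sum_s c s *: phi s) -> forall s, c s = 0.
Proof.
set psi := \sum_s _ => hpsi; apply: hphi_indep.
apply: (sc_pair_inj hS hpsi) => g hg; have hU := UH0 hS hpsi.
apply: (@eq0_small _ _ (hnorm H0 (Um psi))); first by apply: hnorm_ge0.
move=> e e0; have [_ /(_ g e hg e0) [f [f' [/= hL hf hphif] hgf]]] := hLmin_dense.
have hfm := Hp_m2 hf.
have f0 : spair psi f = 0.
  rewrite spair_comb // big1 // => s _.
  by have := congr1 (fun v : 'cV[C]_d => v s 0) hphif; rewrite !mxE => ->; rewrite mulr0.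
have -> : spair psi g = hip H0 (Um psi) (sOm S m (g - f)).
  rewrite -[spair psi g]subr0 -f0 !(spairE hS hpsi) //.
  rewrite -(ipBr h0); try mem.
  by congr (hip _ _ _); rewrite addrC -scaleN1r -(sc_Om_lin hS) // scaleN1r addrC.
apply: le_trans (cauchy_schwarz h0 _ _) _; try mem.
by apply: ler_wpM2l; [exact: hnorm_ge0|exact: ltW hgf].
Qed.

(** * Sums and products of resolvents on the span of the functionals *)

Definition Yx (y : X) := exists c : 'I_d -> C, y = \sum_s c s *: hh s.

Lemma Yx_sub : is_subspace Yx.
Proof. exact: (span_subspace (fun s => hh s)). Qed.
#[local] Hint Resolve Yx_sub : mem.

Lemma YxH0 y : Yx y -> H0 y. Proof. by move=> [c ->]; mem. Qed.
#[local] Hint Resolve YxH0 : mem.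

Lemma hh_indep (c : 'I_d -> C) : Hp S 2 (\sum_s c s *: hh s) -> forall s, c s = 0.
Proof.
move=> h; apply: phi_comb_neg; apply/(neg_U2 hS); first by mem.
by rewrite U_sum //; mem.
Qed.

Lemma Yx_Hp2 y : Yx y -> Hp S 2 y -> y = 0.
Proof. by move=> [c ->] /hh_indep h; rewrite big1 // => s _; rewrite h scale0r. Qed.

(** For [w = zs j0] the resolvent at [zs j0] loses its coefficient, so [L - w] turns a sum over
    [j0 :: l] into one over [l] plus the rough vector [\sum y j]. This step drives the inductions on
    the list of points. *)
Lemma L_resolvent_sum (l : seq 'I_m) (y : 'I_m -> X) (w : C) : (forall j, H0 (y j)) ->
  L (\sum_(j <- l) rs (zs j) (y j),
     \sum_(j <- l) y j + \sum_(j <- l) rs (zs j) ((zs j - w) *: y j) + w *: \sum_(j <- l) rs (zs j) (y j)).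
Proof.
move=> hy; elim: l => [|j l IH].
  by rewrite !big_nil scaler0 !addr0; apply: (rel0 (Lsub hS)).
rewrite !big_cons; have := relD (Lsub hS) (rsP (hzs j) (hy j)) IH; congr (L (_, _)).
rewrite rsZ //.
by lmod.
Qed.

(** After [L - zs j0] the sum of the [y j] equals a sum of resolvents, so it lies in $\mathfrak H_2$
    and vanishes by [Yx_Hp2]; a relation over the shorter list remains. *)
Lemma resolvent_sum_indep (l : seq 'I_m) (y : 'I_m -> X) : uniq l -> (forall j, Yx (y j)) ->
  \sum_(j <- l) rs (zs j) (y j) = 0 -> forall j, j \in l -> y j = 0.
Proof.
elim: l y => [//|j0 l IH] y /= /andP[j0l ul] hy e.
have hy0 j : H0 (y j) by mem.
have := L_resolvent_sum (j0 :: l) (zs j0) hy0; rewrite e scaler0 addr0.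
move=> /(Lop hS) /(_ (rel0 (Lsub hS))).
rewrite [X in _ + X]big_cons subrr scale0r rs0 // add0r => e1.
have hY : Yx (\sum_(j <- j0 :: l) y j) by mem.
have y0 : \sum_(j <- j0 :: l) y j = 0.
  apply: Yx_Hp2 => //; have -> : \sum_(j <- j0 :: l) y j = - \sum_(j <- l) rs (zs j) ((zs j - zs j0) *: y j).
    by apply/eqP; rewrite -addr_eq0 e1.
  apply: subspaceN; first by mem.
  apply: subspace_sum => [|j]; first by mem.
  by apply: Hp_rs => //; rewrite Hp0; mem.
have yl j : j \in l -> y j = 0.
  move=> jl; have : (zs j - zs j0) *: y j = 0.
    apply: (IH (fun j => (zs j - zs j0) *: y j)) => //; first by mem.
    by move: e1; rewrite y0 add0r.
  move=> /eqP; rewrite scaler_eq0 subr_eq0 => /orP[/eqP/hzs_inj jj|/eqP //].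
  by rewrite jj (negPf j0l) in jl.
move=> j; rewrite inE => /orP[/eqP ->|]; last exact: yl.
by move: y0; rewrite big_cons big_seq big1 ?addr0.
Qed.

(** For [enum 'I_m] this is $\widetilde P(L)^{-1}$ on $\mathfrak H_0$. *)
Definition resolvents (l : seq 'I_m) (y : X) := foldr (fun j x => rs (zs j) x) y l.

Lemma resolventsH0 l y : H0 y -> H0 (resolvents l y).
Proof. by move=> hy; elim: l => //= j l IH; mem. Qed.
#[local] Hint Resolve resolventsH0 : mem.

Lemma resolvents_lin l (a : C) u v : H0 u -> H0 v ->
  resolvents l (a *: u + v) = a *: resolvents l u + resolvents l v.
Proof.
move=> hu hv; elim: l => //= j l ->.
by rewrite rs_lin //; mem.
Qed.

Lemma Hp_resolvents l y n : Hp S n y -> Hp S (n + (size l).*2) (resolvents l y).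
Proof.
move=> hy; elim: l => [|j l IH] /=; first by rewrite addn0.
by rewrite doubleS !addnS; apply: Hp_rs.
Qed.

Lemma Hp_resolvents_inv l y n : H0 y -> Hp S (n + (size l).*2) (resolvents l y) -> Hp S n y.
Proof.
move=> hy; elim: l => [|j l IH] /=; first by rewrite addn0.
rewrite doubleS !addnS => /(Hp_rs_inv hS (hzs j))[v hv] /(rs_inj hS) e.
by apply: IH; rewrite e //; mem.
Qed.

(** Applying [L - zs j0] removes one point and two orders of smoothness; as long as two orders are
    left, the rough part [sy] lies in $\mathfrak H_2$ and vanishes. *)
Lemma resolvent_sum_smooth (l : seq 'I_m) (y : 'I_m -> X) : uniq l -> (forall j, Yx (y j)) ->
  Hp S (size l).*2 (\sum_(j <- l) rs (zs j) (y j)) ->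
  exists2 y0, Yx y0 & \sum_(j <- l) rs (zs j) (y j) = resolvents l y0.
Proof.
elim: l y => [|j0 l IH] y ul hy hx.
  by exists 0; [mem|rewrite big_nil].
(* With a single point no order would be left for [Yx_Hp2], but there the sum already is the
   product. *)
have [l0|l0] := eqVneq l [::].
  by exists (y j0) => //; rewrite l0 /= big_cons big_nil addr0.
have hy0 j : H0 (y j) by mem.
have hL := L_resolvent_sum (j0 :: l) (zs j0) hy0.
set x := \sum_(j <- _) _ in hx hL *.
rewrite [size _]/= doubleS in hx; have hx' := Hp_L hS hx hL.
have hxl : Hp S (size l).*2 x by do 2! apply: HpS.
rewrite [X in _ + X + _]big_cons subrr scale0r rs0 // add0r in hx' hL.
set y' := (fun j => (zs j - zs j0) *: y j) in hx' hL.
set sy := \sum_(j <- _) y j in hx' hL.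
have hl2 : (2 <= (size l).*2)%N by move: l0; case: (l) => // a b _; rewrite doubleS.
set t := \sum_(j <- l) rs (zs j) _ in hx' hL.
have h1 : Hp S (size l).*2 (sy + t).
  have -> : sy + t = (sy + t + zs j0 *: x) - zs j0 *: x by rewrite addrK.
  by mem.
have ht : Hp S 2 t.
  apply: subspace_sum => [|j]; first by mem.
  by apply: Hp_rs => //; rewrite Hp0; mem.
have sy0 : sy = 0.
  apply: Yx_Hp2; first by rewrite /sy; mem.
  rewrite -[sy](addrK t); apply: subspaceB => //; first by mem.
  exact: Hp_le hl2 h1.
rewrite sy0 add0r in h1 hL.
have [||y0 hy0' e] := IH y' _ _ h1.
- by case/andP: ul.
- by rewrite /y'; mem.
exists y0 => //=; rewrite -e; apply: rs_eq => //.
have hy'0 j : H0 (y' j) by rewrite /y'; mem.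
by mem.
Qed.

(** Partial fractions of $\prod_j(x-z_j)^{-1}$. *)
Lemma resolvents_fraction (l : seq 'I_m) : uniq l -> l != [::] ->
  exists c : 'I_m -> C, forall y, H0 y -> resolvents l y = \sum_(j <- l) c j *: rs (zs j) y.
Proof.
elim: l => [//|j0 l IH] /= /andP[j0l ul] _.
have [l0|/(IH ul)[c hc]] := eqVneq l [::].
  by exists (fun=> 1) => y hy; rewrite l0 /= big_cons big_nil scale1r addr0.
(* From $(x-z_{j_0})^{-1}(x-z_j)^{-1}=(z_{j_0}-z_j)^{-1}[(x-z_{j_0})^{-1}-(x-z_j)^{-1}]$: the new
   point collects all first terms. *)
exists (fun j => if j == j0 then \sum_(j <- l) c j / (zs j0 - zs j) else - c j / (zs j0 - zs j)) => y hy.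
rewrite hc // rs_sum //; last by mem.
rewrite big_cons eqxx scaler_suml.
have -> : \sum_(j <- l) (if j == j0 then \sum_(j <- l) c j / (zs j0 - zs j)
    else - c j / (zs j0 - zs j)) *: rs (zs j) y = \sum_(j <- l) - ((c j / (zs j0 - zs j)) *: rs (zs j) y).
  rewrite big_seq [RHS]big_seq; apply: eq_bigr => j jl; rewrite ifN; first by rewrite mulNr scaleNr.
  by apply: contraNneq j0l => <-.
rewrite -big_split /= big_seq [RHS]big_seq; apply: eq_bigr => j jl.
have zz : zs j0 - zs j != 0.
  by rewrite subr_eq0; apply: contraNneq j0l => /hzs_inj ->.
rewrite -scalerBr resolvent_identity // scalerA divfK //.
Qed.

Lemma Ufs s : sneg S m.+2 (fs s) /\ U (fs s) = resolvents (enum 'I_m) (hh s).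
Proof.
rewrite /Defs.fs; elim: (enum 'I_m) => [|j l [IH1 IH2]] /=; first by split => //; mem.
by have [h1 h2] := RLP (hzs j) IH1; split => //; rewrite h2 IH2.
Qed.

Lemma enum_m_neq0 : enum 'I_m != [::].
Proof. by rewrite -size_eq0 size_enum_ord -lt0n; apply: leq_trans hm. Qed.

Lemma fs_sub s : Hp S (m - 2) (fs s).
Proof.
have [h1 h2] := Ufs s; apply/(Hp_Usub h1); rewrite h2.
have := @Hp_resolvents (enum 'I_m) (hh s) 0; rewrite Hp0 size_enum_ord add0n; apply.
by mem.
Qed.
#[local] Hint Resolve fs_sub : mem.

Lemma kmin_sub c : Hp S (m - 2) (kmin c). Proof. by rewrite /Defs.kmin; mem. Qed.
#[local] Hint Resolve kmin_sub : mem.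

Lemma Ukmin c : U (kmin c) = resolvents (enum 'I_m) (\sum_s c s 0 *: hh s).
Proof.
rewrite /Defs.kmin U_sum; last by move=> s; case: (Ufs s).
rewrite (linear_sum (D := H0)); last 1 first.
- by mem.
- by apply: eq_bigr => s _; case: (Ufs s) => _ ->.
- by mem.
- by move=> a u v hu hv; apply: resolvents_lin.
Qed.

Lemma kmin_lin (a : C) c c' : kmin (a *: c + c') = a *: kmin c + kmin c'.
Proof.
rewrite /Defs.kmin scaler_sumr -big_split; apply: eq_bigr => s _ /=.
by rewrite !mxE scalerDl scalerA.
Qed.

Lemma kminH0 c : H0 (kmin c). Proof. by mem. Qed.
#[local] Hint Resolve kminH0 : mem.

(** $\mathfrak H_m$ is two orders above $\mathfrak H_{m-2}$: undoing the [m] resolvents leaves the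
    combination of the [hh s] in $\mathfrak H_2$. *)
Lemma kmin_Hp_eq0 c : Hp S m (kmin c) -> c = 0.
Proof.
move=> h; apply/colP => s; rewrite mxE; apply: (hh_indep (c := fun s => c s 0)).
have hk : sneg S m.+2 (kmin c) by apply: H0_neg; mem.
have hy : H0 (\sum_s c s 0 *: hh s) by mem.
apply: (@Hp_resolvents_inv (enum 'I_m)) => //; rewrite -Ukmin size_enum_ord add2n.
by apply/(Hp_U2 hS hk).
Qed.

Lemma kmin_inj c c' : kmin c = kmin c' -> c = c'.
Proof.
move=> e; apply/eqP; rewrite -subr_eq0; apply/eqP/kmin_Hp_eq0.
have -> : kmin (c - c') = 0; last by mem.
by rewrite addrC -scaleN1r kmin_lin e scaleN1r addrC subrr.
Qed.

Lemma gs_neg s z : rhoL S z -> sneg S m (gs s z).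
Proof. by move=> hz; apply: RL_neg => //; mem. Qed.

Lemma Ugs s z : rhoL S z -> U (gs s z) = rs z (hh s).
Proof. by move=> hz; have [] := RLP hz (negphi s). Qed.

Lemma gi_neg i : sneg S m (gi i). Proof. exact: gs_neg. Qed.
#[local] Hint Resolve gi_neg : mem.

Lemma Usum_gi (a : 'I_(d * m) -> C) : U (\sum_i a i *: gi i) =
  \sum_j rs (zs j) (\sum_s a (mxvec_index s j) *: hh s).
Proof.
rewrite U_sum; last by mem.
rewrite sum_ix exchange_big; apply: eq_bigr => j _ /=.
rewrite rs_sum //; last by mem.
by apply: eq_bigr => s _; rewrite /Defs.gi ix_index /= Ugs.
Qed.

Lemma gi_indep : lin_indep gi.
Proof.
move=> a e i; have e1 : U (\sum_i a i *: gi i) = 0 by rewrite e U_H0 ?Vn0 //; mem.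
rewrite Usum_gi in e1.
have hy j : Yx (\sum_s a (mxvec_index s j) *: hh s) by exists (fun s => a (mxvec_index s j)).
have := resolvent_sum_indep (index_enum_uniq _) hy e1 (mem_index_enum (ix i).2).
rewrite -[in a i](ixK i) => e2.
by apply: (hh_indep (c := fun s => a (mxvec_index s (ix i).2))); rewrite e2; mem.
Qed.

Lemma Kx_sub : is_subspace Kx. Proof. exact: span_subspace. Qed.
#[local] Hint Resolve Kx_sub : mem.

Lemma Kx_gi i : Kx (gi i). Proof. exact: span_gen. Qed.
#[local] Hint Resolve Kx_gi : mem.

Lemma Kx_neg k : Kx k -> sneg S m k. Proof. by move=> [a ->]; mem. Qed.
#[local] Hint Resolve Kx_neg : mem.

Lemma fs_Kx s : Kx (fs s).
Proof.
have [h1 h2] := Ufs s; have [c hc] := resolvents_fraction (enum_uniq 'I_m) enum_m_neq0.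
suff -> : fs s = \sum_j c j *: gi (mxvec_index s j) by mem.
apply: (@U_inj _ _ hS m.+2) => //; first by apply: neg_m2; mem.
rewrite h2 hc ?U_sum; try mem.
by rewrite big_enum; apply: eq_bigr => j _; rewrite /Defs.gi ix_index /= Ugs.
Qed.
#[local] Hint Resolve fs_Kx : mem.

Lemma kmin_Kx c : Kx (kmin c). Proof. by rewrite /Defs.kmin; mem. Qed.
#[local] Hint Resolve kmin_Kx : mem.

(** Membership in $\mathfrak H_{m-2}$ means order [2m] for the image under [U], exactly what
    [resolvent_sum_smooth] asks for [m] points. *)
Lemma Kx_smooth k : Kx k -> Hp S (m - 2) k -> exists c, k = kmin c.
Proof.
move=> [a ka] hk; have hneg : sneg S m.+2 k by apply: neg_m2; rewrite ka; mem.
have := hk => /(Hp_Usub hneg); rewrite ka Usum_gi => hU.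
have hy j : Yx (\sum_s a (mxvec_index s j) *: hh s) by exists (fun s => a (mxvec_index s j)).
rewrite -big_enum in hU; rewrite -[in (m.*2)%N](size_enum_ord m) in hU.
have [y0 [c yc] e] := resolvent_sum_smooth (enum_uniq 'I_m) hy hU.
exists (\col_s c s); apply: (@U_inj _ _ hS m.+2) => //.
- by rewrite -ka.
- by apply: H0_neg; mem.
rewrite Usum_gi Ukmin -[LHS]big_enum e yc; congr resolvents.
by apply: eq_bigr => s _; rewrite mxE.
Qed.

Lemma Kmin_iff k : Kmin phi zs k <-> exists c, k = kmin c.
Proof.
split=> [[h1 h2]|[c ->]]; first exact: Kx_smooth.
by split; mem.
Qed.

(** Makes the sum of $\mathfrak H_m$ and $\mathfrak K$ direct. *)
Lemma Kx_Hp k : Kx k -> Hp S m k -> k = 0.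
Proof.
move=> h1 h2; have [c kc] := Kx_smooth h1 (Hp_subm h2).
have c0 := kmin_Hp_eq0 (c := c); rewrite -kc in c0.
by rewrite kc (c0 h2) /Defs.kmin big1 // => s _; rewrite mxE scale0r.
Qed.

Lemma fs_indep : lin_indep fs.
Proof.
move=> a e s; have := @kmin_inj (\col_s a s) 0; rewrite /Defs.kmin.
rewrite (eq_bigr (fun s => a s *: fs s)) => [|i _]; last by rewrite mxE.
rewrite e big1 => [/(_ erefl)|i _]; last by rewrite mxE scale0r.
by move=> /colP/(_ s); rewrite !mxE.
Qed.

Lemma es_sub s : Hp S (m - 2) (es s).
Proof.
have [h1 h2] := PinvP hS m (negphi s).
apply/(Hp_Usub h1); rewrite h2; have [h _] := Vn_double hS m; apply: h; mem.
Qed.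
#[local] Hint Resolve es_sub : mem.

Lemma GsE s z : rhoL S z -> Gs s z = rs z (es s).
Proof.
move=> hz; have [g1 g2] := RLP hz (negphi s).
have [h1 h2] := PinvP hS m g1; have [e1 e2] := PinvP hS m (negphi s).
have hes : H0 (es s) by mem.
apply: (@U_inj _ _ hS m.+2) => //; first by apply: H0_neg; mem.
rewrite [LHS]h2 g2 !rs_Vn //; try mem.
by rewrite -e2 !U_H0 ?rs_Vn //; mem.
Qed.

Lemma Gs_Hp s z : rhoL S z -> Hp S m (Gs s z).
Proof. by move=> hz; rewrite GsE //; mem. Qed.
#[local] Hint Resolve Gs_Hp : mem.

Local Notation Cmx := (Cmx phi zs).
Local Notation Gtz := (Gtz phi zs).

(** Here [hC] enters; it turns $\widetilde G_z(c)$, defined by $P(L)^{-1}$, into the resolvent of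
    [kmin c]. *)
Lemma kmin_es c : kmin c = \sum_s (Cmx *m c) s 0 *: es s.
Proof.
rewrite /Defs.kmin; under eq_bigr do rewrite hC scaler_sumr.
rewrite exchange_big; apply: eq_bigr => s _ /=.
rewrite mxE scaler_suml; apply: eq_bigr => s' _.
by rewrite scalerA mulrC.
Qed.

Lemma GtzE z c : rhoL S z -> Gtz z c = rs z (kmin c).
Proof.
move=> hz; rewrite kmin_es rs_sum //; last by mem.
by apply: eq_bigr => s _; rewrite GsE.
Qed.

Lemma RL_kmin z c : rhoL S z -> RL m z (kmin c) = rs z (kmin c).
Proof.
move=> hz; have hk : sneg S m.+2 (kmin c) by apply: H0_neg; mem.
have [h1 h2] := RLP hz hk; apply: (@U_inj _ _ hS m.+2) => //; first by apply: H0_neg; mem.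
by rewrite h2 !U_H0 ?rs_Vn //; mem.
Qed.

Lemma Gtz_sum z c : Gtz z c = \sum_s (Cmx *m c) s 0 *: Gs s z. Proof. by []. Qed.
Lemma giE i : gi i = gs (ix i).1 (zs (ix i).2). Proof. by []. Qed.
Lemma kmin_sum c : kmin c = \sum_s c s 0 *: fs s. Proof. by []. Qed.

Lemma Gs_Um s z : rhoL S z -> Gs s z = Vm (Um (gs s z)).
Proof. by move=> hz; apply: Pinv_neg => //; apply: gs_neg. Qed.

Opaque Defs.Gs Defs.gs Defs.es Defs.fs Defs.kmin Defs.gi Defs.Gtz Defs.Cmx.

Lemma Gtz_Hp z c : rhoL S z -> Hp S m (Gtz z c).
Proof. by move=> hz; rewrite GtzE //; mem. Qed.
#[local] Hint Resolve Gtz_Hp : mem.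

Lemma Gtz_smooth z c : rhoL S z -> Hp S m.+2 (Gtz z c) -> c = 0.
Proof.
move=> hz; rewrite GtzE // => /(Hp_rs_inv hS hz)[v hv /(rs_inj hS hz) e].
by apply: kmin_Hp_eq0; rewrite e //; mem.
Qed.

Lemma Gtz_L z c : rhoL S z -> L (Gtz z c, kmin c + z *: Gtz z c).
Proof. by move=> hz; rewrite GtzE //; apply: rsP => //; mem. Qed.

Lemma Gtz_diff z w c : rhoL S z -> rhoL S w ->
  Lres S m (Gtz z c - Gtz w c, z *: Gtz z c - w *: Gtz w c).
Proof.
move=> hz hw; apply/(LresP hS); split; [mem|mem|].
have := relB (Lsub hS) (Gtz_L c hz) (Gtz_L c hw); congr (L (_, _)); lmod.
Qed.

(** * The functionals on $\mathfrak H_m$ and the function $R$ *)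

Variable phic : 'I_d -> X -> C.
Hypotheses (hphic_lin : forall s a f g, Hp S m f -> Hp S m g ->
     phic s (a *: f + g) = a * phic s f + phic s g)
  (hphic_ext : forall s f, Hp S m.+2 f -> phic s f = spair (phi s) f)
  (hR : nevanlinna (Rmx m phi phic)).
Local Notation Rmx := (Rmx m phi phic).
Local Notation Rt := (Rt phi phic zs).
Local Notation phiv := (phiv phi).
Local Notation ipm := (hip (Hp S m)).
Local Notation ipn := (hip (Hn S m)).

Lemma phic_sum s (I : Type) (r : seq I) (a : I -> C) (x : I -> X) : (forall i, Hp S m (x i)) ->
  phic s (\sum_(i <- r) a i *: x i) = \sum_(i <- r) a i * phic s (x i).
Proof.
move=> hx; apply: (linear_sum (Y := C^o) (D := Hp S m) (F := phic s)) => //; first by mem.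
by move=> b u v hu hv; apply: hphic_lin.
Qed.

Lemma phicB s f g : Hp S m f -> Hp S m g -> phic s (f - g) = phic s f - phic s g.
Proof. by move=> hf hg; rewrite addrC -scaleN1r hphic_lin // mulN1r addrC. Qed.

Lemma phicZ s (a : C) f : Hp S m f -> phic s (a *: f) = a * phic s f.
Proof.
move=> hf; have h : Hp S m 0 by mem.
by rewrite -[a *: f]addr0 hphic_lin // -(subrr (0 : X)) phicB // subrr addr0.
Qed.

Lemma phiv_lin (a : C) f g : Hp S m.+2 f -> Hp S m.+2 g -> phiv (a *: f + g) = a *: phiv f + phiv g.
Proof.
move=> hf hg; apply/colP => s; rewrite !mxE.
exact: (sc_pairr hS _ (negphi s) hf hg).
Qed.

Lemma RmxE z s s' : Rmx z s s' = phic s (Gs s' z). Proof. by rewrite mxE. Qed.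
Opaque Defs.Rmx Defs.Cmx.

Lemma Rt_mul z c : rhoL S z -> Rt z *m c = mxadj Cmx *m (\col_s phic s (Gtz z c)).
Proof.
move=> hz; rewrite -[_ *m Cmx *m c]mulmxA -[LHS]mulmxA; congr (_ *m _).
apply/colP => s; rewrite [LHS]mxE [RHS]mxE Gtz_sum phic_sum; last by mem.
by apply: eq_bigr => s' _; rewrite RmxE mulrC.
Qed.

Lemma RtE z : Rt z = mxadj Cmx *m Rmx z *m Cmx. Proof. by []. Qed.
Opaque Defs.Rt.

(** The two singular vectors differ by an element of $\mathfrak H_{m+2}$, where the continued
    functionals are the pairings themselves, so increments of $\widetilde R$ do not see the choice
    of continuation. *)
Lemma Rt_diff z w c : rhoL S z -> rhoL S w ->
  Rt z *m c - Rt w *m c = mxadj Cmx *m phiv (Gtz z c - Gtz w c).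
Proof.
move=> hz hw; have e1 := Rt_mul c hz; have e2 := Rt_mul c hw.
transitivity (mxadj Cmx *m ((\col_s phic s (Gtz z c)) - (\col_s phic s (Gtz w c)))).
  exact: (etrans (f_equal2 (fun x y => x - y) e1 e2) (esym (mulmxBr _ _ _))).
congr (_ *m _); apply/colP => s; rewrite [LHS]mxE [X in X + _]mxE [X in _ + X]mxE [X in _ - X]mxE [RHS]mxE.
rewrite -hphic_ext; first by rewrite phicB //; mem.
by have [] := Gtz_diff c hz hw.
Qed.

(** [Gs s z] represents [gs s z] in $\mathfrak H_m$ by [Pinv_neg], and [spair_resolvent] moves the
    resolvent to the other side. *)
Lemma Gs_pair s z f f' : rhoL S z -> Lres S m (f, f') ->
  ipm (Gs s z) (f' - z^* *: f) = spair (phi s) f.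
Proof.
move=> hz [/= hL hf]; have hfm := Hp_m2 hf; have hfm' := Hp_L hS hf hL.
have hg := gs_neg s hz; have hU := UH0 hS hg.
rewrite -(spair_resolvent hS hz (negphi s) hg (Ugs s hz) hf hL) Gs_Um // /= OmVn //.
by rewrite (spairE hS hg) //; mem.
Qed.

Lemma Gs_gram s s' z w : rhoL S z -> rhoL S w ->
  ipm (Gs s w) (Gs s' z) = ipn (gs s w) (gs s' z).
Proof.
move=> hz hw; rewrite !Gs_Um //= !OmVn //; apply: UH0 => //; exact: gs_neg.
Qed.

Lemma Gtz_pair z c f f' : rhoL S z -> Lres S m (f, f') ->
  ipm (Gtz z c) (f' - z^* *: f) = dotc c (mxadj Cmx *m phiv f).
Proof.
move=> hz hL; have [hf hf'] := Lres_inE hS hL.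
rewrite dotc_adjr Gtz_sum (ip_suml (Hp_inner hS m)); try mem.
apply: eq_bigr => s _; rewrite (ipZl (Hp_inner hS m)); try mem.
by congr (_ * _); rewrite (Gs_pair s hz hL) mxE.
Qed.

(** The resolvent identity puts the increment in $\mathfrak H_{m+2}$, and [Gs_pair] at [z^*]
    evaluates the functional there. *)
Lemma Rmx_diff z w s s' : rhoL S z -> rhoL S w ->
  Rmx z s s' - Rmx w s s' = (z - w) * ipm (Gs s z^*) (Gs s' w).
Proof.
move=> hz hw; have hG := Gs_Hp s' hw.
have hL := Lres_rs hS hz hG; have hz' := rhoL_conj hS hz.
have := Gs_pair s hz' hL; rewrite conjCK addrK => ->.
have hr : Hp S m.+2 (rs z (Gs s' w)) by mem.
have hr' : Hp S m (rs w (es s')) by mem.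
have hr2 : Hp S m (rs z (es s')) by mem.
transitivity (phic s (rs z (es s')) - phic s (rs w (es s'))).
  by congr (_ - _); rewrite RmxE GsE.
have e : rs z (es s') - rs w (es s') = (z - w) *: rs z (Gs s' w).
  by rewrite GsE // resolvent_identity //; mem.
by rewrite -phicB // e phicZ ?hphic_ext //; exact: Hp_m2.
Qed.

(** The Nevanlinna property speaks of nonreal points; [Rmx_diff] carries it from ['i] to the real
    points of $\rho(L)$. *)
Lemma Rmx_adj z : rhoL S z -> mxadj (Rmx z) = Rmx z^*.
Proof.
move=> hz; apply/matrixP => s s';
have [w w0] : exists w : C, 'Im w != 0 by exists 'i; exact: Im_i_neq0.
have hi := rhoL_nonreal hS w0.
have hi' := rhoL_conj hS hi; have hz' := rhoL_conj hS hz.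
have e : (Rmx w s' s)^* = Rmx w^* s s'.
  have [_ /matrixP/(_ s s') e0 _] := hR w0.
  exact: (etrans (esym (mxadjE _ _ _)) e0).
have e1 := Rmx_diff s' s hz hi; have e2 := Rmx_diff s s' hi' hz'.
rewrite (conjCK w) in e2; rewrite mxadjE.
by apply: (conj_of_differences e1 e2 e); rewrite -(ipC (Hp_inner hS m)) //; mem.
Qed.

Lemma Rt_adj z : rhoL S z -> mxadj (Rt z) = Rt z^*.
Proof.
move=> hz; rewrite (RtE z) (RtE z^*).
by rewrite (mxadj_congruence Cmx (Rmx z)) (Rmx_adj hz).
Qed.

(** At the points [zs j] this relates the Gram matrix of the exit space to the entries of $\mathcal
    M$. *)
Lemma Rmx_gram z w s s' : rhoL S z -> rhoL S w ->
  Rmx z s s' - (Rmx w s' s)^* = (z - w^*) * ipn (gs s w) (gs s' z).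
Proof.
move=> hz hw; have hw' := rhoL_conj hS hw.
have <- : Rmx w^* s s' = (Rmx w s' s)^* by rewrite -Rmx_adj // mxadjE.
have e := Rmx_diff s s' hw' hz; rewrite conjCK in e.
have gen (a b p q r : C) : b - a = (p - q) * r -> a - b = (q - p) * r.
  by move=> h; rewrite -(opprB b) h; ring.
by rewrite (gen _ _ _ _ _ e) Gs_gram.
Qed.

(** * The operator $l$ and its compression $l_1$ *)

Lemma dvecE (a : 'I_(d * m) -> C) : dvec phi zs (\sum_i a i *: gi i) = \col_i a i.
Proof.
pose P := [set b : 'cV[C]_(d * m) | \sum_i a i *: gi i = \sum_i b i 0 *: gi i].
have : P (xget 0 P).
  apply: (xgetPex 0 (P := P)); exists (\col_i a i); rewrite /P /=.
  by apply: eq_bigr => i _; rewrite mxE.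
rewrite /P /= => e; apply/colP => i; rewrite [RHS]mxE; symmetry.
exact: (lin_indep_inj gi_indep e).
Qed.

Lemma dvecP k : Kx k -> k = \sum_i dvec phi zs k i 0 *: gi i.
Proof. by move=> [a ->]; rewrite dvecE; apply: eq_bigr => i _; rewrite mxE. Qed.

Lemma dvec_lin (a : C) k k' : Kx k -> Kx k' ->
  dvec phi zs (a *: k + k') = a *: dvec phi zs k + dvec phi zs k'.
Proof.
move=> [b ->] [b' ->]; rewrite !dvecE.
rewrite scaler_sumr -big_split (eq_bigr (fun i => (a * b i + b' i) *: gi i)) ?dvecE.
  by apply/colP => i; rewrite !mxE.
by move=> i _; rewrite scalerDl scalerA.
Qed.

Definition lmap (k : X) : X := \sum_i (dvec phi zs k i 0 * zs (ix i).2) *: gi i.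

Lemma lmap_Kx k : Kx (lmap k). Proof. by rewrite /lmap; mem. Qed.
#[local] Hint Resolve lmap_Kx : mem.

Lemma lop_iff k k' : lop phi zs (k, k') <-> Kx k /\ k' = lmap k.
Proof.
split=> [[a [/= -> ->]]|[hk ->]].
  split; first by exists a.
  by rewrite /lmap dvecE; apply: eq_bigr => i _; rewrite mxE.
by exists (fun i => dvec phi zs k i 0); split => //=; exact: dvecP.
Qed.

Lemma lmap_lin (a : C) k k' : Kx k -> Kx k' -> lmap (a *: k + k') = a *: lmap k + lmap k'.
Proof.
move=> hk hk'; rewrite /lmap dvec_lin // scaler_sumr -big_split.
by apply: eq_bigr => i _; rewrite !mxE mulrDl scalerDl scalerA mulrA.
Qed.

Lemma lmap0 : lmap 0 = 0.
Proof. by apply: (linear_on0 (D := Kx)) => [|a u v hu hv]; [mem|exact: lmap_lin]. Qed.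

Local Notation hn := (Hn_inner hS m).

Lemma ipn_Kx (a b : 'I_(d * m) -> C) : ipn (\sum_i a i *: gi i) (\sum_i b i *: gi i) =
  \sum_i \sum_i' (a i)^* * b i' * ipn (gi i) (gi i').
Proof.
rewrite (ip_suml hn); try mem.
apply: eq_bigr => i _; rewrite (ip_sumr hn); try mem.
by apply: eq_bigr => i' _; rewrite (ipZl hn) ?(ipZr hn) ?mulrA //; mem.
Qed.

Lemma cvec_dot k (v : 'cV[C]_d) : dotc (cvec phi zs k) v = \sum_i (dvec phi zs k i 0)^* * v (ix i).1 0.
Proof.
rewrite sum_ix; apply: eq_bigr => s _; rewrite mxE rmorph_sum mulr_suml.
by apply: eq_bigr => j _; rewrite ix_index.
Qed.

(** Termwise this is [Rmx_gram] at pairs of the points [zs j]. *)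
Lemma cvec_form k k' : Kx k -> Kx k' ->
  dotc (cvec phi zs k) (Mmx phi phic zs *m dvec phi zs k')
  - (dotc (cvec phi zs k') (Mmx phi phic zs *m dvec phi zs k))^* =
  ipn k (lmap k') - ipn (lmap k) k'.
Proof.
move=> hk hk'; rewrite !cvec_dot.
set a := dvec phi zs k; set b := dvec phi zs k'.
have -> : ipn k (lmap k') = \sum_i \sum_i' (a i 0)^* * (b i' 0 * zs (ix i').2) * ipn (gi i) (gi i').
  by rewrite {1}(dvecP hk) /lmap ipn_Kx.
have -> : ipn (lmap k) k' = \sum_i \sum_i' (a i 0 * zs (ix i).2)^* * b i' 0 * ipn (gi i) (gi i').
  by rewrite {1}(dvecP hk') /lmap ipn_Kx.
under eq_bigr do rewrite mxE mulr_sumr.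
rewrite rmorph_sum; under [X in _ - X]eq_bigr do rewrite mxE mulr_sumr rmorph_sum.
rewrite [X in _ - X]exchange_big -!sumrB; apply: eq_bigr => i _.
rewrite -!sumrB; apply: eq_bigr => i' _.
rewrite ![Mmx _ _ _ _ _]mxE !rmorphM /= conjCK !giE.
have e := Rmx_gram (ix i).1 (ix i').1 (hzs (ix i').2) (hzs (ix i).2).
transitivity ((a i 0)^* * b i' 0 * ((zs (ix i').2 - (zs (ix i).2)^*) * ipn (gs (ix i).1 (zs (ix i).2)) (gs (ix i').1 (zs (ix i').2)))); last by ring.
by rewrite -e; ring.
Qed.

Variable K1 : set X.
Hypotheses (hK1 : is_subspace K1) (hKmin : Kmin phi zs `<=` K1) (hKmax : K1 `<=` Kmax phi phic zs).
#[local] Hint Resolve hK1 : mem.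

Lemma K1_Kx k : K1 k -> Kx k. Proof. by move=> /hKmax[]. Qed.
#[local] Hint Resolve K1_Kx : mem.
Lemma kmin_K1 c : K1 (kmin c). Proof. by apply: hKmin; apply/Kmin_iff; exists c. Qed.
#[local] Hint Resolve kmin_K1 : mem.
Lemma fs_K1 s : K1 (fs s).
Proof. by apply: hKmin; split; mem. Qed.
#[local] Hint Resolve fs_K1 : mem.

(** [Kmax] is cut out by a quadratic condition, so [q] vanishes on the diagonal of [K1]. As [K1] is
    linear, polarization with the factors 1 and i gives the other values. *)
Lemma lmap_sym k k' : K1 k -> K1 k' -> ipn k (lmap k') = ipn (lmap k) k'.
Proof.
pose q k k' := ipn k (lmap k') - ipn (lmap k) k'.
have q0 x : K1 x -> q x x = 0.
  move=> hx; have [hxK /Creal_ImP] := hKmax hx; rewrite CrealE => /eqP e.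
  by rewrite /q -cvec_form // e subrr.
have qlin (a : C) x x' : K1 x -> K1 x' ->
    q (x + a *: x') (x + a *: x') = q x x + a * q x x' + a^* * q x' x + a^* * a * q x' x'.
  move=> hx hx'; rewrite /q [x + _]addrC lmap_lin; try mem.
  rewrite !(ipDl hn) ?(ipDr hn) ?(ipZl hn) ?(ipZr hn); try mem.
  by ring.
move=> hk hk'; apply/eqP; rewrite -subr_eq0; apply/eqP; rewrite -/(q k k').
have h1 : K1 (k + 1 *: k') by mem.
have hi : K1 (k + 'i *: k') by mem.
have := q0 _ h1; rewrite qlin // !q0 // rmorph1 !mul1r add0r !addr0 => e1.
have := q0 _ hi; rewrite qlin // !q0 // conjCi mulr0 add0r addr0 => e2.
have e3 : q k' k = - q k k' by apply/eqP; rewrite -addr_eq0 addrC e1.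
move: e2; rewrite e3 mulNr mulrN opprK -mulr2n => /eqP.
by rewrite mulrn_eq0 /= mulf_eq0 (negPf (neq0Ci _)) /= => /eqP.
Qed.

Local Notation l1 := (l1 phi zs K1).

Lemma proj_K1 y : Kx y -> exists2 p, K1 p & forall w, K1 w -> ipn w (y - p) = 0.
Proof.
move=> hy; apply: (@findim_projection _ _ (Hn S m) hn _ gi) => //; try mem.
by move=> k /K1_Kx.
Qed.

Lemma l1P k k' : l1 (k, k') <-> [/\ K1 k, K1 k' & forall w, K1 w -> ipn w (lmap k - k') = 0].
Proof.
split=> [[/= hk hk' [y /lop_iff[_ ->] h]]|[hk hk' h]] //.
by split => //; exists (lmap k) => //; apply/lop_iff; split => //; mem.
Qed.

Lemma l1_total k : K1 k -> exists k', l1 (k, k').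
Proof. by move=> hk; have [p hp h] := proj_K1 (lmap_Kx k); exists p; apply/l1P. Qed.

Lemma l1_op : is_op l1.
Proof.
move=> k y y' /l1P[hk hy h] /l1P[_ hy' h']; apply/eqP; rewrite -subr_eq0; apply/eqP.
have hyy : K1 (y - y') by mem.
apply: (ip_eq0 hn); first by mem.
have -> : y - y' = (lmap k - y') - (lmap k - y) by lmod.
rewrite [X in ipn X _](_ : _ = y - y'); last by lmod.
by rewrite (ipBr hn) ?h ?h' ?subrr //; mem.
Qed.

Lemma l1_sub : is_subspace l1.
Proof.
split.
  apply/l1P; split; [mem|mem|move=> w hw].
  by rewrite lmap0 subr0 (ip0r hn) //; mem.
move=> a [k y] [k' y'] /l1P[h1 h2 h3] /l1P[h4 h5 h6].
apply/l1P; split.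
- exact: (subspaceD hK1 (subspaceZ hK1 a h1) h4).
- exact: (subspaceD hK1 (subspaceZ hK1 a h2) h5).
move=> w hw; rewrite lmap_lin; try mem.
have -> : a *: lmap k + lmap k' - ((a *: (k, y)).2 + (k', y').2) = a *: (lmap k - y) + (lmap k' - y').
  by rewrite /=; lmod.
by rewrite (ipDr hn) ?(ipZr hn) ?h3 ?h6 ?mulr0 ?addr0 //; mem.
Qed.

Lemma l1_sym k y k' y' : l1 (k, y) -> l1 (k', y') -> ipn y k' = ipn k y'.
Proof.
move=> /l1P[h1 h2 h3] /l1P[h4 h5 h6].
have e1 : ipn k (lmap k' - y') = 0 by apply: h6.
have e2 : ipn (lmap k - y) k' = 0 by rewrite (ipC hn (y := lmap k - y)) ?h3 ?rmorph0 //; mem.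
rewrite (ipBr hn) in e1; try mem; rewrite (ipBl hn) in e2; try mem.
move/eqP: e1; rewrite subr_eq0 => /eqP <-; move/eqP: e2; rewrite subr_eq0 => /eqP <-.
by rewrite lmap_sym.
Qed.

Local Notation K1x := (K1x m K1).

Lemma K1x_inner : is_inner K1x.
Proof. by apply: (inner_restrict hn) => //; move=> k /K1_Kx; mem. Qed.

Lemma l1_adj : l1 `<=` adj K1x l1.
Proof.
move=> [k y] h; have /l1P[h1 h2 _] := h; split => // -[k' y'] h' /=.
exact: l1_sym h' h.
Qed.

(** A vector [v] of [K1] orthogonal to the range of [l1 - z] satisfies [l1 v = z^* v], which forces
    [v = 0] for symmetric [l1] and nonreal [z]. *)
Lemma l1_onto z y : 'Im z != 0 -> K1 y -> exists k, l1 (k, y + z *: k).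
Proof.
move=> z0 hy.
pose A := [set w | exists k k', l1 (k, k') /\ w = k' - z *: k].
have sA : is_subspace A.
  split; first by exists 0, 0; split; [exact: (rel0 l1_sub)|lmod].
  move=> a u v [k [k' [h ->]]] [x [x' [h' ->]]].
  by exists (a *: k + x), (a *: k' + x'); split; [exact: (relD l1_sub (relZ l1_sub a h) h')|lmod].
have AK w : A w -> K1 w by move=> [k [k' [/l1P[hk hk' _] ->]]]; mem.
have [p hp h] : exists2 p, A p & forall w, A w -> ipn w (y - p) = 0.
  apply: (@findim_projection _ _ (Hn S m) hn _ gi) => //; try mem.
  by move=> k /AK/K1_Kx.
have hpK := AK _ hp; have hw : K1 (y - p) by mem.
have [w' hw'] := l1_total hw; have /l1P[_ hw1 _] := hw'.
have w0 : y - p = 0.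
  set v := y - p in hw hw' h *.
  have e : w' = z^* *: v.
    apply/eqP; rewrite -subr_eq0; apply/eqP; apply: (ip_eq0_all K1x_inner) => [|x hx]; first by mem.
    have [x' hx'] := l1_total hx; have /l1P[_ hx1 _] := hx'.
    have : ipn (x' - z *: x) v = 0 by apply: h; exists x, x'.
    rewrite (ipBl hn) ?(ipZl hn) ?(l1_sym hx' hw'); try mem.
    by move=> e; rewrite [LHS](ipBr hn) ?(ipZr hn) //; mem.
  by apply: (im_inj K1x_inner l1_adj (z := z^*)); [rewrite -e|exact: neq0_Im].
case: hp => k [k' [hk e]]; exists k.
have -> : y + z *: k = k' + (y - p) by rewrite e; lmod.
by rewrite w0 addr0.
Qed.

Lemma exists_z0 : exists z0 : C, 'Im z0 != 0 /\ forall j, z0 != zs j.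
Proof.
have p : 0 < 1 + \sum_j `|zs j| by apply: ltr_wpDr => //; apply: sumr_ge0.
(* Larger in modulus than every [zs j]. *)
exists ('i * (1 + \sum_j `|zs j|)); rewrite Im_it // gt_eqF //; split => // j.
apply/eqP => e; have : `|zs j| = 1 + \sum_j `|zs j| by rewrite -e normrM normCi mul1r gtr0_norm.
rewrite (bigD1 j) //= => /eqP; rewrite addrCA -subr_eq0 opprD addrA subrr sub0r oppr_eq0.
by rewrite gt_eqF // ltr_wpDr // sumr_ge0.
Qed.

(* [Gz0 c] below is G~_{z0}(c): the boundary maps do not depend on the base
   point, and any point of rho(A_0) would do. *)
Definition z0 : C := xget 0 [set z | 'Im z != 0 /\ forall j, z != zs j].
Lemma z0P : 'Im z0 != 0 /\ forall j, z0 != zs j.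
Proof. by apply: (xgetPex 0 (P := [set z | 'Im z != 0 /\ forall j, z != zs j])); exact: exists_z0. Qed.
Lemma rho_z0 : rhoL S z0. Proof. by apply: (rhoL_nonreal hS); case: z0P. Qed.
Opaque z0.
#[local] Hint Resolve rho_z0 : mem.

Local Notation Gz0 c := (rs z0 (kmin c)).

(** * The space $\mathfrak H_m + \mathfrak K$ *)

Local Notation hpm := (Hp_inner hS m).
Local Notation prm := (prm phi zs).
Local Notation Hip := (Hip phi zs).

Lemma prm_eq f k : Hp S m f -> Kx k -> prm (f + k) = f.
Proof.
move=> hf hk; pose P := [set g | Hp S m g /\ Kx (f + k - g)].
have [h1 h2] : P (prm (f + k)).
  by apply: (xgetPex 0 (P := P)); exists f; split => //; rewrite addrC addrA [- f + f]addrC subrr add0r.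
have h3 : Kx (f - prm (f + k)).
  have -> : f - prm (f + k) = (f + k - prm (f + k)) - k by lmod.
  by mem.
have h4 : Hp S m (f - prm (f + k)) by mem.
by have /eqP := Kx_Hp h3 h4; rewrite subr_eq0 => /eqP.
Qed.

Lemma HipE f k f' k' : Hp S m f -> Kx k -> Hp S m f' -> Kx k' ->
  Hip (f + k) (f' + k') = ipm f f' + ipn k k'.
Proof.
move=> hf hk hf' hk'; rewrite /Defs.Hip !prm_eq //.
by congr (_ + ipn _ _); rewrite addrC addrA [- _ + _]addrC subrr add0r.
Qed.
Opaque Defs.Hip Defs.prm.

Lemma sum_inj f k f' k' : Hp S m f -> Kx k -> Hp S m f' -> Kx k' ->
  f + k = f' + k' -> f = f' /\ k = k'.
Proof.
move=> hf hk hf' hk' e; have ff : f = f' by rewrite -(prm_eq hf hk) e prm_eq.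
by split => //; move: e; rewrite ff => /addrI.
Qed.

Lemma sum_inner (A : set X) : is_subspace A -> A `<=` Kx -> is_inner (HSpace (ssum (Hp S m) A) Hip).
Proof.
move=> sA AK.
have sS : is_subspace (ssum (Hp S m) A).
  split; first by exists 0, 0; split; [mem|mem|lmod].
  move=> a _ _ [f [k [hf hk ->]]] [f' [k' [hf' hk' ->]]].
  by exists (a *: f + f'), (a *: k + k'); split; [mem|mem|lmod].
split; first exact: sS.
- rewrite [hip _]/=; move=> a _ _ _ [f [k [hf /AK hk ->]]] [f1 [k1 [hf1 /AK hk1 ->]]] [f2 [k2 [hf2 /AK hk2 ->]]].
  have -> : a *: (f1 + k1) + (f2 + k2) = (a *: f1 + f2) + (a *: k1 + k2) by lmod.
  rewrite !HipE ?(ipDr hpm) ?(ipDr hn) ?(ipZr hpm) ?(ipZr hn); try mem.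
  by ring.
- rewrite [hip _]/=; move=> _ _ [f [k [hf /AK hk ->]]] [f1 [k1 [hf1 /AK hk1 ->]]].
  rewrite !HipE // rmorphD /= -(ipC hpm) // -(ipC hn) //; mem.
- rewrite [hip _]/=; move=> _ [f [k [hf /AK hk ->]]]; rewrite HipE //.
  by rewrite addr_ge0 // ?(ip_ge0 hpm) ?(ip_ge0 hn) //; mem.
- rewrite [hip _]/=; move=> _ [f [k [hf /AK hk ->]]]; rewrite HipE // => /eqP.
  have hkn : Hn S m k by mem.
  rewrite paddr_eq0 ?(ip_ge0 hpm) ?(ip_ge0 hn) // => /andP[/eqP e1 /eqP e2].
  by rewrite (ip_eq0 hpm hf e1) (ip_eq0 hn hkn e2) addr0.
Qed.

Local Notation Hcal := (Hcal phi zs).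
Local Notation H1 := (H1 phi zs K1).
Local Notation calB0 := (calB0 phi zs K1).
Local Notation calBmin := (calBmin phi zs K1).
Local Notation calBmax := (calBmax phi zs K1).
Local Notation Bmax := (Bmax phi zs K1).
Local Notation gammaB := (gammaB phi zs K1).
Local Notation l1ring := (l1ring phi zs K1).
Local Notation l1ringadj := (l1ringadj phi zs K1).
Local Notation gammaring := (gammaring phi zs K1).
Local Notation Qmx := (Qmx phi zs K1).
Local Notation GammaB := (GammaB phi phic zs K1).
Local Notation GammacalB := (GammacalB phi phic zs K1).
Local Notation weylB := (weylB phi phic zs K1).
Local Notation Gammat := (Gammat phi phic zs).
Local Notation Gammaring := (Gammaring phi zs K1).

Lemma Hcal_inner : is_inner Hcal. Proof. by apply: sum_inner => //; mem. Qed.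
Lemma H1_inner : is_inner H1. Proof. by apply: sum_inner => [|k /K1_Kx]; mem. Qed.

Lemma hnorm_sumE (A : set X) f k : Hp S m f -> Kx k ->
  hnorm (HSpace A Hip) (f + k) ^+ 2 = hnorm (Hp S m) f ^+ 2 + hnorm (Hn S m) k ^+ 2.
Proof. by move=> hf hk; rewrite !hnormK /= HipE. Qed.

Lemma hnorm_sum0 (A : set X) f : Hp S m f -> hnorm (HSpace A Hip) f = hnorm (Hp S m) f.
Proof.
move=> hf; have h0K : Kx 0 by mem.
by rewrite /hnorm /= -[f in LHS]addr0 HipE // (ip0r hn) ?addr0 //; mem.
Qed.

Lemma hnorm_sum1 (A : set X) k : Kx k -> hnorm (HSpace A Hip) k = hnorm (Hn S m) k.
Proof.
move=> hk; have h0H : Hp S m 0 by mem.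
by rewrite /hnorm /= -[k in LHS]add0r HipE // (ip0r hpm) ?add0r //; mem.
Qed.

(** The components are orthogonal, and [M1 + M2] dominates both constants. *)
Lemma hnorm_sum_bound (M1 M2 : C) (A A' : set X) f k f' k' : 0 <= M1 -> 0 <= M2 ->
  Hp S m f -> Kx k -> Hp S m f' -> Kx k' ->
  hnorm (Hp S m) f <= M1 * hnorm (Hp S m) f' -> hnorm (Hn S m) k <= M2 * hnorm (Hn S m) k' ->
  hnorm (HSpace A Hip) (f + k) <= (M1 + M2) * hnorm (HSpace A' Hip) (f' + k').
Proof.
move=> m1 m2 hf hk hf' hk' h1 h2.
have Hnk : Hn S m k by mem. have Hnk' : Hn S m k' by mem.
have p (B : set X) g x : Hp S m g -> Kx x -> 0 <= hnorm (HSpace B Hip) (g + x).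
  move=> hg hx; have Hnx : Hn S m x by mem.
  by rewrite /hnorm /= sqrtC_ge0 HipE // addr_ge0 ?(ip_ge0 hpm) ?(ip_ge0 hn).
have q1 := hnorm_ge0 hpm hf; have q2 := hnorm_ge0 hpm hf'.
have q3 := hnorm_ge0 hn Hnk; have q4 := hnorm_ge0 hn Hnk'.
rewrite -(ler_pXn2r (n:=2)) // ?nnegrE ?mulr_ge0 ?addr_ge0 ?p //.
rewrite exprMn !hnorm_sumE // mulrDr; apply: lerD.
  apply: le_trans (_ : (M1 * hnorm (Hp S m) f') ^+ 2 <= _).
    by rewrite ler_pXn2r ?nnegrE ?mulr_ge0.
  rewrite exprMn ler_wpM2r ?exprn_ge0 // ler_pXn2r ?nnegrE ?addr_ge0 // lerDl //.
apply: le_trans (_ : (M2 * hnorm (Hn S m) k') ^+ 2 <= _).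
  by rewrite ler_pXn2r ?nnegrE ?mulr_ge0.
by rewrite exprMn ler_wpM2r ?exprn_ge0 // ler_pXn2r ?nnegrE ?addr_ge0 // lerDr.
Qed.

(** * The maximal operator and the boundary map *)

(** Since $(L-z_j)g_s(z_j)=\varphi_s$, the extended [L] and [l] differ on $\mathfrak K$ by a
    combination of the functionals; the identity is stated after transport by [U]. *)
Lemma L_lmap k : Kx k -> L (U k, U (lmap k) + \sum_i dvec phi zs k i 0 *: hh (ix i).1).
Proof.
move=> hk; have hs i : L (rs (zs (ix i).2) (hh (ix i).1),
    hh (ix i).1 + zs (ix i).2 *: rs (zs (ix i).2) (hh (ix i).1)).
  by apply: rsP => //; mem.
have := subspace_sum (Lsub hS) (index_enum _) xpredT
   (fun i => subspaceZ (Lsub hS) (dvec phi zs k i 0) (hs i)).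
rewrite [X in L X]surjective_pairing (raddf_sum fst) (raddf_sum snd) /=.
congr (L (_, _)).
  rewrite [in RHS](dvecP hk) U_sum; last by mem.
  by apply: eq_bigr => i _; rewrite giE Ugs.
rewrite /lmap U_sum; last by mem.
rewrite -big_split; apply: eq_bigr => i _ /=.
by rewrite giE Ugs // scalerDr scalerA addrC.
Qed.

(** [spair_resolvent] moves each [gi] to the other side, and the value of the functional that it
    leaves vanishes on the domain of [Lmin]. Hence [l] is a part of [Lmax]. *)
Lemma spair_K k q q' : Kx k -> L (q, q') -> Hp S m.+2 q -> phiv q = 0 ->
  spair (lmap k) q = spair k q'.
Proof.
move=> hk hL hq hphiq; have hqm := Hp_m2 hq; have hqm' := Hp_L hS hq hL.
have hOq := OmH0 hS hqm; have hOq' := OmH0 hS hqm'.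
have hkn := Kx_neg hk; have hlkn := Kx_neg (lmap_Kx k).
rewrite (spairE hS hlkn hqm) (spairE hS hkn hqm') {2}(dvecP hk) /lmap !U_sum; try mem.
rewrite !(ip_suml h0); try mem.
apply: eq_bigr => i _; rewrite !(ipZl h0); try mem.
have hg := gi_neg i.
have := spair_resolvent hS (hzs (ix i).2) (negphi (ix i).1) hg (Ugs _ (hzs (ix i).2)) hq hL.
have -> : spair (phi (ix i).1) q = 0 by have := congr1 (fun v : 'cV[C]_d => v (ix i).1 0) hphiq; rewrite !mxE.
have hqq : Hp S m (q' - (zs (ix i).2)^* *: q) by mem.
rewrite (spairE hS hg hqq) addrC -scaleNr (sc_Om_lin hS) //.
rewrite (ipDr h0) ?(ipZr h0); try mem.
rewrite mulNr addrC => /eqP; rewrite subr_eq0 => /eqP ->.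
by rewrite rmorphM mulrA.
Qed.

Local Notation Amax := (Amax phi zs).

Lemma Hp_sub_le : (m <= m.*2)%N. Proof. by rewrite -addnn leq_addr. Qed.

Lemma Amax_sub f f' c k : Lres S m (f, f') -> Kx k ->
  Amax (f + k + Gz0 c, f' + z0 *: Gz0 c + kmin c + lmap k).
Proof.
move=> hL hk; have [hf hf'] := Lres_inE hS hL; have [_ _ hL0] := proj1 (LresP hS _ _ _) hL.
have hG : Hp S m (Gz0 c) by mem.
have hG0 := HpH0 hG; have hk0 := kminH0 c.
have hGL := rsP rho_z0 hk0.
have hLs : L (f + Gz0 c, f' + z0 *: Gz0 c + kmin c).
  by have := relD (Lsub hS) hL0 hGL; congr (L (_, _)); lmod.
have [hx0 hy0] := LH0 hS hLs.
have hkn := Kx_neg hk; have hlkn := Kx_neg (lmap_Kx k).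
have nx : sneg S m (f + Gz0 c) by apply: H0_neg.
have ny : sneg S m (f' + z0 *: Gz0 c + kmin c) by apply: H0_neg.
have xE : f + k + Gz0 c = (f + Gz0 c) + k by lmod.
have hmax : Lmax m phi (f + k + Gz0 c, f' + z0 *: Gz0 c + kmin c + lmap k).
  split; rewrite ?[fst _]/= ?[snd _]/= ?xE; [by mem|by mem|move=> [q q'] [/= hq hq2 hphiq]].
  have hqm := Hp_m2 hq2; have hqm' := Hp_L hS hq2 hq.
  have add x y g : sneg S m x -> sneg S m y -> Hp S m g -> spair (x + y) g = spair x g + spair y g.
    by move=> hx hy hg; have := sc_pairl hS 1 hx hy hg; rewrite scale1r rmorph1 mul1r.
  rewrite (add _ _ q ny hlkn hqm) (add _ _ q' nx hkn hqm') (spair_K hk hq hq2 hphiq); congr (_ + _).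
  have [Hq Hq'] := LH0 hS hq.
  by rewrite !(sc_pair0 hS) //; apply: (Lsym hS hLs hq).
have hx : Hcal (f + k + Gz0 c) by exists (f + Gz0 c), k; split; [mem|mem|].
have hy : Hcal (f' + z0 *: Gz0 c + kmin c + lmap k).
  by exists (f' + z0 *: Gz0 c), (kmin c + lmap k); split; [mem|mem|rewrite addrA].
exact: (And3 hmax hx hy).
Qed.

Lemma Lres_total f : Hp S m.+2 f -> exists f', Lres S m (f, f').
Proof.
have := @Hp_le _ _ _ _ f (leq_addl m 2); rewrite addn2 => h hf.
by move: (h hf); rewrite -(rdomL hS) => -[g hg]; exists g.
Qed.

(** [F] vanishes on the domain of [Lmin], the common kernel of the functionals, so it is a
    combination of them; self-adjointness of [L] turns the resulting identity into membership in its
    graph. *)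
Lemma Lmax_L x y : Lmax m phi (x, y) -> exists c : 'I_d -> C,
  L (U x, U y - \sum_s c s *: hh s).
Proof.
move=> [/= hx hy h]; have hx2 := neg_m2 hx; have hy2 := neg_m2 hy.
pose Lf f := xget 0 [set g | L (f, g)].
have LfP f g : L (f, g) -> Lf f = g.
  move=> hL; apply: (Lop hS (x := f)) => //.
  by apply: (xgetPex 0 (P := [set g | L (f, g)])); exists g.
have LfL f : Hp S m.+2 f -> L (f, Lf f).
  move=> hf; have [g [hg _]] := Lres_total hf.
  by rewrite (LfP _ _ hg).
pose F f := spair y f - spair x (Lf f).
have [||||a ha] := @kernel_combination R X d (fun s => spair (phi s)) F (Hp S m.+2).
- by mem.
- by move=> s a f g hf hg; apply: (sc_pairr hS _ (negphi s)).
- move=> a f g hf hg; have hLf := LfL _ hf; have hLg := LfL _ hg.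
  have e : Lf (a *: f + g) = a *: Lf f + Lf g.
    by apply: LfP; apply: (relD (Lsub hS)) => //; apply: (relZ (Lsub hS)).
  have h1 := Hp_L hS hf hLf; have h2 := Hp_L hS hg hLg.
  rewrite /F e (sc_pairr hS _ hx h1 h2) (sc_pairr hS _ hy (Hp_m2 hf) (Hp_m2 hg)).
  by ring.
- move=> f hf hphif; rewrite /F (h (f, Lf f)) ?subrr //; split => //=.
    exact: LfL.
  by apply/colP => s; rewrite !mxE.
(* Conjugated, the pairing being antilinear in its first argument. *)
exists (fun s => (a s)^*).
have hU1 := UH0 hS hx2; have hU2 := UH0 hS hy2.
rewrite (Lsa hS); split => /=; [mem|mem|move=> [q q'] hq /=].
have [Hq Hq'] := LH0 hS hq.
have hV := Vn_in hS m.+2 Hq; have hV' := Vn_in hS m.+2 Hq'.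
have hVL : L (V2 q, V2 q') := Vn_L hS m.+2 hq.
have := ha _ hV; rewrite /F (LfP _ _ hVL).
have -> : spair y (V2 q) = hip H0 (U y) q by rewrite (spairE hS hy2 hV) OmVn.
have -> : spair x (V2 q') = hip H0 (U x) q' by rewrite (spairE hS hx2 hV') OmVn.
have -> : \sum_s a s * spair (phi s) (V2 q) = \sum_s a s * hip H0 (hh s) q.
  by apply: eq_bigr => s _; rewrite (spairE hS (negphi s) hV) OmVn.
move=> e; rewrite (ipBr h0); try mem.
have -> : hip H0 q (\sum_s (a s)^* *: hh s) = (\sum_s a s * hip H0 (hh s) q)^*.
  rewrite (ip_sumr h0); try mem.
  rewrite rmorph_sum; apply: eq_bigr => s _.
  by rewrite /= rmorphM /= (ipZr h0) -?(ipC h0) //; mem.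
by rewrite -e rmorphB /= -!(ipC h0) // opprB addrC subrK.
Qed.

(** A comparison of smoothness under [U]. Once [L_lmap] has split off the action on [k1], smoothness
    of [f1] excludes the functionals, so their coefficients [c'] vanish. The exit part [k3] of the
    value is then forced into $\mathfrak H_{m-2}$, hence is some [kmin chi], and [f1] splits into a
    vector of $\mathfrak H_{m+2}$ and [Gz0 chi]. *)
Lemma Amax_inv x y : Amax (x, y) -> exists f f' c k,
  [/\ Lres S m (f, f'), Kx k, x = f + k + Gz0 c & y = f' + z0 *: Gz0 c + kmin c + lmap k].
Proof.
move=> [/= hmax [f1 [k1 [hf1 hk1 xE]]] [f2 [k2 [hf2 hk2 yE]]]].
have [c hc] := Lmax_L hmax; have hLk := L_lmap hk1.
have nf1 : sneg S m.+2 f1 by apply: neg_m2; apply: Hp_neg hf1.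
have nf2 : sneg S m.+2 f2 by apply: neg_m2; apply: Hp_neg hf2.
have nk1 := neg_m2 (Kx_neg hk1); have nk2 := neg_m2 (Kx_neg hk2).
have nl := neg_m2 (Kx_neg (lmap_Kx k1)).
have UD x' y' : sneg S m.+2 x' -> sneg S m.+2 y' -> U (x' + y') = U x' + U y'.
  by move=> h1 h2; have := U_lin hS 1 h1 h2; rewrite !scale1r.
have UB x' y' : sneg S m.+2 x' -> sneg S m.+2 y' -> U (x' - y') = U x' - U y'.
  by move=> h1 h2; have := U_lin hS (-1) h2 h1; rewrite !scaleN1r addrC => ->; rewrite addrC.
pose k3 := k2 - lmap k1; have hk3 : Kx k3 by rewrite /k3; mem.
have nk3 := neg_m2 (Kx_neg hk3).
pose c' s := c s + \sum_j dvec phi zs k1 (mxvec_index s j) 0.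
have sumE : \sum_s c' s *: hh s = \sum_s c s *: hh s + \sum_i dvec phi zs k1 i 0 *: hh (ix i).1.
  rewrite [X in _ + X]sum_ix -big_split; apply: eq_bigr => s _ /=.
  rewrite /c' scalerDl scaler_suml; congr (_ + _); apply: eq_bigr => j _.
  by rewrite ix_index.
have hL1 : L (U f1, U (f2 + k3) - \sum_s c' s *: hh s).
  have := relB (Lsub hS) hc hLk; congr (L (_, _)); first by rewrite xE UD // addrK.
  by rewrite yE sumE (UD _ _ nf2 nk2) (UD _ _ nf2 nk3) /k3 (UB _ _ nk2 nl); lmod.
have nfk : sneg S m (f2 + k3) by apply: subspaceD; [mem|exact: Hp_neg hf2|exact: Kx_neg].
have hUf1 : Hp S m.*2.+2 (U f1) by apply/(Hp_U2 hS nf1).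
have h2m := Hp_L hS hUf1 hL1.
have le2 : (2 <= m.*2)%N by apply: leq_trans Hp_sub_le.
have h2 := Hp_le le2 h2m.
have h2' : Hp S 2 (U (f2 + k3)) by apply/(neg_U2 hS (neg_m2 nfk)).
(* [U (f2 + k3)] and its difference with the combination both lie in $\mathfrak H_2$, hence so does
   the combination. *)
have hc0 : forall s, c' s = 0.
  apply: hh_indep; rewrite -[X in Hp S 2 X](subKr (U (f2 + k3))).
  by mem.
rewrite [X in _ - X]big1 ?subr0 in hL1 h2m; last by move=> s _; rewrite hc0 scale0r.
have hk3m : Hp S (m - 2) k3.
  apply/(Hp_Usub nk3); have -> : U k3 = U (f2 + k3) - U f2 by rewrite (UD _ _ nf2 nk3) addrC addKr.
  apply: subspaceB => //; first by mem.
  by do 2! apply: HpS; apply/(Hp_U2 hS nf2).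
have [chi k3E] := Kx_smooth hk3 hk3m.
have hkm := kminH0 chi; have Hf1 := HpH0 hf1; have Hf2 := HpH0 hf2.
have hL2 : L (f1, f2 + kmin chi).
  apply: (L_Vn hS (n := m.+2)) => //; first by mem.
  by rewrite -!U_H0 -?k3E //; mem.
pose g := f2 - z0 *: f1; have hg : Hp S m g by rewrite /g; mem.
have hLr := Lres_rs hS rho_z0 hg; have [hr hr'] := Lres_inE hS hLr.
have f1E : f1 = rs z0 g + Gz0 chi.
  have -> : rs z0 g + Gz0 chi = rs z0 (1 *: g + kmin chi).
    by rewrite rs_lin ?scale1r //; mem.
  apply: (rs_eq rho_z0); first by rewrite /g; mem.
  by move: hL2; congr (L (_, _)); rewrite /g; lmod.
exists (rs z0 g), (g + z0 *: rs z0 g), chi, k1; split => //.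
  by rewrite xE {1}f1E; lmod.
rewrite yE -[k2](subrK (lmap k1)) -/k3 k3E.
have gE : g + z0 *: (rs z0 g + Gz0 chi) = f2 by rewrite -f1E /g; lmod.
by rewrite -[in LHS]gE; lmod.
Qed.

Local Notation A0 := (A0 phi zs).
Local Notation dvec := (dvec phi zs).
Local Notation Gb := (Gb phi zs).

Lemma A0P x y : A0 (x, y) <-> exists f f' k, [/\ Lres S m (f, f'), Kx k, x = f + k & y = f' + lmap k].
Proof.
split=> [[[f f'] [[k k'] [hL /lop_iff[hk ->] [-> ->]]]]|[f [f' [k [hL hk -> ->]]]]].
  by exists f, f', k.
by exists (f, f'), (k, lmap k); split => //; apply/lop_iff.
Qed.

(** Data with one component zero are solved in the sum, and directness of the sum separates the
    component equations. *)
Lemma rho_sum (A : set X) (T : set (X * X)) z : A `<=` Kx -> is_subspace A -> is_subspace T ->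
  (forall p, T p -> A p.1 /\ A p.2) -> rho (HSpace (ssum (Hp S m) A) Hip) (ssum (Lres S m) T) z ->
  rhoL S z /\ rho (HSpace A ipn) T z.
Proof.
move=> AK sA sT TA [h [M hM]].
have L0 := rel0 (Lres_sub hS m); have T0 := rel0 sT.
have A0 : A 0 := subspace0 sA; have P0 : Hp S m 0 by mem.
have sumP f f' k k' x y : Lres S m (f, f') -> T (k, k') -> x = f + k -> y = f' + k' ->
    ssum (Lres S m) T (x, y).
  by move=> hL hT -> ->; exists (f, f'), (k, k').
have inv y f k : Hp S m f -> A k -> y = f + k -> exists g w,
    [/\ Lres S m (g, f + z *: g), T (w, k + z *: w)
      & forall x, ssum (Lres S m) T (x, y + z *: x) -> g + w = x].
  move=> hf hk yE.
  have [|x [[[g g'] [[w w'] [hL hT [xE e]]]] hu]] := h y; first by exists f, k.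
  have [hg hg'] := Lres_inE hS hL; have [/AK hw /AK hw'] := TA _ hT; have hkx := AK _ hk.
  have [e1 e2] : f + z *: g = g' /\ k + z *: w = w'.
    by apply: sum_inj; try mem; rewrite -e xE yE; lmod.
  by exists g, w; rewrite e1 e2; split => // v hv; rewrite -(hu v hv) xE.
split.
  rewrite -(rho_Lres hS m); split.
    move=> y hy; have [g [w [hL hT hu]]] := inv y y 0 hy A0 (esym (addr0 y)).
    have [hg _] := Lres_inE hS hL; have [/AK hw _] := TA _ hT; have k0 := AK _ A0.
    exists g; split => // v hv; have [hvm _] := Lres_inE hS hv.
    have e := hu v (sumP _ _ _ _ _ _ hv T0 (esym (addr0 _)) (esym (addr0 _))).
    by have [] := sum_inj hg hw hvm k0 (etrans e (esym (addr0 v))).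
  exists M => -[f f'] hL; have [hf hf'] := Lres_inE hS hL.
  have := hM _ (sumP _ _ _ _ _ _ hL T0 (esym (addr0 _)) (esym (addr0 _))).
  by rewrite [fst _]/= [snd _]/= !hnorm_sum0 //; mem.
split.
  move=> y hy; have [g [w [hL hT hu]]] := inv y 0 y P0 hy (esym (add0r y)).
  have [hg _] := Lres_inE hS hL; have [/AK hw _] := TA _ hT.
  exists w; split => // v hv; have [/AK hvK _] := TA _ hv.
  have e := hu v (sumP _ _ _ _ _ _ L0 hv (esym (add0r _)) (esym (add0r _))).
  by have [] := sum_inj hg hw P0 hvK (etrans e (esym (add0r v))).
exists M => -[k k'] hT; have [/AK hk /AK hk'] := TA _ hT.
have := hM _ (sumP _ _ _ _ _ _ L0 hT (esym (add0r _)) (esym (add0r _))).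
by rewrite [fst _]/= [snd _]/= !hnorm_sum1 //; mem.
Qed.

Lemma lop_sub : is_subspace (lop phi zs).
Proof.
split; first by apply/lop_iff; rewrite lmap0; split => //; mem.
move=> a [k y] [k' y'] /lop_iff[hk ->] /lop_iff[hk' ->]; apply/lop_iff.
change (Kx (a *: k + k') /\ a *: lmap k + lmap k' = lmap (a *: k + k')).
by rewrite lmap_lin //; split => //; mem.
Qed.

Lemma rho_A0 z : rho Hcal A0 z -> rhoL S z.
Proof.
case/rho_sum => //; [exact: Kx_sub|exact: lop_sub|].
by move=> [k k'] /lop_iff[hk ->]; split; [exact: hk|exact: lmap_Kx].
Qed.

(** [Gammat] quantifies over base points in [rho Hcal A0], so [z0] has to be certified. On
    $\mathfrak K$ the resolvent is diagonal in the [gi], with entries $(z_j-z_0)^{-1}$. *)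
Lemma rho_A0_z0 : rho Hcal A0 z0.
Proof.
have [_ zz] := z0P; have nz (i : 'I_(d * m)) : zs (ix i).2 - z0 != 0 by rewrite subr_eq0 eq_sym.
have gi_n i : Hn S m (gi i) by mem.
have [M2 M20 hM2] := diag_bounded hn (fun i => (zs (ix i).2 - z0)^-1) gi_n gi_indep.
have : rho (Hp S m) (Lres S m) z0 by rewrite (rho_Lres hS); exact: rho_z0.
move=> [_ [M1 hM1]]; split.
  move=> _ [f [k [hf hk ->]]].
  pose k' := \sum_i (dvec k i 0 / (zs (ix i).2 - z0)) *: gi i.
  have hk' : Kx k' by rewrite /k'; mem.
  have lk' : lmap k' = k + z0 *: k'.
    have kE := dvecP hk.
    transitivity (\sum_i dvec k i 0 *: gi i + z0 *: k'); last by rewrite -kE.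
    rewrite /lmap /k' dvecE scaler_sumr -big_split; apply: eq_bigr => i _ /=.
    rewrite mxE scalerA -scalerDl; congr (_ *: _).
    by field; exact: nz.
  have hL := Lres_rs hS rho_z0 hf; have [hr _] := Lres_inE hS hL.
  exists (rs z0 f + k'); split.
    apply/A0P; exists (rs z0 f), (f + z0 *: rs z0 f), k'; split => //.
    by rewrite lk'; lmod.
  move=> x /A0P[f1 [f1' [k1 [hL1 hk1 -> e]]]]; have [hf1 hf1'] := Lres_inE hS hL1.
  have [e1 e2] : f + z0 *: f1 = f1' /\ k + z0 *: k1 = lmap k1.
    by apply: sum_inj; try mem; rewrite -e; lmod.
  have -> : f1 = rs z0 f.
    by apply: (rs_eq rho_z0); [mem|rewrite e1; case/(LresP hS): hL1].
  congr (_ + _).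
  have : lmap (1 *: k1 - k') = z0 *: (k1 - k').
    rewrite -scaleN1r lmap_lin; try mem.
    have -> : lmap (-1 *: k') = - lmap k'.
      by have := lmap_lin (-1) hk' (subspace0 Kx_sub); rewrite addr0 lmap0 addr0 => ->; rewrite scaleN1r.
    by rewrite lk' -e2; lmod.
  rewrite scale1r; set k2 := k1 - k' => lk2; have hk2 : Kx k2 by rewrite /k2; mem.
  suff k20 : k2 = 0 by apply/eqP; rewrite eq_sym -subr_eq0 -/k2 k20.
  have := lk2; rewrite /lmap {2}(dvecP hk2) scaler_sumr.
  under [RHS]eq_bigr do rewrite scalerA.
  move=> /(lin_indep_inj gi_indep) h; rewrite (dvecP hk2) big1 // => i _.
  have /eqP := h i; rewrite -subr_eq0 [z0 * _]mulrC -mulrBr mulf_eq0 (negPf (nz i)) orbF => /eqP ->.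
  by rewrite scale0r.
exists (`|M1| + M2) => -[x y] /A0P[f [f' [k [hL hk -> ->]]]]; rewrite [fst _]/= [snd _]/=.
have [hf hf'] := Lres_inE hS hL.
have -> : f' + lmap k - z0 *: (f + k) = (f' - z0 *: f) + (lmap k - z0 *: k) by lmod.
apply: hnorm_sum_bound => //; try mem.
  apply: le_norm_mul; [exact: (hnorm_ge0 hpm)|by apply: (hnorm_ge0 hpm); mem|].
  exact: (hM1 _ hL).
have := hM2 (fun i => dvec k i 0 * (zs (ix i).2 - z0)).
have -> : \sum_j ((zs (ix j).2 - z0)^-1 * (dvec k j 0 * (zs (ix j).2 - z0))) *: gi j = k.
  rewrite [RHS](dvecP hk); apply: eq_bigr => i _; congr (_ *: _).
  by field; exact: nz.
have -> // : \sum_j (dvec k j 0 * (zs (ix j).2 - z0)) *: gi j = lmap k - z0 *: k.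
rewrite /lmap {3}(dvecP hk) scaler_sumr -sumrB; apply: eq_bigr => i _.
by rewrite scalerA -scalerBl; congr (_ *: _); ring.
Qed.

Definition Gamma1 (f : X) (c : 'cV[C]_d) (k : X) : 'cV[C]_d :=
  mxadj Cmx *m phiv f + Rt z0 *m c - mxadj Gb *m dvec k.

Lemma Rt_shift z c : rhoL S z ->
  Rt z *m c = Rt z0 *m c + mxadj Cmx *m phiv (rs z (kmin c) - rs z0 (kmin c)).
Proof.
move=> hz; have := Rt_diff c hz rho_z0; rewrite !GtzE //; try exact: rho_z0.
by move=> <-; rewrite addrC subrK.
Qed.

Lemma rs_diff_smooth z c : rhoL S z ->
  Lres S m (rs z (kmin c) - Gz0 c, z *: rs z (kmin c) - z0 *: Gz0 c).
Proof. by move=> hz; have := Gtz_diff c hz rho_z0; rewrite !GtzE //; exact: rho_z0. Qed.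

Lemma phivD f g : Hp S m.+2 f -> Hp S m.+2 g -> phiv (f + g) = phiv f + phiv g.
Proof. by move=> hf hg; rewrite -[f in LHS]scale1r phiv_lin // scale1r. Qed.

Lemma boundary_value_shift (B : 'M[C]_d) (v v1 v2 r1 r2 w : 'cV[C]_d) :
  v = v1 + v2 -> r1 = r2 + B *m v2 -> B *m v1 + r1 - w = B *m v + r2 - w.
Proof.
by move=> -> ->; rewrite mulmxDr; congr (_ - _); rewrite -[RHS]addrA; congr (_ + _); rewrite addrC.
Qed.

(** A base point [z] is exchanged for [z0] by moving the smooth difference of the two singular
    vectors into [f]; [Rt_shift] compensates in the boundary value. *)
Lemma Gammat_iff x a b : Gammat (x, (a, b)) <->
  exists f k, [/\ Hp S m.+2 f, Kx k, x = f + k + Gz0 a & b = Gamma1 f a k].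
Proof.
split.
  move=> [z [f [k [c [/rho_A0 hz hf hk e1 [-> ->]]]]]].
  rewrite [fst _]/= (GtzE c hz) in e1.
  have [_ hd] := rs_diff_smooth c hz; rewrite [fst _]/= in hd.
  exists (f + (rs z (kmin c) - Gz0 c)), k; split; [mem|exact: hk|rewrite e1; lmod|].
  have e2 := phivD hf hd; have e3 := Rt_shift c hz.
  exact: (boundary_value_shift _ e2 e3).
move=> [f [k [hf hk -> ->]]]; exists z0, f, k, a; split; [exact: rho_A0_z0|exact: hf|exact: hk| |].
  by rewrite (GtzE a rho_z0).
by [].
Qed.

Lemma Gb_dvec k : Kx k -> mxadj Gb *m dvec k = \col_s ipn (fs s) k.
Proof.
move=> hk; apply/colP => s; rewrite [LHS]mxE [RHS]mxE.
have hf : Hn S m (fs s) by mem. have hg i : Hn S m (gi i) by mem.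
have kE := dvecP hk.
transitivity (ipn (fs s) (\sum_i dvec k i 0 *: gi i)); last by rewrite -kE.
rewrite (ip_sumr hn) //; last by mem.
apply: eq_bigr => i _; rewrite (ipZr hn _ hf (hg i)) (ipC hn (hg i) hf) mulrC; congr (_ * _).
by rewrite mxadjE; congr (_ ^*); exact: mxE.
Qed.

Lemma Gb_dot c k : Kx k -> dotc c (mxadj Gb *m dvec k) = ipn (kmin c) k.
Proof.
move=> hk; rewrite Gb_dvec // kmin_sum (ip_suml hn); try mem.
by apply: eq_bigr => s _; rewrite mxE (ipZl hn) //; mem.
Qed.

(** * Boundary triples with multivalued part [N] *)

(* The triple of part 1 for N = H_bot, the one of part 2 for N = 0. *)
Definition bmapN (N : set X) : set ((X * X) * ('cV[C]_d * 'cV[C]_d)) :=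
  [set r | exists f f' c k k' n, [/\ Lres S m (f, f'), l1 (k, k'), N n,
     r.1 = (f + k + Gz0 c, f' + z0 *: Gz0 c + kmin c + k' + n) & r.2 = (c, Gamma1 f c k)]].

Lemma scale_sum3 (V : lmodType C) (a : C) (x y w x' y' w' : V) :
  a *: x + x' + (a *: y + y') - (a *: w + w') = a *: (x + y - w) + (x' + y' - w').
Proof. lmod. Qed.

Lemma Gamma1_lin (a : C) f c k f' c' k' : Hp S m.+2 f -> Hp S m.+2 f' -> Kx k -> Kx k' ->
  Gamma1 (a *: f + f') (a *: c + c') (a *: k + k') = a *: Gamma1 f c k + Gamma1 f' c' k'.
Proof.
move=> hf hf' hk hk'; rewrite /Gamma1 phiv_lin // dvec_lin // !mulmxDr -!scalemxAr.
exact: scale_sum3.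
Qed.

Lemma Gz0_lin (a : C) c c' : Gz0 (a *: c + c') = a *: Gz0 c + Gz0 c'.
Proof. by rewrite kmin_lin (rs_lin hS) //; mem. Qed.

Lemma Gz0_Hp c : Hp S m (Gz0 c). Proof. by mem. Qed.
#[local] Hint Resolve Gz0_Hp : mem.

Lemma kmin0 : kmin 0 = 0.
Proof. by rewrite kmin_sum big1 // => s _; rewrite mxE scale0r. Qed.

Lemma Gz00 : Gz0 0 = 0. Proof. by rewrite kmin0 rs0 //; exact: rho_z0. Qed.

Lemma Gamma10 : Gamma1 0 0 0 = 0.
Proof.
have z0m : Hp S m.+2 0 by mem. have z0K : Kx 0 by mem.
by have := Gamma1_lin (-1) 0 0 z0m z0m z0K z0K; rewrite !scaler0 !addr0 scaleN1r addNr.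
Qed.

Lemma bmapN_sub N : is_subspace N -> is_subspace (bmapN N).
Proof.
move=> sN; split.
  exists 0, 0, 0, 0, 0, 0; split; [exact: (rel0 (Lres_sub hS m))|exact: (rel0 l1_sub)|exact: (subspace0 sN)| |].
    by rewrite Gz00 kmin0; congr (_, _); lmod.
  by rewrite Gamma10.
move=> a [[rx ry] [rc rb]] [[tx ty] [tc tb]].
move=> [f [f' [c [k [k' [n [hL hl hn1 [-> ->] [-> ->]]]]]]]] [g [g' [e [x [x' [p [hL2 hl2 hn2 [-> ->] [-> ->]]]]]]]].
have hK : K1 k by case/l1P: hl. have hX : K1 x by case/l1P: hl2.
exists (a *: f + g), (a *: f' + g'), (a *: c + e), (a *: k + x), (a *: k' + x'), (a *: n + p); split.
- exact: (relD (Lres_sub hS m) (relZ (Lres_sub hS m) a hL) hL2).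
- exact: (relD l1_sub (relZ l1_sub a hl) hl2).
- exact: (subspaceD sN (subspaceZ sN a hn1) hn2).
- by rewrite Gz0_lin kmin_lin; congr (_, _); rewrite [in LHS]/=; lmod.
- by rewrite Gamma1_lin //; [case: hL|case: hL2|mem|mem].
Qed.

(** Green's identity between two singular vectors: [Gtz_pair] applied to the smooth vector
    $\widetilde G_{z_0}(e)-\widetilde G_{\bar z_0}(e)$. *)
Lemma Rt_gram c e : (z0 - z0^*) * ipm (Gz0 c) (Gz0 e) = dotc c (Rt z0 *m e) - dotc (Rt z0 *m c) e.
Proof.
have hz := rho_z0; have hz' := rhoL_conj hS hz.
have hL := Gtz_diff e hz hz'; have := Gtz_pair c hz hL.
have /(congr1 (fun v => dotc c v)) := Rt_diff e hz hz'; rewrite -(Rt_adj hz) dotcBr dotc_adjr => -> <-.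
rewrite !(GtzE _ hz) (GtzE _ hz').
have hG : Hp S m (rs z0^* (kmin e)) by mem.
have -> : z0 *: Gz0 e - z0^* *: rs z0^* (kmin e) - z0^* *: (Gz0 e - rs z0^* (kmin e)) = (z0 - z0^*) *: Gz0 e.
  by lmod.
by rewrite (ipZr hpm) //; mem.
Qed.

Lemma Gz0_pair c f f' : Lres S m (f, f') -> ipm (Gz0 c) f' - z0^* * ipm (Gz0 c) f = dotc c (mxadj Cmx *m phiv f).
Proof.
move=> hL; have [hf hf'] := Lres_inE hS hL.
rewrite -(Gtz_pair c rho_z0 hL) (GtzE c rho_z0) (ipBr hpm) ?(ipZr hpm) //; mem.
Qed.

(** Directness of the sum separates [k]; then [Gz0 (c - c')] lies in $\mathfrak H_{m+2}$, which
    [Gtz_smooth] allows only for [c = c']. *)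
Lemma decomposition_inj f k c f' k' c' : Hp S m.+2 f -> Kx k -> Hp S m.+2 f' -> Kx k' ->
  f + k + Gz0 c = f' + k' + Gz0 c' -> [/\ f = f', k = k' & c = c'].
Proof.
move=> hf hk hf' hk' e.
have hc := Gz0_Hp c; have hc' := Gz0_Hp c'.
have [e1 e2] : f + Gz0 c = f' + Gz0 c' /\ k = k'.
  by apply: sum_inj; try mem; move: e; rewrite addrAC => ->; lmod.
have e3 : c - c' = 0.
  apply: (Gtz_smooth rho_z0); rewrite (GtzE _ rho_z0).
  have -> : Gz0 (c - c') = f' - f.
    have -> : c - c' = -1 *: c' + c by rewrite scaleN1r addrC.
    rewrite Gz0_lin; apply/eqP; rewrite -subr_eq0; apply/eqP.
    have -> : -1 *: Gz0 c' + Gz0 c - (f' - f) = (f + Gz0 c) - (f' + Gz0 c') by lmod.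
    by rewrite e1 subrr.
  by mem.
move/eqP: e3; rewrite subr_eq0 => /eqP e3; split => //.
by move: e1; rewrite e3 => /addIr.
Qed.

Lemma calB0P x y : calB0 (x, y) <-> exists f f' k k',
  [/\ Lres S m (f, f'), l1 (k, k'), x = f + k & y = f' + k'].
Proof.
split=> [[[f f'] [[k k'] [hL hl [-> ->]]]]|[f [f' [k [k' [hL hl -> ->]]]]]].
  by exists f, f', k, k'.
by exists (f, f'), (k, k').
Qed.

Lemma rho_calB0 z : rho H1 calB0 z -> rhoL S z /\ rho K1x l1 z.
Proof.
apply: rho_sum => //; [by move=> k /K1_Kx|exact: l1_sub|].
by move=> [k k'] /l1P[].
Qed.

Local Notation r1 z y := (resolvent l1 z y).

Lemma r1P z y : rho K1x l1 z -> K1 y -> l1 (r1 z y, y + z *: r1 z y).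
Proof.
move=> [h _] hy; have [x [hx _]] := h y hy.
by apply: (xgetPex 0 (P := [set x | l1 (x, y + z *: x)])); exists x.
Qed.

Lemma r1_eq z y x : rho K1x l1 z -> K1 y -> l1 (x, y + z *: x) -> x = r1 z y.
Proof.
move=> hz hy hx; have [h _] := hz; have [x' [_ hu]] := h y hy.
by rewrite -(hu x) // -(hu (r1 z y)) //; apply: r1P.
Qed.

Lemma r1_K1 z y : rho K1x l1 z -> K1 y -> K1 (r1 z y).
Proof. by move=> hz hy; case/l1P: (r1P hz hy). Qed.
#[local] Hint Resolve r1_K1 : mem.

Lemma r1_lin z (a : C) x y : rho K1x l1 z -> K1 x -> K1 y ->
  r1 z (a *: x + y) = a *: r1 z x + r1 z y.
Proof.
move=> hz hx hy; apply/esym/r1_eq => //; first by mem.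
have := relD l1_sub (relZ l1_sub a (r1P hz hx)) (r1P hz hy); congr (l1 (_, _)); lmod.
Qed.

Lemma Qmx_mul z c : rho K1x l1 z ->
  Qmx z *m c = \col_s ipn (fs s) (r1 z (kmin c)).
Proof.
move=> hz; apply/colP => s; rewrite [LHS]mxE [RHS]mxE kmin_sum.
rewrite (linear_sum hK1 (fun a x y => @r1_lin z a x y hz)); last by mem.
rewrite (ip_sumr hn) //; try mem.
apply: eq_bigr => s' _; rewrite mxE mulrC.
have h1 : Hn S m (fs s) by mem. have h2 : Hn S m (r1 z (fs s')) by mem.
by rewrite (ipZr hn _ h1 h2).
Qed.

(** The eigenvector consists of a smooth difference of resolvents, [Gz0 c] and the exit part
    [- r1 z (kmin c)]. The term [kmin c] produced by the singular vector cancels against the one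
    from the exit part. *)
Lemma bmapN_solution N z c : is_subspace N -> rho H1 calB0 z ->
  bmapN N ((gammaB z c, z *: gammaB z c), (c, weylB z *m c)).
Proof.
move=> sN /rho_calB0[hz hz1]; have hk := r1P hz1 (kmin_K1 c).
have hk1 := r1_K1 hz1 (kmin_K1 c); have hL := rs_diff_smooth c hz.
have gE : gammaB z c = rs z (kmin c) - r1 z (kmin c).
  by rewrite /Defs.gammaB (RL_kmin c hz).
exists (rs z (kmin c) - Gz0 c), (z *: rs z (kmin c) - z0 *: Gz0 c), c,
  (- r1 z (kmin c)), (- (kmin c + z *: r1 z (kmin c))), 0; split.
- exact: hL.
- exact: (relN l1_sub hk).
- exact: (subspace0 sN).
- by rewrite gE; congr (_, _); lmod.
congr (_, _); rewrite /Defs.weylB mulmxDl (Qmx_mul c hz1) (Rt_shift c hz) /Gamma1.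
have -> : mxadj Gb *m dvec (- r1 z (kmin c)) = - \col_s ipn (fs s) (r1 z (kmin c)).
  rewrite Gb_dvec; last by mem.
  apply/colP => s; rewrite [LHS]mxE [RHS]mxE mxE.
  by rewrite (ipNr hn) //; mem.
by rewrite opprK; congr (_ + _); rewrite addrC.
Qed.

Section ExitPart.
(** [KN] is [K1 + N] only up to the equivalence [KNE], so that the choices [Kx] and [K1] make [E]
    convertible to [Hcal] and [H1]. *)
Variables (N KN : set X).
Hypotheses (sN : is_subspace N) (NK : N `<=` Kx)
  (N_orth : forall n w, N n -> K1 w -> ipn w n = 0)
  (sKN : is_subspace KN) (KNE : forall x, KN x <-> exists k n, [/\ K1 k, N n & x = k + n]).
#[local] Hint Resolve sN sKN : mem.

Lemma N_Kx n : N n -> Kx n. Proof. exact: NK. Qed.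
#[local] Hint Resolve N_Kx : mem.
Lemma KN_Kx : KN `<=` Kx.
Proof. by move=> x /KNE[k [n [hk hn' ->]]]; mem. Qed.
Lemma K1_KN k : K1 k -> KN k.
Proof. by move=> hk; apply/KNE; exists k, 0; split; [|mem|rewrite addr0]. Qed.
Lemma N_KN n : N n -> KN n.
Proof. by move=> hk; apply/KNE; exists 0, n; split; [mem| |rewrite add0r]. Qed.
#[local] Hint Resolve K1_KN N_KN : mem.

Local Notation E := (HSpace (ssum (Hp S m) KN) Hip).

Lemma E_inner : is_inner E. Proof. by apply: sum_inner => //; exact: KN_Kx. Qed.

Let A : set (X * X) := [set p | exists ab, bmapN N (p, ab)].

Lemma bmapN_dom p : A p -> E p.1 /\ E p.2.
Proof.
case: p => x y [[a b] [f [f' [c [k [k' [n [hL /l1P[hk hk' _] hn' [-> ->] _]]]]]]]].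
have [hf hf'] := Lres_inE hS hL; split.
  by exists (f + Gz0 c), k; split; [mem|mem|rewrite /=; lmod].
by exists (f' + z0 *: Gz0 c), (kmin c + k' + n); split; [mem|mem|rewrite /=; lmod].
Qed.

(** With [f = 0] the second value is [Rt z0 *m c] minus the inner products of the [fs s] with [k];
    as the [fs s] are independent, some [k] in their span, hence in [K1], gives these any values. *)
Lemma bmapN_onto ab : exists p, bmapN N (p, ab).
Proof.
case: ab => c b; have hfs s : Hn S m (fs s) by mem.
have [a ha] := gram_solve hn (fun s => (Rt z0 *m c - b) s 0) hfs fs_indep.
set k := \sum_j _ in ha.
have hk : K1 k by rewrite /k; mem.
have [k' hk'] := l1_total hk.
exists (0 + k + Gz0 c, 0 + z0 *: Gz0 c + kmin c + k' + 0).
exists 0, 0, c, k, k', 0; split => //; [exact: (rel0 (Lres_sub hS m))|exact: (subspace0 sN)|].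
have phiv0 : phiv 0 = 0.
  have h : Hp S m.+2 0 by mem.
  by have := phiv_lin (-1) h h; rewrite scaler0 addr0 scaleN1r addNr.
congr (_, _); rewrite /Gamma1 phiv0 mulmx0 add0r Gb_dvec; last by mem.
have -> : (\col_s ipn (fs s) k) = Rt z0 *m c - b by apply/colP => s; rewrite [LHS]mxE ha.
by rewrite opprB addrC subrK.
Qed.

(** Regular pairs and [l1] pairs cancel by symmetry, [N] is orthogonal to [K1], products of [kmin]
    with exit vectors produce the $\mathcal G_b^*$ terms, and the rest is [Gz0_pair] and
    [Rt_gram]. *)
Lemma bmapN_green p ab q ab' : bmapN N (p, ab) -> bmapN N (q, ab') ->
  hip E p.1 q.2 - hip E p.2 q.1 = dotc ab.1 ab'.2 - dotc ab.2 ab'.1.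
Proof.
move=> [f [f' [c [k [k' [n [hL hl hn1 /= -> ->]]]]]]] [g [g' [e [x [x' [n' [hL2 hl2 hn2 /= -> ->]]]]]]] /=.
have /l1P[hk hk' _] := hl; have /l1P[hx hx' _] := hl2.
have [hf hf'] := Lres_inE hS hL; have [hg hg'] := Lres_inE hS hL2.
have -> : f + k + Gz0 c = (f + Gz0 c) + k by lmod.
have -> : g + x + Gz0 e = (g + Gz0 e) + x by lmod.
have -> : f' + z0 *: Gz0 c + kmin c + k' + n = (f' + z0 *: Gz0 c) + (kmin c + k' + n) by lmod.
have -> : g' + z0 *: Gz0 e + kmin e + x' + n' = (g' + z0 *: Gz0 e) + (kmin e + x' + n') by lmod.
have nk : Hn S m k by mem. have nx : Hn S m x by mem.
have nk' : Hn S m k' by mem. have nx' : Hn S m x' by mem.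
have nn : Hn S m n by mem. have no : Hn S m n' by mem.
have nc : Hn S m (kmin c) by mem. have ne : Hn S m (kmin e) by mem.
have Gc := Gz0_Hp c; have Ge := Gz0_Hp e.
rewrite !HipE; try mem.
have e1 : ipn k (kmin e + x' + n') = (dotc e (mxadj Gb *m dvec k))^* + ipn k x'.
  rewrite !(ipDr hn) ?(N_orth hn2 hk) ?addr0; try mem.
  by rewrite Gb_dot -?(ipC hn) //; mem.
have e2 : ipn (kmin c + k' + n) x = dotc c (mxadj Gb *m dvec x) + ipn k' x.
  rewrite !(ipDl hn); try mem.
  have -> : ipn n x = 0 by rewrite (ipC hn nx nn) (N_orth hn1 hx) rmorph0.
  by rewrite addr0 Gb_dot //; mem.
have e3 := l1_sym hl hl2.
have e4 := Lres_sym hS hL hL2.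
have e5 := Gz0_pair c hL2; have e6 := Gz0_pair e hL; have e7 := Rt_gram c e.
rewrite e1 e2 -e3 /Gamma1 dotcBr dotcDr dotcBl dotcDl.
have e8 : dotc (mxadj Cmx *m phiv f) e = ipm f' (Gz0 e) - z0 * ipm f (Gz0 e).
  rewrite dotcC -e6 (ipC hpm Ge hf') (ipC hpm Ge hf).
  rewrite [LHS]rmorphB [X in _ - X = _]rmorphM; congr (_ - _ * _); exact: conjCK.
rewrite -e5 e8 (dotcC e (mxadj Gb *m dvec k)).
have -> : dotc c (Rt z0 *m e) = (z0 - z0^*) * ipm (Gz0 c) (Gz0 e) + dotc (Rt z0 *m c) e by rewrite e7 subrK.
rewrite !(ipDl hpm) ?(ipDr hpm) ?(ipZl hpm) ?(ipZr hpm) //; try mem.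
rewrite e4; ring.
Qed.

Lemma ker0_exit_bmap x y : ker0 (bmapN N) (x, y) <->
  exists f f' k k' n, [/\ Lres S m (f, f'), l1 (k, k'), N n, x = f + k & y = f' + k' + n].
Proof.
split.
  move=> [b [f [f' [c [k [k' [n [hL hl hn1 [-> ->] [c0 _]]]]]]]]].
  exists f, f', k, k', n; split => //; rewrite -c0 Gz00 ?kmin0; lmod.
move=> [f [f' [k [k' [n [hL hl hn1 -> ->]]]]]]; exists (Gamma1 f 0 k).
exists f, f', 0, k, k', n; split => //; rewrite kmin0 rs0 //; last exact: rho_z0.
by congr (_, _); lmod.
Qed.

Lemma bmapN_onto0 z y : 'Im z != 0 -> E y -> exists x, ker0 (bmapN N) (x, y + z *: x).
Proof.
move=> z1 [f [_ [hf /KNE[k [n [hk hn1 ->]]] ->]]].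
have hL := Lres_rs hS (rhoL_nonreal hS z1) hf.
have [x hx] := l1_onto z1 hk.
exists (rs z f + x); apply/ker0_exit_bmap; exists (rs z f), (f + z *: rs z f), x, (k + z *: x), n.
by split => //; lmod.
Qed.

Lemma bmapN_triple : boundary_triple E A (bmapN N).
Proof.
apply: boundary_triple_green; [exact: E_inner|exact: bmapN_dom|by []|exact: (bmapN_sub sN)
  |exact: bmapN_onto|exact: bmapN_green|exact: bmapN_onto0].
Qed.

Lemma calB0_ker0 p : calB0 p -> ker0 (bmapN N) p.
Proof.
case: p => x y /calB0P[f [f' [k [k' [hL hl -> ->]]]]]; apply/ker0_exit_bmap.
by exists f, f', k, k', 0; split => //; [exact: (subspace0 sN)|rewrite addr0].
Qed.

Lemma N_K1_eq0 n : N n -> K1 n -> n = 0.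
Proof. by move=> h1 h2; apply: (ip_eq0 hn); [mem|exact: N_orth]. Qed.

(** [N] meets [K1] trivially, so the multivalued part only absorbs the [N] component of the
    right-hand side. By Pythagoras dropping this component does not increase the norm, which
    transfers the resolvent bound. *)
Lemma rho_ker0 : rho E (ker0 (bmapN N)) = rho H1 calB0.
Proof.
have K1K := K1_Kx.
apply/seteqP; split=> z [h [M hM]].
  split.
    move=> _ [f [k [hf hk ->]]].
    have hE : E (f + k) by exists f, k; split => //; mem.
    have [x [/ker0_exit_bmap[f1 [f1' [k1 [k1' [n [hL hl hn1 xE e]]]]]] hu]] := h _ hE.
    have [hf1 hf1'] := Lres_inE hS hL; have /l1P[hk1 hk1' _] := hl.
    have [e1 e2] : f + z *: f1 = f1' /\ k + z *: k1 = k1' + n.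
      by apply: sum_inj; try mem; rewrite [RHS]addrA -e xE; lmod.
    have n0 : n = 0.
      apply: N_K1_eq0 => //; have -> : n = k + z *: k1 - k1' by rewrite e2; lmod.
      by mem.
    rewrite n0 addr0 in e2; exists x; split.
      by apply/calB0P; exists f1, f1', k1, k1'; split => //; rewrite xE -e1 -e2; lmod.
    by move=> w /calB0_ker0; apply: hu.
  by exists M => p /calB0_ker0; apply: hM.
split.
  move=> _ [f [_ [hf /KNE[k [n [hk hn1 ->]]] ->]]].
  have hE : H1 (f + k) by exists f, k.
  have [x [/calB0P[f1 [f1' [k1 [k1' [hL hl xE e]]]]] hu]] := h _ hE.
  exists x; split.
    by apply/ker0_exit_bmap; exists f1, f1', k1, k1', n; split => //; rewrite -e; lmod.
  move=> w /ker0_exit_bmap[g [g' [c [c' [n' [hL2 hl2 hn2 wE e2]]]]]]; apply: hu; apply/calB0P.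
  have [hg hg'] := Lres_inE hS hL2; have /l1P[hc hc' _] := hl2.
  have [e3 e4] : f + z *: g = g' /\ k + n + z *: c = c' + n'.
    by apply: sum_inj; try mem; rewrite [RHS]addrA -e2 wE; lmod.
  have n0 : n - n' = 0.
    apply: N_K1_eq0; first by mem.
    have -> : n - n' = k + n + z *: c - n' - k - z *: c by lmod.
    by rewrite e4 addrK; mem.
  exists g, g', c, c'; split => //; rewrite wE -e3 -[c'](addrK n') -e4.
  have -> : k + n + z *: c - n' = k + z *: c + (n - n') by lmod.
  by rewrite n0; lmod.
exists `|M| => -[x y] /ker0_exit_bmap[f [f' [k [k' [n [hL hl hn1 -> ->]]]]]].
have [hf hf'] := Lres_inE hS hL; have /l1P[hk hk' _] := hl.
rewrite [fst _]/= [snd _]/=.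
have hB : calB0 (f + k, f' + k') by apply/calB0P; exists f, f', k, k'.
have := hM _ hB; rewrite [fst _]/= [snd _]/=.
have -> : f' + k' - z *: (f + k) = (f' - z *: f) + (k' - z *: k) by lmod.
have -> : f' + k' + n - z *: (f + k) = (f' - z *: f) + (k' - z *: k + n) by lmod.
have hg : Hp S m (f' - z *: f) by mem.
have hkk : K1 (k' - z *: k) by mem.
have hx : H1 (f + k) by exists f, k.
have hy : H1 (f' - z *: f + (k' - z *: k)) by exists (f' - z *: f), (k' - z *: k).
have hy' : E (f' - z *: f + (k' - z *: k + n)).
  by exists (f' - z *: f), (k' - z *: k + n); split; [mem|mem|].
move: (f' - z *: f) (k' - z *: k) hg hkk hy hy' => g w hg hw hy hy' hb.
apply: le_trans (le_norm_mul (hnorm_ge0 H1_inner hx) (hnorm_ge0 H1_inner hy) hb) _.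
rewrite ler_wpM2l //.
have hwK : Kx w by mem. have hwn : Kx (w + n) by mem.
have p1 := hnorm_ge0 H1_inner hy; have p2 := hnorm_ge0 E_inner hy'.
rewrite -(ler_pXn2r (n := 2)) // ?nnegrE //.
have -> : hnorm E (g + (w + n)) ^+ 2 = hnorm H1 (g + w) ^+ 2 + hip (Hn S m) n n.
  have Nw : Hn S m w by mem. have Nn : Hn S m n by mem.
  have o1 : ipn w n = 0 by apply: N_orth.
  rewrite !hnorm_sumE // -addrA; congr (_ + _).
  rewrite !hnormK !(ipDl hn) ?(ipDr hn) //; try mem.
  by rewrite o1 (ipC hn Nw Nn) o1 rmorph0 addr0 add0r.
by rewrite lerDl; apply: (ip_ge0 hn); mem.
Qed.

Lemma bmapN_gamma_weyl : gamma_weyl_given_by E (bmapN N) (rho H1 calB0)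
  gammaB weylB.
Proof.
apply: (gamma_weyl_of_solutions E_inner bmapN_dom erefl (bmapN_sub sN) bmapN_onto bmapN_green rho_ker0).
by move=> z c; apply: bmapN_solution.
Qed.

Lemma adj_exit_bmap_dom : adj E A = [set p | bmapN N (p, (0, 0))].
Proof. exact: (adj_bmap E_inner bmapN_dom erefl (bmapN_sub sN) bmapN_onto bmapN_green bmapN_onto0). Qed.

Lemma adj_exit_bmap_ker : adj E [set p | bmapN N (p, (0, 0))] = A.
Proof. exact: (adj_ker_bmap E_inner bmapN_dom erefl (bmapN_sub sN) bmapN_onto bmapN_green bmapN_onto0). Qed.

End ExitPart.

(** * The triple of $B_{\max}$ *)

Local Notation Hbot := (Hbot phi zs K1).

Lemma Hbot_sub : is_subspace Hbot.
Proof.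
split.
  split; [mem|move=> y hy].
  by rewrite [LHS](ip0r hn) //; mem.
move=> a u v [hu u0] [hv v0]; split; [mem|move=> y hy].
have hyn : Hn S m y by mem. have hun : Hn S m u by mem. have hvn : Hn S m v by mem.
have e1 : ipn y u = 0 := u0 y hy. have e2 : ipn y v = 0 := v0 y hy.
have hz : Hn S m (a *: u) by mem.
by rewrite [LHS](ipDr hn) // (ipZr hn) // e1 e2 mulr0 addr0.
Qed.

Lemma Hbot_Kx : Hbot `<=` Kx. Proof. by move=> n []. Qed.
Lemma Hbot_orth n w : Hbot n -> K1 w -> ipn w n = 0. Proof. by move=> [_ h]; exact: h. Qed.
Lemma Kx_Hbot x : Kx x <-> exists k n, [/\ K1 k, Hbot n & x = k + n].
Proof.
split=> [hx|[k [n [hk [hn1 _] ->]]]]; last by mem.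
have [p hp h] := proj_K1 hx; exists p, (x - p); split => //; last by lmod.
by split; [mem|exact: h].
Qed.

Lemma l1_Hbot k : K1 k -> exists k', l1 (k, k') /\ Hbot (lmap k - k').
Proof.
move=> hk; have [k' hk'] := l1_total hk; have /l1P[_ h1 h2] := hk'.
by exists k'; split => //; split; [mem|exact: h2].
Qed.

Lemma Gamma1_Gammat f k c : Hp S m.+2 f -> Kx k ->
  Gammat (f + k + Gz0 c, (c, Gamma1 f c k)).
Proof. by move=> hf hk; apply/Gammat_iff; exists f, k. Qed.

Lemma Gammat_Amax x y a b : Amax (x, y) -> Gammat (x, (a, b)) -> H1 x ->
  exists f f' k k', [/\ Lres S m (f, f'), l1 (k, k') & Hbot (lmap k - k')] /\
    [/\ x = f + k + Gz0 a, y = f' + z0 *: Gz0 a + kmin a + lmap k & b = Gamma1 f a k].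
Proof.
move=> /Amax_inv[f [f' [c [k [hL hk xE yE]]]]] /Gammat_iff[f2 [k2 [hf2 hk2 xE2 ->]]] [h [k3 [hh hk3 xE3]]].
have [_ hf] := hL; rewrite [fst _]/= in hf.
have [e1 e2 e3] := decomposition_inj hf hk hf2 hk2 (etrans (esym xE) xE2).
have Ga := Gz0_Hp a.
have [_ e4] : f2 + Gz0 a = h /\ k2 = k3.
  by apply: sum_inj; try mem; rewrite -xE3 xE2; lmod.
have hk1 : K1 k by rewrite e2 e4.
have [k' [hk' hb]] := l1_Hbot hk1.
rewrite e3 in xE yE; rewrite -e1 -e2.
exists f, f', k, k'; split; first exact: (And3 hL hk' hb).
exact: (And3 xE yE erefl).
Qed.

(** [Amax] acts by [lmap k] where [bmapN] has [l1]; the two values differ by an element of [Hbot],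
    which the multivalued part absorbs. *)
Lemma GammaB_exit_bmap : GammaB = bmapN Hbot.
Proof.
apply/seteqP; split=> [r [u [v [[[hA hG] hH _] [[v1 v2] v3] ->]]]|[[px py] [a b]]].
  case: u hA hG hH => -[x y] [a b] hA hG hH.
  case: v v1 v2 v3 => -[x1 y1] [a1 b1] v1 v2 [v3 v4].
  have [f [f' [k [k' [[hL hl hb] [xE yE bE]]]]]] := Gammat_Amax hA hG hH.
  exists f, f', a, k, k', ((lmap k - k') + y1); split => //.
  - exact: (subspaceD Hbot_sub hb v2).
  - have x10 : x1 = 0 := v1; transitivity (x + x1, y + y1); first by [].
    by rewrite x10 addr0 xE yE; congr (_, _); lmod.
  - by rewrite /= v3 v4 bE !addr0.
move=> [f [f' [c [k [k' [n [hL hl hn1 [-> ->] [-> ->]]]]]]]].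
have /l1P[hk hk' ho] := hl; have [hf hf'] := Lres_inE hS hL; have hf2 : Hp S m.+2 f := proj2 hL.
have hkx : Kx k by mem.
have hA := Amax_sub c hL hkx.
exists ((f + k + Gz0 c, f' + z0 *: Gz0 c + kmin c + lmap k), (c, Gamma1 f c k)).
exists ((0, n - (lmap k - k')), (0, 0)); split.
- split; [split; [exact: hA|exact: Gamma1_Gammat]| |by case: hA].
  by exists (f + Gz0 c), k; split; [have := Gz0_Hp c; mem|exact: hk|rewrite [fst _]/=; lmod].
- split => //; split => //=.
  by apply: (subspaceB Hbot_sub hn1); split; [mem|exact: ho].
change ((f + k + Gz0 c, f' + z0 *: Gz0 c + kmin c + k' + n, (c, Gamma1 f c k)) =
  (f + k + Gz0 c + 0, f' + z0 *: Gz0 c + kmin c + lmap k + (n - (lmap k - k')), (c + 0, Gamma1 f c k + 0))).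
by rewrite !addr0; congr ((_, _), _); lmod.
Qed.

Lemma Bmax_exit_bmap : Bmax = [set p | exists ab, bmapN Hbot (p, ab)].
Proof.
rewrite -GammaB_exit_bmap; apply/seteqP; split=> [p [u [v [[hA hH] hv ->]]]|p [ab [u [v [[[hA hG] hH _] [hv _] e]]]]].
  case: u hA hH => x y hA hH; have [f [f' [c [k [hL hk xE yE]]]]] := Amax_inv hA.
  have [_ hf] := hL.
  exists (c, Gamma1 f c k), ((x, y), (c, Gamma1 f c k)), (v, 0); split => //.
  - by split => //; [split => //; rewrite [fst _]/= xE; apply: Gamma1_Gammat|case: hA].
  - by congr (_, _); rewrite addr0.
by exists u.1, v.1; split => //; case: e.
Qed.

Lemma triple_Bmax : boundary_triple Hcal Bmax GammaB /\
  gamma_weyl_given_by Hcal GammaB (rho H1 calB0)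
    gammaB weylB.
Proof.
rewrite Bmax_exit_bmap GammaB_exit_bmap; split.
  exact: (bmapN_triple Hbot_sub Hbot_Kx Hbot_orth Kx_sub Kx_Hbot).
exact: (bmapN_gamma_weyl Hbot_sub Hbot_Kx Hbot_orth Kx_sub Kx_Hbot).
Qed.

(** * The triple of the operator part $\mathcal B_{\max}$ *)

Local Notation bmap0 := (bmapN [set 0]).
Local Notation Amin := (Amin phi zs).

Lemma zero_sub : is_subspace [set 0 : X].
Proof. by split => // a u v -> ->; rewrite scaler0 addr0. Qed.
Lemma zero_Kx : [set 0 : X] `<=` Kx. Proof. by move=> _ ->; mem. Qed.
Lemma zero_orth n w : [set 0] n -> K1 w -> ipn w n = 0.
Proof. by move=> -> hw; rewrite (ip0r hn) //; mem. Qed.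
Lemma K1_zero x : K1 x <-> exists k n, [/\ K1 k, [set 0] n & x = k + n].
Proof.
split=> [hx|[k [n [hk -> ->]]]]; last by rewrite addr0.
by exists x, 0; split; rewrite ?addr0.
Qed.

Lemma bmap0P x y a b : bmap0 ((x, y), (a, b)) <-> exists f f' k k', [/\ Lres S m (f, f'), l1 (k, k') &
  [/\ x = f + k + Gz0 a, y = f' + z0 *: Gz0 a + kmin a + k' & b = Gamma1 f a k]].
Proof.
split=> [[f [f' [c [k [k' [n [hL hl -> [-> ->] [-> ->]]]]]]]]|[f [f' [k [k' [hL hl [-> -> ->]]]]]]].
  by exists f, f', k, k'; rewrite addr0.
by exists f, f', a, k, k', 0; split; rewrite ?addr0.
Qed.

Local Notation dom0 := ([set p | exists ab, bmap0 (p, ab)]).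

(** The adjoint of [l] in $\mathfrak K$, found by prescribing inner products with the basis. Outside
    [K1] the operator [l] need not be symmetric, and [Amin] acts on the exit part by this
    adjoint. *)
Lemma lmap_adj k : Kx k -> exists2 y, Kx y & forall x, Kx x -> ipn x y = ipn (lmap x) k.
Proof.
move=> hk; have gn i : Hn S m (gi i) by mem.
have [a ha] := gram_solve hn (fun i => ipn (zs (ix i).2 *: gi i) k) gn gi_indep.
set y := \sum_j _ in ha; have hy : Kx y by rewrite /y; mem.
exists y => // x hx; have xE := dvecP hx.
transitivity (ipn (\sum_i dvec x i 0 *: gi i) y); first by rewrite -xE.
rewrite /lmap !(ip_suml hn); try mem.
apply: eq_bigr => i _; rewrite !(ipZl hn) ?ha ?(ipZl hn) //; try mem.
by rewrite rmorphM mulrA.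
Qed.

(** [y] is the adjoint of [l] at [k]; its projection to [K1] is [k'] because [lmap] is symmetric on
    [K1]. The vanishing of [Gamma1] balances the [kmin] terms against the functionals. *)
Lemma Amin_extension f f' k k' : Lres S m (f, f') -> l1 (k, k') -> Gamma1 f 0 k = 0 ->
  exists2 y, Amin (f + k, f' + y) & Kx y /\ forall w, K1 w -> ipn w (y - k') = 0.
Proof.
move=> hL hl G10; have /l1P[hk hk' ho] := hl; have [hf hf'] := Lres_inE hS hL.
have hkx : Kx k by mem. have [y hy hadj] := lmap_adj hkx.
exists y; last first.
  split => // w hw; have hwx : Kx w by mem.
  have e := ho w hw; rewrite (ipBr hn) in e; try mem.
  rewrite (ipBr hn) ?hadj -?(lmap_sym hw hk) //; mem.
split; [by exists f, k|by exists f', y|move=> [u v] /Amax_inv[h [h' [c [x [hL2 hx -> ->]]]]]].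
have [hh hh'] := Lres_inE hS hL2; have Gc := Gz0_Hp c.
rewrite [fst _]/= [snd _]/= /Defs.Hcal [hip _]/=.
have -> : h' + z0 *: Gz0 c + kmin c + lmap x = (h' + z0 *: Gz0 c) + (kmin c + lmap x) by lmod.
have -> : h + x + Gz0 c = (h + Gz0 c) + x by lmod.
rewrite !HipE //; try mem.
rewrite hadj // (ipDl hn) //; try mem.
rewrite !(ipDl hpm) ?(ipZl hpm) //; try mem.
rewrite (Lres_sym hS hL2 hL) -(Gb_dot c hkx).
have e := Gz0_pair c hL; have e2 : dotc c (mxadj Cmx *m phiv f) = dotc c (mxadj Gb *m dvec k).
  congr (dotc c _); apply/eqP; rewrite -subr_eq0; apply/eqP.
  by rewrite -[RHS]G10 /Gamma1 mulmx0 addr0.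
by rewrite -e2 -e; ring.
Qed.

Lemma K1_inner_cancel f g y k' k : Hp S m f -> Hp S m g -> K1 k -> Kx y -> Kx k' ->
  (forall w, K1 w -> ipn w (y - k') = 0) -> Hip (f + k) (g + y) = Hip (f + k) (g + k').
Proof.
move=> hf hg hk hy hk' h; have hkx : Kx k by mem.
rewrite !HipE //; congr (_ + _); apply/eqP; rewrite -subr_eq0; apply/eqP.
by have := h k hk; rewrite (ipBr hn) //; mem.
Qed.

(** Against elements of [Amax] over [H1] only projections to [K1] are seen, so [calBmin] lies in the
    adjoint of the domain of [bmap0], which is the kernel of [bmap0]. Conversely, [Amin_extension]
    lifts kernel elements to [Amin]. *)
Lemma calBmin_bmap0 : calBmin = [set p | bmap0 (p, (0, 0))].
Proof.
apply/seteqP; split=> -[x y].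
  move=> [hx hy [y' [hx' hy' hmin]] ho]; rewrite [fst _]/= [snd _]/= in hx hy hy' ho.
  rewrite -(adj_exit_bmap_dom zero_sub zero_Kx zero_orth hK1 K1_zero); split; [exact: hx|exact: hy|].
  move=> [u v] [[a b] /bmap0P[f [f' [k [k' [hL hl [-> -> _]]]]]]].
  have /l1P[hk hk' hoo] := hl; have hkx : Kx k by mem.
  have e2 : Hip (f' + z0 *: Gz0 a + kmin a + lmap k) x = Hip (f + k + Gz0 a) y'.
    exact: (hmin _ (Amax_sub a hL hkx)).
  suff : Hip (f' + z0 *: Gz0 a + kmin a + k') x = Hip (f + k + Gz0 a) y by [].
  have [hf hf'] := Lres_inE hS hL; have Ga := Gz0_Hp a.
  have hu : H1 (f + k + Gz0 a) by exists (f + Gz0 a), k; split; [mem|mem|lmod].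
  have huc : Hcal (f + k + Gz0 a) by exists (f + Gz0 a), k; split; [mem|mem|lmod].
  have hyc : Hcal y by case: hy => h1 [h2 [h3 h4 ->]]; exists h1, h2; split; [mem|mem|].
  have := ho _ hu; rewrite (ipBr Hcal_inner huc hy' hyc) => /eqP; rewrite subr_eq0 => /eqP e1.
  rewrite [hip _]/= in e1; rewrite -e1 -e2.
  case: hx hx' {hmin e2} => g [x1 [hg hx1 ->]] hgx; rewrite [fst _]/= in hgx.
  have -> : f' + z0 *: Gz0 a + kmin a + lmap k = f' + z0 *: Gz0 a + (kmin a + lmap k) by lmod.
  have -> : f' + z0 *: Gz0 a + kmin a + k' = f' + z0 *: Gz0 a + (kmin a + k') by lmod.
  have h1 : H1 (g + x1) by exists g, x1.
  have hv1 : Hcal (f' + z0 *: Gz0 a + (kmin a + lmap k)).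
    by exists (f' + z0 *: Gz0 a), (kmin a + lmap k); split; [mem|mem|].
  have hv2 : Hcal (f' + z0 *: Gz0 a + (kmin a + k')).
    by exists (f' + z0 *: Gz0 a), (kmin a + k'); split; [mem|mem|].
  have c1 := ipC Hcal_inner hgx hv1; have c2 := ipC Hcal_inner hgx hv2.
  rewrite [hip _]/= in c1 c2; rewrite c1 c2; congr (_ ^*).
  apply/esym/K1_inner_cancel => //; try mem.
  by move=> w hw; rewrite (_ : _ - _ = lmap k - k') ?hoo //; lmod.
move=> /bmap0P[f [f' [k [k' [hL hl [xE yE gE]]]]]].
have /l1P[hk hk' hoo] := hl; have [hf hf'] := Lres_inE hS hL.
have [w hw [hwx ho]] := Amin_extension hL hl (esym gE).
have xE' : x = f + k by rewrite xE Gz00 addr0.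
have yE' : y = f' + k' by rewrite yE Gz00 kmin0 scaler0 !addr0.
have hx : H1 x by rewrite xE'; exists f, k.
have hy : H1 y by rewrite yE'; exists f', k'.
apply: (And3 hx hy).
exists (f' + w); first by rewrite [fst _]/= xE'.
move=> _ [g [u [hg hu ->]]]; rewrite yE' [hip _]/=.
have -> : f' + w - (f' + k') = 0 + (w - k') by lmod.
have m0 : Hp S m 0 by mem.
by rewrite HipE ?(ip0r hpm) ?ho ?addr0 //; mem.
Qed.

Lemma calBmax_bmap0 : calBmax = dom0.
Proof. by rewrite /Defs.calBmax calBmin_bmap0 (adj_exit_bmap_ker zero_sub zero_Kx zero_orth hK1 K1_zero). Qed.

Lemma on_graph_bmap0 : on_graph calBmax GammacalB = bmap0.
Proof.
rewrite calBmax_bmap0; apply/seteqP; split=> -[[x y] [a b]].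
  move=> [[[a' b'] h] [hG hH]]; rewrite [fst _]/= [snd _]/= in h hG hH.
  have [f [f' [k [k' [hL hl [xE yE bE]]]]]] := proj1 (bmap0P _ _ _ _) h.
  have /l1P[hk _ _] := hl; have hf : Hp S m.+2 f := proj2 hL; have hkx : Kx k by mem.
  have [f2 [k2 [hf2 hk2 xE2 bE2]]] := proj1 (Gammat_iff _ _ _) hG.
  have [e1 e2 e3] := decomposition_inj hf hkx hf2 hk2 (etrans (esym xE) xE2).
  rewrite e3 in xE yE; rewrite -e1 -e2 in bE2.
  apply/bmap0P; exists f, f', k, k'; exact: (And3 hL hl (And3 xE yE bE2)).
move=> h; have [f [f' [k [k' [hL hl [xE yE bE]]]]]] := proj1 (bmap0P _ _ _ _) h.
have /l1P[hk _ _] := hl; have hf : Hp S m.+2 f := proj2 hL; have hkx : Kx k by mem.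
split; first by exists (a, b).
split; rewrite [fst _]/= ?[snd _]/=; first by rewrite xE bE; apply: Gamma1_Gammat.
have Ga := Gz0_Hp a; have hfm := Hp_m2 hf;
by rewrite xE; exists (f + Gz0 a), k; split; [mem|exact: hk|lmod].
Qed.

Lemma triple_calBmax : boundary_triple_op H1 calBmax GammacalB /\
  gamma_weyl_given_by H1 (on_graph calBmax GammacalB)
    (rho H1 calB0) gammaB weylB.
Proof.
split; last first.
  rewrite on_graph_bmap0; exact: (bmapN_gamma_weyl zero_sub zero_Kx zero_orth hK1 K1_zero).
split; last first.
- rewrite on_graph_bmap0 calBmax_bmap0; exact: (bmapN_triple zero_sub zero_Kx zero_orth hK1 K1_zero).
- rewrite calBmax_bmap0; apply/seteqP; split=> x.
    move=> [[a b] [hG hH]]; rewrite [fst _]/= in hH.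
    have [f [k [hf hk xE bE]]] := proj1 (Gammat_iff _ _ _) hG.
    case: hH => h [k3 [hh hk3 xE3]]; have Ga := Gz0_Hp a.
    have [_ e] : f + Gz0 a = h /\ k = k3.
      by apply: sum_inj; try mem; rewrite -xE3 xE; lmod.
    have [k' hk'] : exists k', l1 (k, k') by apply: l1_total; rewrite e.
    have [f' hf'] := Lres_total hf.
    exists (f' + z0 *: Gz0 a + kmin a + k'), (a, b); apply/bmap0P.
    by exists f, f', k, k'.
  move=> [y [[a b] h]]; exists (a, b).
  have hG : on_graph calBmax GammacalB ((x, y), (a, b)).
    by rewrite on_graph_bmap0.
  by case: hG.
rewrite calBmax_bmap0 => x y y' [[a b] /bmap0P[f [f' [k [k' [hL hl [xE -> _]]]]]]] [[c e] /bmap0P[g [g' [w [w' [hL2 hl2 [xE2 -> _]]]]]]].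
have /l1P[hk _ _] := hl; have hL0 : L (f, f') := proj1 hL; have hf : Hp S m.+2 f := proj2 hL; have hkx : Kx k by mem.
have /l1P[hw _ _] := hl2; have hL20 : L (g, g') := proj1 hL2; have hg : Hp S m.+2 g := proj2 hL2; have hwx : Kx w by mem.
have [e1 e2 e3] := decomposition_inj hf hkx hg hwx (etrans (esym xE) xE2).
rewrite e3 (Lop hS hL0 (_ : L (f, g'))) ?(l1_op hl (_ : l1 (k, w'))) ?e1 ?e2 //.
Qed.

(** * The triple of the exit space operator *)

Lemma GammaringP x y a b : Gammaring ((x, y), (a, b)) <-> exists k', [/\ l1 (x, k'), y = k' + kmin a & b = - (mxadj Gb *m dvec x)].
Proof.
split=> [[k [k' [c [hl [-> ->] [-> ->]]]]]|[k' [hl -> ->]]]; first by exists k'.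
by exists x, k', a.
Qed.

Local Notation dom3 := ([set p | exists ab, Gammaring (p, ab)]).

Lemma Gammaring_dom p : dom3 p -> K1x p.1 /\ K1x p.2.
Proof.
case: p => x y [[a b] /GammaringP[k' [/l1P[hk hk' _] -> _]]]; split; [exact: hk|].
by rewrite [snd _]/= /K1x [hset _]/=; mem.
Qed.

Lemma Gammaring_sub : is_subspace Gammaring.
Proof.
split.
  apply/GammaringP; exists 0; split; [exact: (rel0 l1_sub)|by rewrite kmin0 addr0|].
  have K0 : Kx 0 by mem.
  have e : dvec 0 = 0 by have := dvec_lin (-1) K0 K0; rewrite scaler0 addr0 scaleN1r addNr.
  by rewrite e mulmx0 oppr0.
move=> t [[x y] [a b]] [[x1 y1] [a1 b1]] /GammaringP[k [hl -> ->]] /GammaringP[k1 [hl1 -> ->]].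
apply/GammaringP; exists (t *: k + k1); split.
- exact: (relD l1_sub (relZ l1_sub t hl) hl1).
- change (t *: (k + kmin a) + (k1 + kmin a1) = t *: k + k1 + kmin (t *: a + a1)).
  by rewrite kmin_lin; lmod.
have /l1P[hk _ _] := hl; have /l1P[hk1 _ _] := hl1.
have hkx : Kx x by mem. have hkx1 : Kx x1 by mem.
change (t *: - (mxadj Gb *m dvec x) + - (mxadj Gb *m dvec x1) = - (mxadj Gb *m dvec (t *: x + x1))).
by rewrite dvec_lin // mulmxDr -scalemxAr opprD scalerN.
Qed.

Lemma Gammaring_onto ab : exists p, Gammaring (p, ab).
Proof.
case: ab => c b; have hfs s : Hn S m (fs s) by mem.
have [a ha] := gram_solve hn (fun s => - b s 0) hfs fs_indep.
set k := \sum_j _ in ha.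
have hk : K1 k by rewrite /k; mem.
have [k' hk'] := l1_total hk; exists (k, k' + kmin c); apply/GammaringP; exists k'; split => //.
rewrite Gb_dvec; last by mem.
by apply/colP => s; rewrite mxE [(\col_ _ _) _ _]mxE ha opprK.
Qed.

Lemma Gammaring_green p ab q ab' : Gammaring (p, ab) -> Gammaring (q, ab') ->
  hip K1x p.1 q.2 - hip K1x p.2 q.1 = dotc ab.1 ab'.2 - dotc ab.2 ab'.1.
Proof.
case: p q ab ab' => [x y] [u v] [a b] [c e] /GammaringP[k [hl -> ->]] /GammaringP[w [hl2 -> ->]].
have /l1P[hx hk _] := hl; have /l1P[hu hw _] := hl2.
have hxk : Kx x by mem. have huk : Kx u by mem.
change (ipn x (w + kmin c) - ipn (k + kmin a) u =
  dotc a (- (mxadj Gb *m dvec u)) - dotc (- (mxadj Gb *m dvec x)) c).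
rewrite dotcNr dotcNl (dotcC c) !Gb_dot //.
have nx : Hn S m x by mem. have nu : Hn S m u by mem.
have nk : Hn S m k by mem. have nw : Hn S m w by mem.
have na : Hn S m (kmin a) by mem. have nc : Hn S m (kmin c) by mem.
rewrite (ipDr hn nx nw nc) (ipDl hn nk na nu) (l1_sym hl hl2) -(ipC hn nc nx); ring.
Qed.

Lemma Gammaring_ker0 : ker0 Gammaring = l1.
Proof.
apply/seteqP; split=> -[x y].
  by move=> [b /GammaringP[k [hl -> _]]]; rewrite kmin0 addr0.
move=> h; exists (- (mxadj Gb *m dvec x)); apply/GammaringP; exists y.
by rewrite kmin0 addr0.
Qed.

Lemma Gammaring_onto0 z y : 'Im z != 0 -> K1x y -> exists x, ker0 Gammaring (x, y + z *: x).
Proof. by rewrite Gammaring_ker0; exact: l1_onto. Qed.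

(** Orthogonality to $\mathfrak K_{\min}$ is the vanishing of $\mathcal G_b^*d(k)$. So [l1ring] is
    the kernel of the boundary map, and closedness, defect numbers and adjoint follow as for any
    such kernel. *)
Lemma l1ring_Gammaring : l1ring = [set p | Gammaring (p, (0, 0))].
Proof.
have Gbk x : Kx x -> (forall y, Kmin phi zs y -> ipn y x = 0) <-> mxadj Gb *m dvec x = 0.
  move=> hx; rewrite Gb_dvec //; split=> [h|h y /Kmin_iff[c ->]].
    apply/colP => s; rewrite !mxE; apply: h; split; [exact: fs_Kx|exact: fs_sub].
  by rewrite -Gb_dot // Gb_dvec // h dotc0r.
apply/seteqP; split=> -[x y].
  move=> [hl [hx h]]; rewrite [fst _]/= in hx h; apply/GammaringP; exists y; split; [exact: hl|by rewrite kmin0 addr0|].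
  have hxx : Kx x by mem.
  by rewrite (proj1 (Gbk x hxx) h) oppr0.
move=> /GammaringP[k [hl -> e]]; have /l1P[hx _ _] := hl.
rewrite kmin0 addr0; split; [exact: hl|split; [exact: hx|]].
have hxx : Kx x by mem.
by apply/(Gbk _ hxx)/eqP; rewrite -oppr_eq0 -e.
Qed.

Lemma l1ringadj_Gammaring : l1ringadj = dom3.
Proof.
rewrite /Defs.l1ringadj l1ring_Gammaring.
exact: (adj_ker_bmap K1x_inner Gammaring_dom erefl Gammaring_sub Gammaring_onto Gammaring_green Gammaring_onto0).
Qed.

Lemma l1ring_symmetric : [/\ is_op l1ring, closed_rel K1x l1ring,
  symmetric_rel K1x l1ring & defect K1x l1ring d].
Proof.
have := bmap_kernel K1x_inner Gammaring_dom erefl Gammaring_sub Gammaring_onto Gammaring_green Gammaring_onto0.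
rewrite -l1ring_Gammaring => -[h1 h2 h3 _]; split => //.
by move=> x y y' [h _] [h' _]; apply: l1_op h h'.
Qed.

Lemma l1ringadj_ssum : l1ringadj = ssum l1 [set p | p.1 = 0 /\ Kmin phi zs p.2].
Proof.
rewrite l1ringadj_Gammaring; apply/seteqP; split=> [[x y]|p].
  move=> [[a b] /GammaringP[k [hl -> _]]]; exists (x, k), (0, kmin a); split => //.
    by split => //; apply/Kmin_iff; exists a.
  by congr (_, _); rewrite addr0.
move=> [[x k] [[x0 y0] [hl [e /Kmin_iff[a e2]] ->]]]; rewrite [fst _]/= [snd _]/= in e e2.
exists (a, - (mxadj Gb *m dvec x)); apply/GammaringP; exists k; rewrite e e2.
have e3 : x + 0 = x := addr0 x.
change ([/\ l1 (x + 0, k), k + kmin a = k + kmin a & - (mxadj Gb *m dvec x) = - (mxadj Gb *m dvec (x + 0))]).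
by rewrite e3.
Qed.

Lemma eigspace_l1ringadj z : rho K1x l1 z ->
  eigspace l1ringadj z = resolvent l1 z @` Kmin phi zs.
Proof.
move=> hz; rewrite l1ringadj_Gammaring; apply/seteqP; split=> [x|_ [y /Kmin_iff[c ->] <-]].
  (* Here [(l1 - z) x = - kmin a], which is also the sign in [gammaring]. *)
  move=> [[a b] /GammaringP[k [hl e _]]]; exists (- kmin a).
    by apply/Kmin_iff; exists (- a); have := kmin_lin (-1) a 0; rewrite kmin0 !addr0 !scaleN1r.
  apply/esym/r1_eq => //; first by mem.
  by rewrite [z *: x]e addrC addrK.
have hk := r1P hz (kmin_K1 c).
exists (- c, - (mxadj Gb *m dvec (r1 z (kmin c)))); apply/GammaringP; exists (kmin c + z *: r1 z (kmin c)); split => //.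
have -> : kmin (- c) = - kmin c by have := kmin_lin (-1) c 0; rewrite kmin0 !addr0 !scaleN1r.
by lmod.
Qed.

Lemma triple_l1ringadj : boundary_triple K1x l1ringadj Gammaring /\
  gamma_weyl_given_by K1x Gammaring (rho K1x l1) gammaring Qmx.
Proof.
rewrite l1ringadj_Gammaring; split.
  exact: (boundary_triple_green K1x_inner Gammaring_dom erefl Gammaring_sub Gammaring_onto Gammaring_green Gammaring_onto0).
apply: (gamma_weyl_of_solutions K1x_inner Gammaring_dom erefl Gammaring_sub Gammaring_onto Gammaring_green).
  by rewrite Gammaring_ker0.
move=> z c hz; have hk := r1P hz (kmin_K1 c); have hk1 := r1_K1 hz (kmin_K1 c).
apply/GammaringP; exists (- (kmin c + z *: r1 z (kmin c))); split.
- exact: (relN l1_sub hk).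
- by rewrite /Defs.gammaring; lmod.
rewrite (Qmx_mul c hz) Gb_dvec; last by rewrite /Defs.gammaring; mem.
apply/colP => s; rewrite mxE [RHS]mxE mxE /Defs.gammaring (ipNr hn) ?opprK //; mem.
Qed.

(** * The Nevanlinna function $\mathcal Q$ *)

Lemma rho_l1 z : 'Im z != 0 -> rho K1x l1 z.
Proof.
move=> z1; split.
  move=> y hy; have [x hx] := l1_onto z1 hy; exists x; split => // x' hx'.
  apply/eqP; rewrite -subr_eq0; apply/eqP.
  apply: (im_inj K1x_inner l1_adj (z := z)) => //.
  by have := relB l1_sub hx hx'; congr (l1 (_, _)); lmod.
exists `|'Im z|^-1 => -[x y] h.
have := im_bound K1x_inner z l1_adj h.
by rewrite ler_pdivlMl ?normr_gt0.
Qed.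

Lemma r1_identity z w y : rho K1x l1 z -> rho K1x l1 w -> K1 y ->
  r1 w y - r1 z y = (w - z) *: r1 w (r1 z y).
Proof.
move=> hz hw hy; have hv := r1_K1 hz hy.
have hs : K1 ((w - z) *: r1 z y) by mem.
transitivity (r1 w ((w - z) *: r1 z y)).
  apply: r1_eq => //.
  have := relB l1_sub (r1P hw hy) (r1P hz hy); congr (l1 (_, _)); lmod.
apply/esym/r1_eq => //.
have := relZ l1_sub (w - z) (r1P hw hv); congr (l1 (_, _)); lmod.
Qed.

Lemma r1_norm w y : 'Im w != 0 -> K1 y -> hnorm K1x (r1 w y) <= hnorm K1x y / `|'Im w|.
Proof.
move=> w1 hy; have := im_bound K1x_inner w l1_adj (r1P (rho_l1 w1) hy).
by rewrite addrK ler_pdivlMr ?normr_gt0 // mulrC.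
Qed.

(** The resolvent identity used twice writes the remainder after the linear term as $(w-z)^2$ times
    the inner product of [fs i] with [r1 w v2]. *)
Lemma Qmx_derivable z i j : 'Im z != 0 ->
  derivable (fun w : C^o => Qmx w i j : C^o) z 1.
Proof.
move=> z1; have hz := rho_l1 z1; have hf := fs_K1 i; have hg := fs_K1 j.
pose v := r1 z (fs j); pose v2 := r1 z v.
have hv : K1 v by apply: r1_K1. have hv2 : K1 v2 by apply: r1_K1.
have nf := hnorm_ge0 K1x_inner hf; have nv := hnorm_ge0 K1x_inner hv2.
have zp : 0 < `|'Im z| by rewrite normr_gt0.
(* Within [|Im z| / 2] of [z] the imaginary part of [w] keeps modulus at least [|Im z| / 2], so the
   resolvent at [w] has norm at most [2 / |Im z|], the factor in [K]. *)
apply: (derivable_quadratic (a := ipn (fs i) v2) (e := `|'Im z| / 2)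
  (K := hnorm K1x (fs i) * (hnorm K1x v2 * (2 / `|'Im z|)))).
- by rewrite divr_gt0.
- by rewrite !mulr_ge0 ?invr_ge0.
move=> w hw.
have wz : `|'Im z| / 2 <= `|'Im w|.
  have h1 : `|'Im z| <= `|'Im w| + `|w - z|.
    have -> : 'Im z = 'Im w - 'Im (w - z) by rewrite raddfB /= opprB addrC subrK.
    by apply: le_trans (ler_normB _ _) _; rewrite lerD2l; exact: norm_Im_le.
  rewrite -(lerD2r (`|'Im z| / 2)) -splitr; apply: le_trans h1 _.
  by rewrite lerD2l ltW.
have wp : 0 < `|'Im w| by apply: lt_le_trans wz; rewrite divr_gt0.
have w1 : 'Im w != 0 by rewrite -normr_gt0.
have hwr := rho_l1 w1.
have -> : Qmx w i j - Qmx z i j - (w - z) * ipn (fs i) v2 =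
    (w - z) ^+ 2 * ipn (fs i) (r1 w v2).
  have QE u : Qmx u i j = ipn (fs i) (r1 u (fs j)) by rewrite mxE.
  have e1 := r1_identity hz hwr hg; have e2 := r1_identity hz hwr hv.
  have h1 : Hn S m (r1 w (fs j)) by have := r1_K1 hwr hg; mem.
  have h2 : Hn S m (r1 z (fs j)) by have := r1_K1 hz hg; mem.
  have h3 : Hn S m (r1 w v) by have := r1_K1 hwr hv; mem.
  have h4 : Hn S m v2 by mem. have h5 : Hn S m (r1 w v2) by have := r1_K1 hwr hv2; mem.
  have h6 : Hn S m (fs i) by mem.
  rewrite !QE -(ipBr hn h6 h1 h2) e1 (ipZr hn _ h6 h3) -mulrBr -(ipBr hn h6 h3 h4) e2.
  by rewrite (ipZr hn _ h6 h5) mulrA.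
rewrite normrM normrX mulrC ler_wpM2r ?exprn_ge0 //.
have hr := r1_K1 hwr hv2.
apply: le_trans (cauchy_schwarz K1x_inner hf hr) _; rewrite ler_wpM2l //.
apply: le_trans (r1_norm w1 hv2) _; rewrite ler_wpM2l //.
by rewrite -[2 / _]invf_div lef_pV2 ?posrE // divr_gt0.
Qed.

Lemma nevanlinna_Qmx : nevanlinna Qmx.
Proof.
move=> z z1; have hz := rho_l1 z1; have hz' := rho_l1 (neq0_Im z1).
split; first by move=> i j; exact: Qmx_derivable.
  apply/matrixP => s s'; rewrite mxadjE [in LHS]mxE [RHS]mxE.
  have e := l1_sym (r1P hz (fs_K1 s)) (r1P hz' (fs_K1 s')).
  have h1 : Hn S m (r1 z (fs s)) by have := r1_K1 hz (fs_K1 s); mem.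
  have h2 : Hn S m (r1 z^* (fs s')) by have := r1_K1 hz' (fs_K1 s'); mem.
  have h3 : Hn S m (fs s) by mem. have h4 : Hn S m (fs s') by mem.
  rewrite (ipDl hn) ?(ipDr hn) ?(ipZl hn) ?(ipZr hn) // in e; try mem.
  by move/addIr: e => ->; rewrite -(ipC hn h4 h1).
move=> c; set k := r1 z (kmin c).
have hk : l1 (k, kmin c + z *: k) := r1P hz (kmin_K1 c).
have hk1 : K1 k by case/l1P: hk.
have nk : Hn S m k by mem. have nc : Hn S m (kmin c) by mem.
have qE : dotc c (Qmx z *m c) = ipn (kmin c) k.
  rewrite (Qmx_mul c hz) kmin_sum (ip_suml hn) //; try mem.
  by apply: eq_bigr => s _; rewrite [X in _ * X]mxE (ipZl hn) //; mem.
have e := l1_sym hk hk; rewrite (ipDl hn) ?(ipDr hn) ?(ipZl hn) ?(ipZr hn) // in e; try mem.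
(* Symmetry of [l1] at [k] gives $\langle k_{\min}(c),k\rangle-\langle k,k_{\min}(c)\rangle=(z-\bar
   z)\|k\|^2$, so division by ['Im z] leaves a squared norm. *)
have -> : dotc c (mxIm (Qmx z) *m c) = 'Im z * ipn k k.
  rewrite /mxIm -scalemxAl dotcZr mulmxBl dotcBr dotc_adjr (dotcC c) qE -(ipC hn nc nk).
  have -> : ipn (kmin c) k - ipn k (kmin c) = (z - z^*) * ipn k k.
    by rewrite mulrBl -[ipn (kmin c) k](addrK (z^* * ipn k k)) e; ring.
  rewrite ImE mulrA; congr (_ * _).
  have i0 : ('i : C) != 0 by exact: neq0Ci.
  have ii : ('i : C)^-1 = - 'i by rewrite invCi.
  by rewrite invfM ii; ring.
rewrite mulrC mulrA mulVf // mul1r; exact: (ip_ge0 hn).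
Qed.

End ModelTheory.

Theorem theorem4p4 (R : realType) (S : scale_data R) (hS : is_scale S)
  (m d : nat) (hm : (2 <= m)%N) (hd : (1 <= d)%N)
  (phi : 'I_d -> sX S)
  (hphi : forall s, Hn S m.+2 (phi s) /\ ~ Hn S m.+1 (phi s))
  (hphi_indep : lin_indep phi)
  (hLmin : [/\ closed_rel (Hp S m) (Lmin m phi),
               is_dense (Hp S m) (rdom (Lmin m phi)),
               symmetric_rel (Hp S m) (Lmin m phi)
             & defect (Hp S m) (Lmin m phi) d])
  (phic : 'I_d -> sX S -> R[i])
  (hphic_lin : forall s a f g, Hp S m f -> Hp S m g ->
     phic s (a *: f + g) = a * phic s f + phic s g)
  (hphic_ext : forall s f, Hp S m.+2 f -> phic s f = spair (phi s) f)
  (hR : nevanlinna (Rmx m phi phic))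
  (zs : 'I_m -> R[i]) (hzs_inj : injective zs)
  (hzs : forall j, rhoL S (zs j))
  (hC_unit : Cmx phi zs \in unitmx)
  (hC : forall s, fs phi zs s = \sum_s' Cmx phi zs s' s *: es m phi s')
  (K1 : set (sX S)) (hK1 : is_subspace K1)
  (hKmin : Kmin phi zs `<=` K1) (hKmax : K1 `<=` Kmax phi phic zs) :
  nevanlinna (Qmx phi zs K1) /\
  (* 1) *)
  (boundary_triple (Hcal phi zs) (Bmax phi zs K1) (GammaB phi phic zs K1) /\
   gamma_weyl_given_by (Hcal phi zs) (GammaB phi phic zs K1)
     (rho (H1 phi zs K1) (calB0 phi zs K1))
     (gammaB phi zs K1) (weylB phi phic zs K1)) /\
  (* 2) *)
  (boundary_triple_op (H1 phi zs K1) (calBmax phi zs K1)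
     (GammacalB phi phic zs K1) /\
   gamma_weyl_given_by (H1 phi zs K1)
     (on_graph (calBmax phi zs K1) (GammacalB phi phic zs K1))
     (rho (H1 phi zs K1) (calB0 phi zs K1))
     (gammaB phi zs K1) (weylB phi phic zs K1)) /\
  (* 3) *)
  (([/\ is_op (l1ring phi zs K1),
        closed_rel (K1x m K1) (l1ring phi zs K1),
        symmetric_rel (K1x m K1) (l1ring phi zs K1)
      & defect (K1x m K1) (l1ring phi zs K1) d] /\
    l1ringadj phi zs K1 =
      ssum (l1 phi zs K1) [set p | p.1 = 0 /\ Kmin phi zs p.2] /\
    (forall z, rho (K1x m K1) (l1 phi zs K1) z ->
       eigspace (l1ringadj phi zs K1) z =
         resolvent (l1 phi zs K1) z @` Kmin phi zs)) /\
   boundary_triple (K1x m K1) (l1ringadj phi zs K1) (Gammaring phi zs K1) /\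
   gamma_weyl_given_by (K1x m K1) (Gammaring phi zs K1)
     (rho (K1x m K1) (l1 phi zs K1))
     (gammaring phi zs K1) (Qmx phi zs K1)).
Proof.
have [_ dense _ _] := hLmin.
split; first exact: (nevanlinna_Qmx hS hm hphi hphi_indep dense hzs_inj hzs hphic_lin hphic_ext hR hK1 hKmin hKmax).
split; first exact: (triple_Bmax hS hm hphi hphi_indep dense hzs_inj hzs hC hphic_lin hphic_ext hR hK1 hKmin hKmax).
split; first exact: (triple_calBmax hS hm hphi hphi_indep dense hzs_inj hzs hC hphic_lin hphic_ext hR hK1 hKmin hKmax).
split; last exact: (triple_l1ringadj hS hm hphi hphi_indep dense hzs_inj hzs hphic_lin hphic_ext hR hK1 hKmin hKmax).
split; first exact: (l1ring_symmetric hS hm hphi hphi_indep dense hzs_inj hzs hphic_lin hphic_ext hR hK1 hKmin hKmax).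
split; first exact: (l1ringadj_ssum hS hm hphi hphi_indep dense hzs_inj hzs hphic_lin hphic_ext hR hK1 hKmin hKmax).
move=> z hz.
exact: (eigspace_l1ringadj hS hm hphi hphi_indep dense hzs_inj hzs hphic_lin hphic_ext hR hK1 hKmin hKmax hz).
Qed.
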